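(* Suppose that $\sup_{t\in[0,T]}\beta^\pm_t\in L^1([0,1]^2)$ and $\int_{[0,1]^2}\sup_{t\in[0,T]}|\beta^{n,\pm}_t(x,y)-\beta^\pm_t(x,y)|\,dx\,dy\to0$ as $n\to\infty$. Then for any $t\in(0,T]$, $H^n_t$ converges to $w_t:=\beta^+_t/(\beta^+_t+\beta^-_t)$ almost surely in the weak topology on $\mathcal S_0$. Moreover, for any finite $\mathcal T\subseteq(0,T]$, the sequence $\{(H^n_t)_{t\in\mathcal T}:n\ge1\}$ satisfies a large deviation principle in the $|\mathcal T|$-fold product of $\mathcal S_0$ (with the weak topology), with speed $n^2$ and rate function $$I^{(\beta^+,\beta^-)}_{\mathrm{point},\mathcal T}\big((f_t)_{t\in\mathcal T}\big)=\sum_{t\in\mathcal T}\int_{[0,1]^2}\mathcal Q_2\big(f_t(x,y),w_t(x,y)\big)\,dx\,dy,\qquad f_t\in\mathcal S_0,\ t\in\mathcal T,$$ where $\mathcal Q_2:[0,1]\times(0,1)\to\mathbb R$ is $\mathcal Q_2(u,v)=u\log\frac uv+(1-u)\log\frac{1-u}{1-v}$, with $0\cdot\log0=0$.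
   Context: Fix $T\in(0,\infty)$; write $[0,1]^2_T=[0,1]^2\times[0,T]$ and $[n]=\{1,\dots,n\}$. All $L^p$ spaces are with respect to Lebesgue measure. Let $Q^n_1=[0,1/n]$, $Q^n_i=((i-1)/n,i/n]$ for $2\le i\le n$, and $Q^n_{i,j}=Q^n_i\times Q^n_j$. Rates. $\beta^+,\beta^-:[0,1]^2\times[0,T]\to[0,\infty)$ are measurable, with $\beta^\pm_t(x,y)=\beta^\pm(x,y,t)$. For each $n$ and $i,j\in[n]$, $\beta^{n,\pm}_{i,j}:[0,T]\to[0,\infty)$ are measurable and $\beta^{n,\pm}_t(x,y)=\beta^{n,\pm}(x,y,t)=\sum_{i,j=1}^n\beta^{n,\pm}_{i,j}(t)\mathbf 1_{Q^n_{i,j}}(x,y)$. Standing assumptions: (a) $\beta^{n,\pm},\beta^\pm\in L^1([0,1]^2_T)$ and $\beta^{n,\pm}\to\beta^\pm$ in $L^1([0,1]^2_T)$; (b) there is $c_\beta>0$ with $\beta^{n,\pm}_{i,j}(t)\ge c_\beta$ for all $n\ge1$, $i,j\in[n]$, $t\in[0,T]$; (c) $t\mapsto\beta^\pm_t(x,y)$ is bounded and left-continuous for a.e. $(x,y)\in[0,1]^2$, and $t\mapsto\beta^{n,\pm}_{i,j}(t)$ is bounded and left-continuous for all $i,j\in[n]$ and all large enough $n$. Graph process. $a(n)\in(0,\infty)$ with $a(n)\to\infty$. For each $n$, $\{X^n_{i,j}(t):t\in[0,T]\}_{i,j\in[n]}$ are $n^2$ mutually independent (càdlàg) Markov chains on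 $\{0,1\}$, with deterministic initial values $X^n_{i,j}(0)=x^n_{i,j}\in\{0,1\}$, jumping at time $t$ from $0$ to $1$ at rate $a(n)\beta^{n,+}_{i,j}(t)$ and from $1$ to $0$ at rate $a(n)\beta^{n,-}_{i,j}(t)$; all are defined on one probability space $(\Omega,\mathcal F,\mathbb P)$. Put $H^n_t(x,y)=\sum_{i,j=1}^nX^n_{i,j}(t)\mathbf 1_{Q^n_{i,j}}(x,y)$. $\mathcal S_0$ is the set of measurable $f:[0,1]^2\to\mathbb R$ with $0\le f\le1$ a.e. (identified if equal a.e.). The weak topology on $\mathcal S_0$ is inherited from the weak topology of $L^2([0,1]^2)$; it is compact and metrizable. LDP. For a metric space $S$, a rate function is $I:S\to[0,\infty]$ with $\{I\le r\}$ compact for every $r<\infty$. $S$-valued random variables $Y_n$ satisfy an LDP with speed $b(n)>0$ and rate function $I$ if $\limsup_n b(n)^{-1}\log\mathbb P(Y_n\in F)\le-\inf_FI$ for all closed $F$ and $\liminf_nb(n)^{-1}\log\mathbb P(Y_n\in G)\ge-\inf_GI$ for all open $G$. *)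

(* Defs.v *)
From HB Require Import structures.
From mathcomp Require Import all_boot all_order all_algebra finmap.
From mathcomp Require Import all_classical all_reals all_analysis.
From mathcomp Require Import measurable_realfun.
Set Implicit Arguments.
Unset Strict Implicit.
Unset Printing Implicit Defensive.
Import Order.TTheory GRing.Theory Num.Theory.
Import numFieldNormedType.Exports.
Local Open Scope classical_set_scope.
Local Open Scope ring_scope.

(* [measurableTypeR R] is convertible to [R]; it is the carrier on which
   [lebesgue_measure] is declared. *)
Notation plane R := (measurableTypeR R * measurableTypeR R)%type.
Notation space R := (plane R * measurableTypeR R)%type.

Section Square.
Context {R : realType}.

Definition unit_sq : set (plane R) := `[0, 1] `*` `[0, 1].

Definition unit_sqT (T : R) : set (space R) := unit_sq `*` `[0, T].

Lemma measurable_unit_sq : measurable unit_sq.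
Proof. by apply: measurableX; exact: measurable_itv. Qed.

Definition leb2 : {measure set (plane R) -> \bar R} :=
  (@lebesgue_measure R \x @lebesgue_measure R)%E.

Definition leb3 : {measure set (space R) -> \bar R} :=
  (leb2 \x @lebesgue_measure R)%E.

(* Lebesgue measure on [0,1]^2, as a measure on the plane carried by the
   square: functions on the plane up to [leb_sq]-a.e. equality are functions
   on [0,1]^2 up to Lebesgue-a.e. equality. *)
Definition leb_sq : {measure set (plane R) -> \bar R} :=
  mrestr leb2 measurable_unit_sq.

Lemma leb_sqT : (leb_sq [set: plane R] < +oo)%E.
Proof.
rewrite /leb_sq /= /mrestr setTI /leb2 /unit_sq.
rewrite product_measure1E; [|exact: measurable_itv..].
by rewrite /= !lebesgue_measure_itv /= lte_fin ltr01 oppr0 adde0 mule1 ltry.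
Qed.

Definition L2 := LspaceType2 leb_sq.
HB.instance Definition _ := gen_eqMixin L2.
HB.instance Definition _ := gen_choiceMixin L2.

Definition inner (f g : L2) : R := \int[leb_sq]_p (f p * g p).

(* Coarsest topology on L^2 making every [inner ^~ g] continuous. *)
Definition weakL2 : Type := initial_topology (inner : L2 -> {ptws L2 -> R}).
HB.instance Definition _ := Topological.on weakL2.

Definition S0 : set weakL2 :=
  [set f : L2 | {ae leb_sq, forall p, 0 <= f p <= 1}].

End Square.

Section Step.
Context {R : realType}.

(* The index [i : 'I_n] stands for the [i.+1]-st interval. *)
Definition cell n (i : 'I_n) : set (measurableTypeR R) :=
  if i == 0%N :> nat then `[0, n%:R^-1]%classic
  else `](i%:R / n%:R), (i.+1%:R / n%:R)]%classic.

Definition step n (b : 'I_n -> 'I_n -> R) (p : plane R) : R :=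
  \sum_(i < n) \sum_(j < n) b i j * \1_(cell i `*` cell j) p.

Lemma measurable_cell n (i : 'I_n) : measurable (cell i).
Proof. by rewrite /cell; case: ifP => _; exact: measurable_itv. Qed.

Lemma measurable_step n (b : 'I_n -> 'I_n -> R) :
  measurable_fun [set: plane R] (step b : plane R -> measurableTypeR R).
Proof.
apply: (@measurable_sum _ (plane R) R) => i.
apply: (@measurable_sum _ (plane R) R) => j.
apply: measurable_funM; first exact: measurable_cst.
by apply: measurable_indic; apply: measurableX; exact: measurable_cell.
Qed.

Lemma cell_inj n (i j : 'I_n) (x : R) : cell i x -> cell j x -> i = j.
Proof.
wlog ij : i j / (i < j)%N.
  move=> H ci cj; have [ij|ji|/val_inj//] := ltngtP i j; first exact: H.
  by apply/esym/H.
have n0 : 0 < n%:R^-1 :> R by rewrite invr_gt0 ltr0n (leq_ltn_trans _ (ltn_ord i)).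
have xi : cell i x -> x <= i.+1%:R / n%:R.
  rewrite /cell; case: ifPn => [/eqP ->|_] /=.
    by rewrite in_itv /= mul1r => /andP[].
  by rewrite in_itv /= => /andP[].
move=> /xi {}xi; rewrite /cell (gtn_eqF (leq_ltn_trans _ ij))// /=.
rewrite in_itv /= => /andP[jx _].
have := lt_le_trans jx xi.
by rewrite ltr_pM2r// ltr_nat ltnS leqNgt ij.
Qed.

Lemma step01 n (x : 'I_n -> 'I_n -> bool) (p : plane R) :
  0 <= step (fun i j => (x i j)%:R) p <= 1.
Proof.
apply/andP; split.
  by apply: sumr_ge0 => i _; apply: sumr_ge0 => j _; rewrite mulr_ge0.
rewrite /step pair_bigA /=.
have [[[i j] /= cij]|no] :=
    pselect (exists k : 'I_n * 'I_n, (cell k.1 `*` cell k.2) p); last first.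
  rewrite big1 // => -[i j] _ /=; rewrite indicE memNset ?mulr0// => cij.
  by apply: no; exists (i, j).
rewrite (bigD1 (i, j)) //= big1 ?addr0.
  rewrite indicE mem_set// mulr1; by case: (x i j).
move=> [k l] /= /eqP kl; rewrite indicE memNset ?mulr0// => -[/= ck cl].
case: cij => ci cj; apply: kl.
by rewrite (cell_inj ck ci) (cell_inj cl cj).
Qed.

Section Graphon.
Context (n : nat) (x : 'I_n -> 'I_n -> bool).

Let f : plane R -> measurableTypeR R := step (fun i j => (x i j)%:R).

HB.instance Definition _ := @isMeasurableFun.Build _ _ _ _ f (measurable_step _).

Definition graphon_class : {mfun_ leb_sq, plane R >-> measurableTypeR R} :=
  \pi_({mfun_ leb_sq, plane R >-> measurableTypeR R})%qT
    (f : {mfun plane R >-> measurableTypeR R}).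

Lemma graphon_classE :
  {ae leb_sq, forall p, graphon_class p = step (fun i j => (x i j)%:R) p}.
Proof.
have /eqP := reprK graphon_class; rewrite eqmodE => /asboolP.
by apply: filterS => p /(_ I).
Qed.

Lemma graphon_class01 : {ae leb_sq, forall p, 0 <= graphon_class p <= 1}.
Proof. by apply: filterS graphon_classE => p ->; exact: step01. Qed.

Lemma graphon_class_L2 : finite_norm leb_sq 2%:R%:E graphon_class.
Proof.
rewrite /finite_norm unlock; apply: poweR_lty.
apply: (@le_lt_trans _ _ (\int[leb_sq]_p (cst 1 p))%E); last first.
  by rewrite integral_cst// mul1e leb_sqT.
apply: ae_ge0_le_integral => //.
- by move=> p _; exact: poweR_ge0.
- apply: (measurableT_comp (measurable_poweR _)).
  apply: measurableT_comp => //.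
  by apply/measurable_EFinP; exact: (measurable_funPT (repr graphon_class)).
- apply: filterS graphon_class01 => p /andP[p0 p1] _ /=.
  by rewrite lee_fin powR_mulrn// ger0_norm// expr_le1.
Qed.

HB.instance Definition _ :=
  @isFinLebesgue.Build _ _ _ _ _ (lee1n 2) graphon_class graphon_class_L2.

Definition graphon : S0 :=
  exist _ (graphon_class : weakL2) (mem_set graphon_class01).

End Graphon.
End Step.

Section Rates.
Context {R : realType}.

Definition left_continuous (T : R) (f : R -> R) :=
  forall t, 0 < t <= T -> f s @[s --> t^'-] --> f t.

(* One of the two signs of the rates: [b p t] is the limiting rate at the
   point [p] and the time [t], [bn n i j t] the rate of the pair [(i, j)]. *)
Record standing_rates (T c : R) (b : plane R -> R -> R)
    (bn : forall n, 'I_n -> 'I_n -> R -> R) : Prop := {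
  rate_ge0 : forall p t, unit_sq p -> 0 <= t <= T -> 0 <= b p t ;
  rate_measurable : measurable_fun (unit_sqT T) (fun z => b z.1 z.2) ;
  raten_measurable : forall n i j, measurable_fun `[0, T] (bn n i j) ;
  rate_L1 : leb3.-integrable (unit_sqT T) (fun z => (b z.1 z.2)%:E) ;
  raten_L1 : forall n, leb3.-integrable (unit_sqT T)
    (fun z => (step (fun i j => bn n i j z.2) z.1)%:E) ;
  raten_cvg :
    (\int[leb3]_(z in unit_sqT T)
       `|step (fun i j => bn n i j z.2) z.1 - b z.1 z.2|%:E)%E @[n --> \oo]
      --> 0%E ;
  raten_ge : forall n i j t, 0 <= t <= T -> c <= bn n i j t ;
  rate_regular : {ae leb_sq, forall p,
    [bounded b p t | t in `[0, T]] /\ left_continuous T (b p)} ;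
  raten_regular : \forall n \near \oo, forall i j : 'I_n,
    [bounded bn n i j t | t in `[0, T]] /\ left_continuous T (bn n i j)
}.

(* The suprema below are a priori only Lebesgue measurable, whereas the
   library's sigma-algebra is the Borel one.  The integral of a nonnegative
   function is the supremum of the integrals of the simple functions below it,
   so it is the Lebesgue integral as soon as the integrand is a.e. equal to a
   Borel function, which left-continuity of the rates ensures (for large [n]
   as regards [unif_rate_cvg]). *)
Record uniform_rates (T : R) (b : plane R -> R -> R)
    (bn : forall n, 'I_n -> 'I_n -> R -> R) : Prop := {
  sup_rate_L1 :
    (\int[leb2]_(p in unit_sq)
       ereal_sup [set (b p t)%:E | t in `[0%R, T]] < +oo)%E ;
  unif_rate_cvg :
    (\int[leb2]_(p in unit_sq)
       ereal_sup [set `|step (fun i j => bn n i j t) p - b p t|%:E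
                 | t in `[0%R, T]])%E @[n --> \oo]
      --> 0%E
}.

Definition limit_graphon (bp bm : plane R -> R -> R) (t : R) (p : plane R) : R :=
  bp p t / (bp p t + bm p t).

(* [ln] vanishes on nonpositive numbers, so that [0 * ln 0 = 0]. *)
Definition Q2 (u v : R) : R :=
  u * ln (u / v) + (1 - u) * ln ((1 - u) / (1 - v)).

Definition Ipoint (bp bm : plane R -> R -> R) (Ts : {fset R})
    (f : {ptws Ts -> @S0 R}) : \bar R :=
  (\sum_(t : Ts) \int[leb2]_(p in unit_sq)
     (Q2 (val (f t) p) (limit_graphon bp bm (val t) p))%:E)%E.

End Rates.

Section Chains.
Context {R : realType} d (Om : measurableType d) (P : probability Om R).
Implicit Types (X : R -> Om -> bool) (s t u : R).

Definition history X s : set (set Om) :=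
  <<s [set A | exists2 u, 0 <= u <= s & exists B : set bool, A = X u @^-1` B] >>.

Definition cadlag (T : R) (f : R -> bool) :=
  (forall t, 0 <= t < T -> f s @[s --> t^'+] --> f t) /\
  (forall t, 0 < t <= T -> cvg (f s @[s --> t^'-])).

(* Kolmogorov's forward equation on {0, 1}, in integrated form since the rates
   are only measurable in time; [q u x] is the rate at which the chain leaves
   the state [x] at time [u], and [p s t x y] the probability to be in [y] at
   time [t] starting from [x] at time [s]. *)
Record transition_function (T : R) (q : R -> bool -> R)
    (p : R -> R -> bool -> bool -> R) : Prop := {
  trans_ge0 : forall s t x y, 0 <= s -> s <= t -> t <= T -> 0 <= p s t x y ;
  trans_sum1 : forall s t x, 0 <= s -> s <= t -> t <= T ->
    p s t x false + p s t x true = 1 ;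
  trans_measurable : forall s x y, 0 <= s -> s <= T ->
    measurable_fun `[s, T] (fun u => p s u x y) ;
  trans_forward : forall s t x y, 0 <= s -> s <= t -> t <= T ->
    p s t x y = (x == y)%:R +
      \int[@lebesgue_measure R]_(u in `[s, t])
        (p s u x (~~ y) * q u (~~ y) - p s u x y * q u y)
}.

Record jump_chain (T : R) (q : R -> bool -> R) (x0 : bool) X : Prop := {
  chain_measurable : forall t, 0 <= t <= T -> measurable_fun [set: Om] (X t) ;
  chain_init : forall w, X 0 w = x0 ;
  chain_cadlag : forall w, cadlag T (X ^~ w) ;
  chain_markov : exists2 p, transition_function T q p &
    forall s t A x y, 0 <= s -> s <= t -> t <= T -> history X s A ->
      P (A `&` X s @^-1` [set x] `&` X t @^-1` [set y]) =
      (P (A `&` X s @^-1` [set x]) * (p s t x y)%:E)%E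
}.

(* Since each sigma-algebra contains the whole space, the product rule over
   the full index set yields the product rule over every subfamily. *)
Definition independent_processes (I : finType) (T : R)
    (X : I -> R -> Om -> bool) :=
  forall A : I -> set Om, (forall i, history (X i) T (A i)) ->
    P (\bigcap_i A i) = (\prod_(i : I) fine (P (A i)))%:E.

End Chains.

Section LDP.
Context {R : realType} {S : topologicalType}.

Definition rate_function (I : S -> \bar R) :=
  (forall s, (0 <= I s)%E) /\
  (forall r : R, compact [set s | (I s <= r%:E)%E]).

Record satisfies_LDP d (Om : measurableType d) (P : probability Om R)
    (Y : nat -> Om -> S) (b : nat -> R) (I : S -> \bar R) : Prop := {
  ldp_speed : forall n, (0 < n)%N -> 0 < b n ;
  ldp_measurable : forall n (U : set S), open U -> measurable (Y n @^-1` U) ;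
  ldp_rate : rate_function I ;
  ldp_upper : forall F : set S, closed F ->
    (limn_esup (fun n => (b n)^-1%:E * lne (P (Y n @^-1` F)))
       <= - ereal_inf (I @` F))%E ;
  ldp_lower : forall G : set S, open G ->
    (- ereal_inf (I @` G)
       <= limn_einf (fun n => (b n)^-1%:E * lne (P (Y n @^-1` G))))%E
}.

End LDP.

(* Main.v *)
From HB Require Import structures.
Require Import Defs.
From mathcomp Require Import all_boot all_order all_algebra finmap.
From mathcomp Require Import all_classical all_reals all_analysis.
From mathcomp Require Import measurable_realfun ring lra.
Set Implicit Arguments.
Unset Strict Implicit.
Unset Printing Implicit Defensive.
Import Order.TTheory GRing.Theory Num.Theory.
Import numFieldNormedType.Exports.
Local Open Scope classical_set_scope.
Local Open Scope ring_scope.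

(** Each chain forgets its past at rate [a n]: two solutions of Kolmogorov's
    forward equation on [[s, t]] differ at time [t] by at most
    [1 / (1 + 2 a(n) c (t - s))], and the occupation probability follows the
    ratio of the rates.  Hence the joint law of the states at finitely many
    times is squeezed between two (not quite normalised) product weights whose
    marginals converge to [w_t] in L^1, and both claims reduce to
    statements about such weights on [{0, 1}]-valued step functions.

    Chernoff's bound for the pairing with a test function [g] gives the exponent
    [int f g - int log (1 - w + w e^g)], whose supremum over [g] is the relative
    entropy [int Q2(f, w)]; compactness of the space of graphons in the weak
    topology turns this into the upper bound for closed sets, and the same bound
    with Borel-Cantelli gives the almost sure convergence.  For the lower bound
    the weights are tilted by a truncation of the optimal [g], under which the
    graphon concentrates around [f].  All test functions are approximated in L^1
    by functions constant on the cells. *)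

(** * Scalar estimates on the entropy and the exponential tilt *)

(** Uniformity shapes the estimates. The law of the states is known only up to two families of
    weights that vary with [n], so every bound is stated for all weights within L^1 distance [eta]
    of the limit, with [eta] chosen before [n].

    The rates are bounded below but not above, so w_t may come arbitrarily close to 0 and 1, and f
    may take these values. The optimal g, the difference of the logits of f and w, is then
    unbounded. It is truncated by deforming the odds ratio in such a way that the entropy of the
    tilted profile never exceeds that of f: the cost of a tilt is bounded without passing to the
    limit.

    The relaxation bound is 1/(1 + x) and not exp(-x): it follows from an elementary argument on
    integral equations with measurable rates, and it suffices because a(n) tends to infinity.

    Compactness comes from setwise limits along an ultrafilter of the measures with density f,
    followed by Radon-Nikodym. Pointwise control of the rates over a time interval goes through
    exceptional sets defined with rational times only, which are measurable; left-continuity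
    restores the other times. *)

Section Scalar.
Context {R : realType}.
Implicit Types (u v g x y K eps : R).

Lemma ln_le_subr1 x : 0 < x -> ln x <= x - 1.
Proof.
by move=> x0; have := @le_ln1Dx R (x - 1); rewrite [1 + _]addrC subrK; apply; lra.
Qed.

Lemma ln_lip m x y : 0 < m -> m <= x -> m <= y -> `|ln x - ln y| <= `|x - y| / m.
Proof.
move=> m0; wlog xy : x y / y <= x => [H mx my|mx my].
  by have [|/ltW] := leP y x => xy; [|rewrite distrC [in leRHS]distrC]; exact: H.
have y0 := lt_le_trans m0 my; have x0 := lt_le_trans m0 mx.
rewrite ger0_norm ?subr_ge0 ?ler_ln// ger0_norm ?subr_ge0// -ln_div//.
apply: (le_trans (ln_le_subr1 (divr_gt0 x0 y0))).
rewrite -[X in _ - X](@divff _ y) ?gt_eqF// -mulrBl ler_wpM2l ?subr_ge0//.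
by rewrite lef_pV2.
Qed.

Lemma expR_lip K x y : x <= K -> y <= K -> `|expR x - expR y| <= expR K * `|x - y|.
Proof.
wlog xy : x y / y <= x => [H mx my|mx my].
  by have [|/ltW] := leP y x => xy; [|rewrite distrC [in leRHS]distrC]; exact: H.
rewrite ger0_norm ?subr_ge0 ?ler_expR// ger0_norm ?subr_ge0//.
have -> : expR x - expR y = expR x * (1 - expR (y - x)).
  by rewrite mulrBr mulr1 -expRD [x + _]addrC subrK.
apply: ler_pM; rewrite ?expR_ge0 ?ler_expR//.
  by rewrite subr_ge0 -expR0 ler_expR; lra.
by have := expR_ge1Dx (y - x); lra.
Qed.

(** Inverting e^(-x) >= 1 - x gives e^x <= 1/(1 - x), and (1 + x + 2 x^2)(1 - x) - 1 = x^2 (1 - 2x)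
    is nonnegative for x <= 1/2. *)
Lemma expR_le_quad x : x <= 2^-1 -> expR x <= 1 + x + 2 * x ^+ 2.
Proof.
move=> x2; have := expR_ge1Dx (- x) => h.
have h1 : 0 < 1 - x by lra.
have : expR x * (1 - x) <= 1.
  by rewrite -[leRHS](expRxMexpNx_1 x) ler_wpM2l ?expR_ge0.
rewrite -ler_pdivlMr// => /le_trans; apply.
by rewrite ler_pdivrMr// -subr_ge0; nra.
Qed.

(** The difference has numerator x'(y' - y) + y'(x - x'), whose weights are at most x' + y'. This
    cancels the second denominator, so only the first one needs a quantitative lower bound. *)
Lemma frac_lip m x y x' y' : 0 < m -> m <= x + y -> 0 <= x' -> 0 <= y' ->
  0 < x' + y' ->
  `|x / (x + y) - x' / (x' + y')| <= (`|x - x'| + `|y - y'|) / m.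
Proof.
move=> m0 mxy x0 y0 s0.
have s1 := lt_le_trans m0 mxy.
have -> : x / (x + y) - x' / (x' + y') =
    (x' * (y' - y) + y' * (x - x')) / ((x + y) * (x' + y')).
  by field; rewrite !gt_eqF.
rewrite normrM normfV (gtr0_norm (mulr_gt0 s1 s0)).
rewrite ler_pdivrMr ?mulr_gt0//.
apply: (@le_trans _ _ ((x' + y') * (`|x - x'| + `|y - y'|))).
  apply: (le_trans (ler_normD _ _)).
  rewrite !normrM !(ger0_norm x0) !(ger0_norm y0) (distrC y').
  have := normr_ge0 (x - x'); have := normr_ge0 (y - y'); nra.
have n0 : 0 <= (`|x - x'| + `|y - y'|) * (x' + y').
  by rewrite mulr_ge0 ?addr_ge0.
have : 1 <= (x + y) / m by rewrite ler_pdivlMr ?mul1r.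
rewrite [(x' + y') * _]mulrC [X in _ -> _ <= X](_ : _ =
  (`|x - x'| + `|y - y'|) * (x' + y') * ((x + y) / m)); last first.
  by field; rewrite gt_eqF.
by move=> h; rewrite ler_peMr.
Qed.

(** When v0 + v1 = 1, these are the log-moment generating function at g of a Bernoulli variable of
    parameter v1, and its parameter after the exponential tilt by g. The two masses are separate
    arguments because the weights that sandwich the law do not sum to one. *)
Definition logmgf (v0 v1 g : R) := ln (v0 + v1 * expR g).
Definition tilt (v0 v1 g : R) := v1 * expR g / (v1 * expR g + v0).

Section Lip.
Variables (K v0 v1 w0 w1 g h : R).
Hypotheses (v0_ge0 : 0 <= v0) (v1_ge0 : 0 <= v1) (v01 : 2^-1 <= v0 + v1).
Hypotheses (w0_ge0 : 0 <= w0) (w1_ge0 : 0 <= w1) (w01 : w0 + w1 = 1).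
Hypotheses (gK : `|g| <= K) (hK : `|h| <= K).

Let K0 : 0 <= K. Proof. exact: le_trans (normr_ge0 _) gK. Qed.

Lemma mgf_ge (a b z : R) : 0 <= a -> 0 <= b -> 2^-1 <= a + b -> `|z| <= K ->
  expR (- K) / 2 <= a + b * expR z.
Proof.
move=> a0 b0 ab; rewrite ler_norml => /andP[z1 z2].
apply: (@le_trans _ _ (expR (- K) * (a + b))).
  by rewrite ler_wpM2l// expR_ge0.
rewrite mulrDr; apply: lerD.
  by rewrite ler_piMl// -expR0 ler_expR oppr_le0.
by rewrite mulrC ler_wpM2l// ler_expR.
Qed.

(** The factor [2 * expR K] inverts the lower bound of [mgf_ge]; the other [expR K] is the Lipschitz
    constant of the weighted exponential. *)
Let C := 2 * expR K * expR K.

Let weighted_lip : `|v1 * expR g - w1 * expR h| <=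
  expR K * (`|v1 - w1| + `|g - h|).
Proof.
have [g1 g2] := andP (etrans (esym (ler_norml _ _)) gK).
have [h1 h2] := andP (etrans (esym (ler_norml _ _)) hK).
have -> : v1 * expR g - w1 * expR h =
    (v1 - w1) * expR g + w1 * (expR g - expR h) by ring.
rewrite [leRHS]mulrDr; apply: (le_trans (ler_normD _ _)).
apply: lerD.
  by rewrite normrM mulrC ler_wpM2r// gtr0_norm ?expR_gt0 ?ler_expR.
rewrite normrM (ger0_norm w1_ge0).
have w1_le1 : w1 <= 1 by rewrite -w01 lerDr.
apply: le_trans (expR_lip g2 h2).
by rewrite ler_piMl.
Qed.

Let expK1 : 1 <= expR K. Proof. by rewrite -expR0 ler_expR. Qed.

Lemma logmgf_lip : `|logmgf v0 v1 g - logmgf w0 w1 h| <=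
  C * (`|v0 - w0| + `|v1 - w1| + `|g - h|).
Proof.
have w01' : 2^-1 <= w0 + w1 by rewrite w01; lra.
have m0 : 0 < expR (- K) / 2 by rewrite divr_gt0 ?expR_gt0.
apply: (le_trans (ln_lip m0 (mgf_ge v0_ge0 v1_ge0 v01 gK)
  (mgf_ge w0_ge0 w1_ge0 w01' hK))).
have -> : (expR (- K) / 2)^-1 = 2 * expR K by rewrite expRN invf_div invrK.
rewrite mulrC /C -[leRHS]mulrA ler_wpM2l ?mulr_ge0 ?expR_ge0//.
have -> : v0 + v1 * expR g - (w0 + w1 * expR h) =
  (v0 - w0) + (v1 * expR g - w1 * expR h) by ring.
apply: (le_trans (ler_normD _ _)); rewrite -addrA [leRHS]mulrDr.
by apply: lerD weighted_lip; rewrite ler_peMl.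
Qed.

Lemma tilt_lip : `|tilt v0 v1 g - tilt w0 w1 h| <=
  C * (`|v0 - w0| + `|v1 - w1| + `|g - h|).
Proof.
have m0 : 0 < expR (- K) / 2 by rewrite divr_gt0 ?expR_gt0.
have w01' : 2^-1 <= w0 + w1 by rewrite w01; lra.
have p1 := mgf_ge v0_ge0 v1_ge0 v01 gK; have p2 := mgf_ge w0_ge0 w1_ge0 w01' hK.
rewrite /tilt; apply: le_trans (frac_lip m0 _ _ w0_ge0 _) _.
- by rewrite addrC.
- by rewrite mulr_ge0// expR_ge0.
- by rewrite addrC (lt_le_trans m0).
have -> : (expR (- K) / 2)^-1 = 2 * expR K by rewrite expRN invf_div invrK.
rewrite mulrC /C -[leRHS]mulrA ler_wpM2l ?mulr_ge0 ?expR_ge0//.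
rewrite addrC -addrA [leRHS]mulrDr.
by apply: lerD weighted_lip; rewrite ler_peMl.
Qed.

End Lip.

Lemma tilt_compl (v0 v1 g : R) : v0 + v1 * expR g != 0 ->
  1 - tilt v0 v1 g = v0 / (v0 + v1 * expR g).
Proof. by move=> h; rewrite /tilt [v1 * _ + _]addrC; field. Qed.

Lemma tilt01 (v g : R) : 0 < v < 1 -> 0 < tilt (1 - v) v g < 1.
Proof.
move=> /andP[v0 v1]; have e0 := expR_gt0 g; have ve := mulr_gt0 v0 e0.
by rewrite /tilt divr_gt0 ?ltr_pdivrMr; lra.
Qed.

(** Gibbs' inequality: x ln (x/y) >= x - y holds for both terms, and the right-hand sides add up to
    zero. *)
Lemma Q2_ge0 u v : 0 <= u <= 1 -> 0 < v < 1 -> 0 <= Q2 u v.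
Proof.
have H x y : 0 <= x -> 0 < y -> x - y <= x * ln (x / y).
  rewrite le_eqVlt => /predU1P[<-|x0] y0; first by rewrite mul0r; lra.
  have := ln_le_subr1 (divr_gt0 y0 x0).
  rewrite -[y / x]invf_div lnV ?posrE ?divr_gt0// => h.
  have : x * (- ln (x / y)) <= x * ((x / y)^-1 - 1) by rewrite ler_wpM2l// ltW.
  by rewrite mulrBr mulr1 invf_div mulrCA divff ?gt_eqF//; lra.
move=> /andP[u0 u1] /andP[v0 v1]; rewrite /Q2.
have := H u v u0 v0.
have := H (1 - u) (1 - v); rewrite !subr_ge0 !subr_gt0 => /(_ u1 v1); lra.
Qed.

(** Legendre duality with its exact gap: the dual value at g misses Q2(u, v) by the entropy of u
    relative to the tilt of v by g. Young's inequality, the near-optimality of the truncated logit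
    and the cost of a tilt are all read off this identity. *)
Lemma ug_logmgfE u v g : 0 <= u <= 1 -> 0 < v < 1 ->
  u * g - logmgf (1 - v) v g = Q2 u v - Q2 u (tilt (1 - v) v g).
Proof.
move=> /andP[u0 u1] v01; have /andP[v0 v1] := v01.
have /andP[t0 t1] := tilt01 g v01.
have D0 : 0 < 1 - v + v * expR g by rewrite ltr_pwDl ?subr_gt0// mulr_ge0 ?expR_ge0// ltW.
have e1 : ln (tilt (1 - v) v g) = ln v + g - logmgf (1 - v) v g.
  rewrite /tilt ln_div ?posrE ?mulr_gt0 ?expR_gt0//; last by rewrite addrC.
  by rewrite lnM ?posrE ?expR_gt0// expRK addrC /logmgf (addrC (v * _)); ring.
have e2 : ln (1 - tilt (1 - v) v g) = ln (1 - v) - logmgf (1 - v) v g.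
  by rewrite tilt_compl ?gt_eqF// ln_div// posrE subr_gt0.
rewrite /Q2.
have h (a b c : R) : 0 <= a -> 0 < b -> 0 < c ->
    a * ln (a / b) - a * ln (a / c) = a * (ln c - ln b).
  rewrite le_eqVlt => /predU1P[<-|a0] b0 c0; first by rewrite !mul0r subrr.
  by rewrite !ln_div ?posrE//; ring.
have /eqP := h u v _ u0 v0 t0; rewrite subr_eq => /eqP ->.
have := h (1 - u) (1 - v) (1 - tilt (1 - v) v g).
rewrite !subr_ge0 !subr_gt0 => /(_ u1 v1 t1)/eqP; rewrite subr_eq => /eqP ->.
by rewrite e1 e2; ring.
Qed.

Lemma young u v g : 0 <= u <= 1 -> 0 < v < 1 ->
  u * g - logmgf (1 - v) v g <= Q2 u v.
Proof.
move=> u01 v01; rewrite ug_logmgfE// gerBl; apply: Q2_ge0 => //; exact: tilt01.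
Qed.

Lemma Q2xx u : 0 < u < 1 -> Q2 u u = 0.
Proof.
by move=> /andP[u0 u1]; rewrite /Q2 !divff ?gt_eqF ?subr_gt0// ln1 !mulr0 addr0.
Qed.

Lemma logmgf_le K v g : 0 <= v <= 1 -> `|g| <= 2^-1 -> `|g| <= K ->
  logmgf (1 - v) v g <= v * g + 2 * K ^+ 2.
Proof.
move=> /andP[v0 v1]; rewrite ler_norml => /andP[g1 g2] gK; rewrite /logmgf.
have := expR_gt0 g; have := expR_le_quad g2 => h e0.
have h1 : 2^-1 - 1 <= expR g - 1 by have := expR_ge1Dx g; lra.
apply: le_trans (ln_le_subr1 _) _; first nra.
have : g ^+ 2 <= K ^+ 2.
  by rewrite -real_normK ?num_real// lerXn2r ?nnegrE// (le_trans _ gK).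
have := sqr_ge0 g; nra.
Qed.

(* [expR (trunc_logit eps u v)] is a smooth truncation to [[eps, 1 / eps]] of
   the odds ratio [u (1 - v) / ((1 - u) v)], the tilt carrying [v] to [u]. *)
Definition trunc_logit eps u v :=
  ln ((u * (1 - v) + eps * ((1 - u) * v)) / ((1 - u) * v + eps * (u * (1 - v)))).

Section Trunc.
Variables (u v : R).
Hypotheses (u01 : 0 <= u <= 1) (v01 : 0 < v < 1).
Let A := u * (1 - v).
Let B := (1 - u) * v.

Let A0 : 0 <= A. Proof. by have /andP[? ?] := u01; have /andP[? ?] := v01; rewrite mulr_ge0//; lra. Qed.
Let B0 : 0 <= B. Proof. by have /andP[? ?] := u01; have /andP[? ?] := v01; rewrite mulr_ge0//; lra. Qed.
Let AB : 0 < A + B.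
Proof.
have /andP[v0 v1] := v01; have /andP[u0 u1] := u01; rewrite /A /B.
have [u2|u2] := leP u 2^-1; first nra.
have : 0 < u * (1 - v) by rewrite mulr_gt0; lra.
have : 0 <= (1 - u) * v by rewrite mulr_ge0; lra.
lra.
Qed.

Lemma trunc_logit_num_gt0 eps : 0 < eps -> 0 < A + eps * B.
Proof. by move=> e0; move: A B A0 B0 AB => a b a0 b0 ab; nra. Qed.

Lemma trunc_logit_den_gt0 eps : 0 < eps -> 0 < B + eps * A.
Proof. by move=> e0; move: A B A0 B0 AB => a b a0 b0 ab; nra. Qed.

Lemma trunc_logit_bound eps : 0 < eps < 1 -> `|trunc_logit eps u v| <= - ln eps.
Proof.
move=> /andP[e0 e1]; rewrite /trunc_logit -/A -/B.
have n0 := trunc_logit_num_gt0 e0; have d0 := trunc_logit_den_gt0 e0.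
rewrite ler_norml opprK -lnV ?posrE// !ler_ln ?posrE ?divr_gt0 ?invr_gt0//.
rewrite ler_pdivlMr// ler_pdivrMr// ler_pdivlMl//.
have : 0 <= eps * eps <= 1 by apply/andP; split; nra.
by move: A B A0 B0 => a b a0 b0 /andP[? ?]; apply/andP; split; nra.
Qed.

Lemma tilt_trunc_logit eps : 0 < eps ->
  tilt (1 - v) v (trunc_logit eps u v) =
  v * (A + eps * B) / (v * (A + eps * B) + (1 - v) * (B + eps * A)).
Proof.
move=> e0; rewrite /tilt /trunc_logit -/A -/B.
have n0 := trunc_logit_num_gt0 e0; have d0 := trunc_logit_den_gt0 e0.
rewrite lnK ?posrE ?divr_gt0//.
have /andP[v0 v1] := v01; have v1' : 0 < 1 - v by lra.
field; rewrite ?(gt_eqF d0)//=.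
have h1 := mulr_gt0 v0 n0; have h2 := mulr_gt0 v1' d0.
by rewrite andbT gt_eqF; lra.
Qed.

(** The difference between u and the tilted parameter is eps (A - B)(A + B)/D. It has the sign of A
    - B, which is also the sign of the truncated logit, so their product is nonnegative. *)
Lemma tilt_trunc_logit_entropy eps : 0 < eps < 1 ->
  tilt (1 - v) v (trunc_logit eps u v) * trunc_logit eps u v
    - logmgf (1 - v) v (trunc_logit eps u v)
  <= u * trunc_logit eps u v - logmgf (1 - v) v (trunc_logit eps u v).
Proof.
move=> /andP[e0 e1]; rewrite lerB// -subr_ge0 -mulrBl tilt_trunc_logit//.
have n0 := trunc_logit_num_gt0 e0; have d0 := trunc_logit_den_gt0 e0.
have /andP[v0 v1] := v01; have v1' : 0 < 1 - v by lra.
have h1 := mulr_gt0 v0 n0; have h2 := mulr_gt0 v1' d0.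
set D := v * _ + _; have D0 : 0 < D by rewrite addr_gt0.
have -> : u - v * (A + eps * B) / D = eps * (A - B) * (A + B) / D.
  apply/eqP; rewrite -subr_eq0; apply/eqP; rewrite /D /A /B; field.
  by move: D0; rewrite /D /A /B => D0; rewrite gt_eqF.
rewrite mulrAC mulr_ge0 ?invr_ge0//; last exact: ltW.
have lnq : (0 <= A - B -> 0 <= trunc_logit eps u v) /\
           (A - B <= 0 -> trunc_logit eps u v <= 0).
  rewrite /trunc_logit -/A -/B; split=> h.
    by rewrite ln_ge0// ler_pdivlMr// mul1r; nra.
  by rewrite ln_le0// ler_pdivrMr// mul1r; nra.
rewrite -!mulrA mulr_ge0//; first exact: ltW.
rewrite mulrCA mulr_ge0//; first exact: ltW.
by have [h|/ltW h] := leP 0 (A - B); have := lnq.1; have := lnq.2; nra.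
Qed.

(** At eps = 0 the tilted parameter is v A / (v A + (1 - v) B), whose denominator equals v (1 - v) >
    0; hence it is u even when u is 0 or 1. The index [n.+2] keeps eps strictly between 0 and 1. *)
Lemma cvg_tilt_trunc_logit :
  tilt (1 - v) v (trunc_logit n.+2%:R^-1 u v) @[n --> \oo] --> u.
Proof.
have /andP[v0 v1] := v01.
have eps0 : (n.+2%:R^-1 : R) @[n --> \oo] --> (0 : R).
  have := @cvg_harmonic R; rewrite -(cvg_shiftn 1).
  by under eq_fun do rewrite /= addn1.
have ue : u = v * (A + 0 * B) / (v * (A + 0 * B) + (1 - v) * (B + 0 * A)).
  rewrite !mul0r !addr0 /A /B; field.
  have -> : v * (u * (1 - v)) + (1 - v) * ((1 - u) * v) = v * (1 - v) by ring.
  by rewrite mulf_neq0 ?gt_eqF ?subr_gt0.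
rewrite [X in _ --> X]ue (_ : (fun n => _) = fun n => v * (A + n.+2%:R^-1 * B) /
  (v * (A + n.+2%:R^-1 * B) + (1 - v) * (B + n.+2%:R^-1 * A))); last first.
  by apply/funext => n; rewrite tilt_trunc_logit ?invr_gt0.
have c1 : v * (A + (n.+2%:R^-1 : R) * B) @[n --> \oo] --> v * (A + 0 * B).
  apply: cvgM; [exact: cvg_cst|apply: cvgD; [exact: cvg_cst|]].
  by apply: cvgM => //; exact: cvg_cst.
have c2 : (1 - v) * (B + (n.+2%:R^-1 : R) * A) @[n --> \oo] --> (1 - v) * (B + 0 * A).
  apply: cvgM; [exact: cvg_cst|apply: cvgD; [exact: cvg_cst|]].
  by apply: cvgM => //; exact: cvg_cst.
apply: cvgM => //; apply: cvgV; last exact: cvgD.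
rewrite gt_eqF// !mul0r !addr0; have v1' : 0 < 1 - v by lra.
rewrite (_ : _ + _ = v * (1 - v)) ?mulr_gt0//.
by rewrite /A /B; ring.
Qed.

(** By [ug_logmgfE] the gap is Q2 of u and a sequence tending to u. Each of its two terms tends to
    zero; a vanishing coefficient makes the term zero outright, whatever the logarithm does. *)
Lemma cvg_trunc_logit :
  u * trunc_logit n.+2%:R^-1 u v
    - logmgf (1 - v) v (trunc_logit n.+2%:R^-1 u v) @[n --> \oo] --> Q2 u v.
Proof.
have /andP[u0 u1] := u01.
have main (a : R) (b : nat -> R) : 0 <= a -> b n @[n --> \oo] --> a ->
    a * ln (a / b n) @[n --> \oo] --> (0 : R).
  rewrite le_eqVlt => /predU1P[<- _|a0 ba].
    by under eq_fun do rewrite mul0r; exact: cvg_cst.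
  rewrite -(mulr0 a) -(@ln1 R); apply: cvgM; first exact: cvg_cst.
  have c1 : a / b n @[n --> \oo] --> (1 : R).
    rewrite -(@divff _ a) ?gt_eqF//; apply: cvgM; [exact: cvg_cst|]; apply: cvgV => //.
    by rewrite gt_eqF.
  exact: (cvg_comp _ _ c1 (continuous_ln ltr01)).
rewrite (_ : (fun n => _) = fun n =>
    Q2 u v - Q2 u (tilt (1 - v) v (trunc_logit n.+2%:R^-1 u v))); last first.
  by apply/funext => n; rewrite ug_logmgfE.
rewrite -[X in _ --> X]subr0; apply: cvgB; first exact: cvg_cst.
rewrite -[X in _ --> X](addr0 0); apply: cvgD; apply: main => //.
- exact: cvg_tilt_trunc_logit.
- by rewrite subr_ge0.
- by apply: cvgB; [exact: cvg_cst|exact: cvg_tilt_trunc_logit].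
Qed.

End Trunc.

End Scalar.

(** * Cells and step functions *)

Section Cells.
Context {R : realType}.
Local Notation mu := (@leb_sq R).
Local Notation lam := (@lebesgue_measure R).

Lemma leb_sq_setT : mu setT = 1%E.
Proof.
rewrite /leb_sq /= /mrestr setTI /leb2 /unit_sq.
rewrite product_measure1E; [|exact: measurable_itv..].
by rewrite /= !lebesgue_measure_itv /= lte_fin ltr01 oppr0 adde0 mule1.
Qed.

Lemma ae_unit_sq : {ae mu, forall p, unit_sq p}.
Proof.
exists (~` unit_sq); split => //.
  by apply: measurableC; exact: measurable_unit_sq.
by rewrite /leb_sq /= /mrestr setICl measure0.
Qed.

Lemma cell_ex n (x : R) : (0 < n)%N -> 0 <= x <= 1 -> exists i : 'I_n, cell i x.
Proof.
case: n => // n _ /andP[x0 x1].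
have exP : exists i, x <= i.+1%:R / n.+1%:R.
  by exists n; rewrite divff ?pnatr_eq0.
case: (ex_minnP exP) => m xm minm.
have mn : (m < n.+1)%N by rewrite ltnS minm// divff ?pnatr_eq0.
exists (Ordinal mn); rewrite /cell /=; case: ifPn => [/eqP m0|m0] /=.
  by rewrite in_itv /= x0 /=; move: xm; rewrite m0 mul1r.
rewrite in_itv /= xm andbT ltNge; apply/negP => h.
have := minm m.-1; rewrite prednK ?lt0n// => /(_ h).
by rewrite leqNgt prednK ?lt0n// leqnn.
Qed.

Lemma cell_sub01 n (i : 'I_n) : cell i `<=` `[(0:R), 1].
Proof.
have n0 : (0 < n)%N by exact: leq_ltn_trans (ltn_ord i).
have h : i.+1%:R / n%:R <= 1 :> R.
  by rewrite ler_pdivrMr ?ltr0n// mul1r ler_nat.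
move=> x; rewrite /cell; case: ifPn => [/eqP i0|i0] /=; rewrite !in_itv /=.
  move=> /andP[-> /le_trans]; apply.
  by apply: le_trans h; rewrite i0 mul1r.
move=> /andP[x1 x2]; rewrite (le_trans x2 h) andbT.
by rewrite (le_trans _ (ltW x1)).
Qed.

Lemma lebesgue_measure_cell n (i : 'I_n) : lam (cell i) = (n%:R^-1)%:E.
Proof.
have n0 : (0 < n)%N by exact: leq_ltn_trans (ltn_ord i).
rewrite /cell; case: ifPn => _; rewrite lebesgue_measure_itv /= lte_fin.
  by rewrite invr_gt0 ltr0n n0 oppr0 adde0.
rewrite ltr_pM2r ?invr_gt0 ?ltr0n// ltr_nat ltnSn -EFinB.
by rewrite -mulrBl -natrB// subSnn mul1r.
Qed.

Lemma leb_sq_cell n (i j : 'I_n) : mu (cell i `*` cell j) = (n%:R^-2)%:E.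
Proof.
rewrite /leb_sq /= /mrestr setIidl; last first.
  by move=> [x y] [/= /cell_sub01 ? /cell_sub01].
rewrite product_measure1E; [|exact: measurable_cell..].
by rewrite /= !lebesgue_measure_cell -EFinM expr2 invfM.
Qed.

Lemma step_cell n (b : 'I_n -> 'I_n -> R) (i j : 'I_n) p :
  (cell i `*` cell j) p -> step b p = b i j.
Proof.
move=> pij; rewrite /step pair_bigA /= (bigD1 (i, j)) //= big1 ?addr0.
  by rewrite indicE mem_set// mulr1.
move=> [k l] /= /eqP kl; rewrite indicE memNset ?mulr0// => -[/= ck cl].
by case: pij => ci cj; apply: kl; rewrite (cell_inj ck ci) (cell_inj cl cj).
Qed.

Lemma unit_sq_cell n (p : plane R) : (0 < n)%N -> unit_sq p ->
  exists i j : 'I_n, (cell i `*` cell j) p.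
Proof.
move=> n0 [/= p1 p2].
have [i ci] := @cell_ex n p.1 n0 p1; have [j cj] := @cell_ex n p.2 n0 p2.
by exists i, j.
Qed.

Lemma step_bound n (b : 'I_n -> 'I_n -> R) K p : 0 <= K ->
  (forall i j, `|b i j| <= K) -> `|step b p| <= K.
Proof.
move=> K0 bK.
have [[i [j pij]]|no] :=
    pselect (exists i j : 'I_n, (cell i `*` cell j) p); first by rewrite (step_cell _ pij).
rewrite /step big1 ?normr0// => i _; rewrite big1// => j _.
by rewrite indicE memNset ?mulr0// => pij; apply: no; exists i, j.
Qed.

Lemma measurable_step_real n (b : 'I_n -> 'I_n -> R) :
  measurable_fun [set: plane R] (step b).
Proof. exact: measurable_step. Qed.

Lemma bounded_integrable (f : plane R -> R) (K : R) : measurable_fun setT f ->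
  (forall p, `|f p| <= K) -> mu.-integrable setT (EFin \o f).
Proof.
move=> mf fK; apply: measurable_bounded_integrable => //.
  by rewrite leb_sq_setT ltry.
by exists K; split; rewrite ?num_real// => x Kx y _; exact: le_trans (fK y) (ltW Kx).
Qed.

Lemma integrable_step n (b : 'I_n -> 'I_n -> R) : mu.-integrable setT (EFin \o step b).
Proof.
apply: (@bounded_integrable _ (\sum_i \sum_j `|b i j|)); first exact: measurable_step.
move=> p; apply: step_bound => [|i j].
  by apply: sumr_ge0 => i _; apply: sumr_ge0.
rewrite (bigD1 i)//= (bigD1 j)//= -addrA lerDl addr_ge0 ?sumr_ge0// => k _.
exact: sumr_ge0.
Qed.

Lemma Rintegral_step n (b : 'I_n -> 'I_n -> R) :
  \int[mu]_p step b p = n%:R^-2 * \sum_i \sum_j b i j.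
Proof.
have mc (k : 'I_n * 'I_n) : measurable (cell k.1 `*` cell k.2 : set (plane R)).
  exact: measurableX (measurable_cell _) (measurable_cell _).
have ic (k : 'I_n * 'I_n) :
    mu.-integrable setT (EFin \o (\1_(cell k.1 `*` cell k.2) : plane R -> R)).
  apply: (@bounded_integrable _ 1); first exact: measurable_indic.
  by move=> p; rewrite indicE; case: (_ \in _); rewrite ?normr1 ?normr0.
rewrite /Rintegral /step; under eq_integral do rewrite pair_bigA /= -sumEFin.
rewrite integral_sum//; last first.
  by move=> k; exact: (@integrableZl _ _ _ _ _ measurableT (b k.1 k.2) _ (ic k)).
rewrite [RHS](_ : _ = fine (\sum_(k : 'I_n * 'I_n) (n%:R^-2 * b k.1 k.2)%:E)%E).
  congr fine; apply: eq_bigr => k _; under eq_integral do rewrite EFinM.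
  rewrite (@integralZl _ _ _ _ _ measurableT _ (ic k)) integral_indic//.
  by rewrite setIT leb_sq_cell -EFinM mulrC.
by rewrite sumEFin /= pair_bigA mulr_sumr.
Qed.

Lemma step_mul n (b b' : 'I_n -> 'I_n -> R) p :
  step b p * step b' p = step (fun i j => b i j * b' i j) p.
Proof.
have [[i [j pij]]|no] :=
    pselect (exists i j : 'I_n, (cell i `*` cell j) p); first by rewrite !(step_cell _ pij).
by rewrite /step [X in X * _]big1 ?mul0r => [|i _]; [rewrite big1// => i _|];
  rewrite big1// => j _; rewrite indicE memNset ?mulr0// => pij; apply: no; exists i, j.
Qed.

Lemma mkL2 (g : plane R -> R) (K : R) : measurable_fun setT g ->
  (forall p, `|g p| <= K) -> exists h : @L2 R, {ae mu, forall p, h p = g p}.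
Proof.
move=> mg gK.
pose f : {mfun plane R >-> measurableTypeR R} :=
  HB.pack (g : plane R -> measurableTypeR R) (@isMeasurableFun.Build _ _ (plane R) (measurableTypeR R) g mg).
pose c : {mfun_ mu, plane R >-> measurableTypeR R} :=
  \pi_({mfun_ mu, plane R >-> measurableTypeR R})%qT f.
have cE : {ae mu, forall p, c p = g p}.
  have /eqP := reprK c; rewrite eqmodE => /asboolP.
  by apply: filterS => p /(_ I).
have c2 : finite_norm mu 2%:R%:E c.
  rewrite /finite_norm unlock; apply: poweR_lty.
  apply: (@le_lt_trans _ _ (\int[mu]_p (cst (K^+2)%:E p))%E); last first.
    by rewrite integral_cst// leb_sq_setT mule1 ltry.
  apply: ae_ge0_le_integral => //.
  - by move=> p _; exact: poweR_ge0.
  - apply: (measurableT_comp (measurable_poweR _)).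
    apply: measurableT_comp => //.
    by apply/measurable_EFinP; exact: (measurable_funPT (repr c)).
  - by move=> p _; rewrite lee_fin sqr_ge0.
  - apply: filterS cE => p cp _ /=.
    rewrite cp lee_fin powR_mulrn// lerXn2r ?nnegrE//.
    exact: le_trans (gK p).
pose h : @L2 R := HB.pack_for (@L2 R) (c : {mfun_ mu, plane R >-> measurableTypeR R})
  (@isFinLebesgue.Build _ _ _ _ _ (lee1n 2) c c2).
by exists h.
Qed.

End Cells.

(** * The weak topology *)

Section Topo.
Context {R : realType}.
Local Notation mu := (@leb_sq R).

Lemma L2_measurable (f : @L2 R) : measurable_fun [set: plane R] (f : plane R -> R).
Proof.
exact: (@measurable_funPT _ _ (plane R) (measurableTypeR R)
  (repr (f : {mfun_ mu, plane R >-> measurableTypeR R}))).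
Qed.

Lemma L2_sqr_integrable (f : @L2 R) :
  mu.-integrable [set: plane R] (fun p => (f p ^+ 2)%:E).
Proof.
apply: (@Lfun2_integrable_sqr _ _ _ mu f).
rewrite inE; apply/andP; split; rewrite inE; first exact: L2_measurable.
exact: Lebesgue_finite.
Qed.

Lemma sqr_integrable_mul (f g : plane R -> R) :
  measurable_fun setT f -> measurable_fun setT g ->
  mu.-integrable setT (fun p => (f p ^+ 2)%:E) ->
  mu.-integrable setT (fun p => (g p ^+ 2)%:E) ->
  mu.-integrable [set: plane R] (fun p => (f p * g p)%:E).
Proof.
move=> mf mg f2 g2; apply: (le_integrable _ _ _ (integrableD _ f2 g2)) => //.
  by apply/measurable_EFinP; exact: measurable_funM.
move=> p _ /=; rewrite lee_fin [leRHS]ger0_norm ?addr_ge0 ?sqr_ge0//.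
rewrite ler_norml; have := sqr_ge0 (f p + g p); have := sqr_ge0 (f p - g p).
have := sqr_ge0 (f p); have := sqr_ge0 (g p).
rewrite !expr2; move: (f p) (g p) => a b *; apply/andP; split; nra.
Qed.

Lemma L2_integrable (f : @L2 R) : mu.-integrable [set: plane R] (fun p => (f p)%:E).
Proof.
have H := @sqr_integrable_mul f (cst 1) (L2_measurable f) (measurable_cst _)
  (L2_sqr_integrable f).
apply: eq_integrable (H _) => // [p _|]; first by rewrite /= mulr1.
by apply: (@bounded_integrable _ (fun=> 1 ^+ 2) 1 (measurable_cst _)) => p; rewrite expr1n normr1.
Qed.

Lemma integrable_mul01 (f g : plane R -> R) : measurable_fun setT f ->
  {ae mu, forall p, 0 <= f p <= 1} -> mu.-integrable setT (EFin \o g) ->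
  mu.-integrable [set: plane R] (fun p => (f p * g p)%:E).
Proof.
move=> mf f01 ig; apply/integrableP; split.
  apply/measurable_EFinP; apply: measurable_funM => //.
  by case/integrableP : ig => /measurable_EFinP.
have /integrableP[mg] := ig; apply: le_lt_trans.
apply: ae_ge0_le_integral => //.
- apply: measurableT_comp => //; apply/measurable_EFinP; apply: measurable_funM => //.
  exact/measurable_EFinP.
- by apply: measurableT_comp.
apply: filterS f01 => p /andP[f0 f1] _ /=.
by rewrite lee_fin normrM ger0_norm// ler_piMl.
Qed.

Lemma S0_integrable (f : @S0 R) (g : plane R -> R) : mu.-integrable setT (EFin \o g) ->
  mu.-integrable [set: plane R] (fun p => ((val f : L2) p * g p)%:E).
Proof.
by apply: integrable_mul01; [exact: L2_measurable|exact: set_mem (valP f)].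
Qed.

Lemma ae_eq_Rintegral (f g : plane R -> R) :
  measurable_fun setT f -> measurable_fun setT g ->
  {ae mu, forall p, f p = g p} -> \int[mu]_p f p = \int[mu]_p g p.
Proof.
move=> mf mg fg; rewrite /Rintegral; congr fine; apply: ae_eq_integral => //.
- exact/measurable_EFinP.
- exact/measurable_EFinP.
- by apply: filterS fg => p -> _.
Qed.

Lemma inner_continuous (g : L2) : continuous (fun h : @S0 R => inner (val h) g).
Proof.
move=> h.
apply: (@continuous_comp (@S0 R) (@weakL2 R) R set_val (fun x => inner x g)).
  exact: initial_continuous.
apply: (@continuous_comp (@weakL2 R) {ptws @L2 R -> R} R
  (inner : @weakL2 R -> {ptws @L2 R -> R}) (fun x => x g)).
  exact: (@initial_continuous (@L2 R) _ (inner : @L2 R -> {ptws @L2 R -> R})).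
exact: (@proj_continuous (@L2 R) (fun=> R) g).
Qed.

Lemma cvg_initial (S : choiceType) (T : topologicalType) (f : S -> T)
    (F : set_system S) (s : S) : Filter F ->
  f x @[x --> F] --> f s -> F --> (s : initial_topology f).
Proof.
move=> FF fF A [B [[C oC <-] Cs] CA]; apply: filterS CA _.
by apply: fF; apply: open_nbhs_nbhs.
Qed.

(** The topology is built in layers: a subspace of an initial topology, for a map into a product.
    [cvg_initial] peels them off one at a time. *)
Lemma S0_cvg (F : set_system (@S0 R)) (f : @S0 R) : Filter F ->
  (forall g : L2, inner (val h) g @[h --> F] --> inner (val f) g) -> F --> f.
Proof.
move=> FF Fg; apply: (@cvg_initial (@S0 R) (@weakL2 R) set_val) => //.
apply: (@cvg_initial (@L2 R) {ptws @L2 R -> R} inner) => //.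
apply/cvg_sup => g.
by apply: (@cvg_initial _ R (fun x : @L2 R -> R => x g)); exact: Fg.
Qed.

Lemma ptws_cvg (I : Type) (T : topologicalType) (F : set_system {ptws I -> T})
    (f : {ptws I -> T}) : Filter F ->
  (forall i, h i @[h --> F] --> f i) -> F --> f.
Proof.
move=> FF Fi; apply/cvg_sup => i.
by apply: (@cvg_initial _ T (fun x : I -> T => x i)); exact: Fi.
Qed.

Lemma ptws_proj_continuous (I : eqType) (T : topologicalType) (i : I) :
  continuous (fun h : {ptws I -> T} => h i).
Proof. exact: (@proj_continuous I (fun=> T) i). Qed.

End Topo.

(** * Approximation by step functions *)

Section StepApprox.
Context {R : realType}.
Local Notation mu := (@leb_sq R).
Local Notation mfun f := (measurable_fun [set: plane R] (f : plane R -> R)).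
Implicit Types (f g h : plane R -> R).

(** Kept extended-valued, so that the comparison lemmas need measurability but no integrability. *)
Definition distL1 f g : \bar R := (\int[mu]_p `|f p - g p|%:E)%E.

Lemma measurable_dist f g : mfun f -> mfun g ->
  measurable_fun [set: plane R] (fun p => `|f p - g p|%:E).
Proof.
by move=> mf mg; apply/measurable_EFinP; apply: measurableT_comp => //;
  exact: measurable_funB.
Qed.

Lemma distL1_sum (I : Type) (s : seq I) (f g : I -> plane R -> R) (C : R)
    (F G : plane R -> R) : 0 <= C ->
  (forall i, mfun (f i)) -> (forall i, mfun (g i)) -> mfun F -> mfun G ->
  {ae mu, forall p, `|F p - G p| <= C * \sum_(i <- s) `|f i p - g i p|} ->
  (distL1 F G <= C%:E * \sum_(i <- s) distL1 (f i) (g i))%E.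
Proof.
move=> C0 mf mg mF mG FG; rewrite /distL1 -ge0_integral_sum//; last first.
  by move=> i; exact: measurable_dist.
rewrite -ge0_integralZl//; last 2 first.
- by apply: emeasurable_sum => i; exact: measurable_dist.
- by move=> p _; apply: sume_ge0 => i _; rewrite lee_fin.
apply: ae_ge0_le_integral => //.
- exact: measurable_dist.
- by move=> p _; rewrite mule_ge0// sume_ge0// => i _; rewrite lee_fin.
- apply: measurable_funeM.
  by apply: emeasurable_sum => i; exact: measurable_dist.
by apply: filterS FG => p FGp _; rewrite sumEFin -EFinM lee_fin.
Qed.

Lemma distL1_le2 f1 g1 f2 g2 F G (C : R) : 0 <= C ->
  mfun f1 -> mfun g1 -> mfun f2 -> mfun g2 -> mfun F -> mfun G ->
  {ae mu, forall p, `|F p - G p| <= C * (`|f1 p - g1 p| + `|f2 p - g2 p|)} ->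
  (distL1 F G <= C%:E * (distL1 f1 g1 + distL1 f2 g2))%E.
Proof.
move=> C0 m1 m2 m3 m4 mF mG FG.
have := @distL1_sum _ [:: true; false] (fun b => if b then f1 else f2)
  (fun b => if b then g1 else g2) C F G C0.
rewrite !big_cons big_nil adde0; apply => //; try by case.
by apply: filterS FG => p; rewrite !big_cons big_nil addr0.
Qed.

Lemma distL1_triangle f g h : mfun f -> mfun g -> mfun h ->
  (distL1 f h <= distL1 f g + distL1 g h)%E.
Proof.
move=> mf mg mh; rewrite -[leRHS]mul1e; apply: distL1_le2 => //.
by apply: aeW => p; rewrite mul1r -[f p - h p](subrKA (g p)) ler_normD.
Qed.

(** Approximation is required for every large [n], and not merely for some [n]: the partitions into
    cells for different [n] are not nested, and the graphs live on the partition of the current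
    [n]. *)
Definition step_approx f := forall eps : R, 0 < eps -> \forall n \near \oo,
  exists b : 'I_n -> 'I_n -> R, (distL1 (step b) f < eps%:E)%E.

Lemma step_approx_lim f : mfun f ->
  (forall eps : R, 0 < eps -> exists g,
    [/\ mfun g, step_approx g & (distL1 g f < eps%:E)%E]) -> step_approx f.
Proof.
move=> mf H eps e0; have e2 : 0 < eps / 2 by rewrite divr_gt0.
have [g [mg sg gf]] := H _ e2.
near=> n; have [b bg] : exists b : 'I_n -> 'I_n -> R, (distL1 (step b) g < (eps / 2)%:E)%E.
  by near: n; exact: sg.
exists b; apply: le_lt_trans (distL1_triangle _ mg mf) _; first exact: measurable_step_real.
by rewrite [eps]splitr EFinD lteD.
Unshelve. all: by end_near. Qed.

Lemma step_approx_ae f g : mfun f -> mfun g -> {ae mu, forall p, f p = g p} ->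
  step_approx f -> step_approx g.
Proof.
move=> mf mg fg sf; apply: step_approx_lim => // eps e0; exists f; split=> //.
rewrite /distL1 (ae_eq_integral (cst 0%E))//; first by rewrite integral0.
- exact: measurable_dist.
- by apply: filterS fg => p -> _; rewrite subrr normr0.
Qed.

Lemma step_approx_comp f1 f2 (F : R -> R -> R) (C : R) : 0 < C ->
  mfun f1 -> mfun f2 -> mfun (fun p => F (f1 p) (f2 p)) ->
  (forall x y x' y', `|F x y - F x' y'| <= C * (`|x - x'| + `|y - y'|)) ->
  step_approx f1 -> step_approx f2 -> step_approx (fun p => F (f1 p) (f2 p)).
Proof.
move=> C0 mf1 mf2 mF FC s1 s2 eps e0.
have e2 : 0 < eps / (C * 2) by rewrite divr_gt0 ?mulr_gt0.
near=> n.
have n0 : (0 < n)%N by near: n; exact: nbhs_infty_gt.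
have [b1 H1] : exists b : 'I_n -> 'I_n -> R, (distL1 (step b) f1 < (eps / (C * 2))%:E)%E.
  by near: n; exact: s1.
have [b2 H2] : exists b : 'I_n -> 'I_n -> R, (distL1 (step b) f2 < (eps / (C * 2))%:E)%E.
  by near: n; exact: s2.
exists (fun i j => F (b1 i j) (b2 i j)).
have := @distL1_le2 (step b1) f1 (step b2) f2 (step (fun i j => F (b1 i j) (b2 i j)))
  (fun p => F (f1 p) (f2 p)) C (ltW C0) (measurable_step_real _) mf1
  (measurable_step_real _) mf2 (measurable_step_real _) mF.
move=> H; apply: (le_lt_trans (H _)).
  apply: filterS ae_unit_sq => p /(unit_sq_cell n0)[i [j pij]].
  by rewrite !(step_cell _ pij); exact: FC.
rewrite -lte_pdivlMl// -EFinM.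
apply: (lt_le_trans (lteD H1 H2)).
rewrite -EFinD lee_fin le_eqVlt; apply/orP; left; apply/eqP.
by field; rewrite gt_eqF.
Unshelve. all: by end_near. Qed.

Lemma step_approxD f g : mfun f -> mfun g ->
  step_approx f -> step_approx g -> step_approx (fun p => f p + g p).
Proof.
move=> mf mg; apply: (@step_approx_comp f g (fun x y => x + y) 1) => //.
  exact: measurable_funD.
move=> x y x' y'; rewrite mul1r (_ : _ - _ = (x - x') + (y - y')) ?ler_normD//.
by ring.
Qed.

Lemma step_approxB f g : mfun f -> mfun g ->
  step_approx f -> step_approx g -> step_approx (fun p => f p - g p).
Proof.
move=> mf mg; apply: (@step_approx_comp f g (fun x y => x - y) 1) => //.
  exact: measurable_funB.
move=> x y x' y'; rewrite mul1r (_ : _ - _ = (x - x') - (y - y')) ?ler_normB//.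
by ring.
Qed.

Lemma step_approxZ c f : mfun f -> step_approx f -> step_approx (fun p => c * f p).
Proof.
move=> mf sf; apply: (@step_approx_comp f f (fun x y => c * x) (`|c| + 1)) => //.
  exact: measurable_funM.
move=> x y x' y'; rewrite -mulrBr normrM.
have := normr_ge0 c; have := normr_ge0 (x - x'); have := normr_ge0 (y - y').
by move=> *; nra.
Qed.

Lemma step_approx_cst c : step_approx (cst c).
Proof.
move=> eps e0; near=> n; exists (fun _ _ => c).
have n0 : (0 < n)%N by near: n; exact: nbhs_infty_gt.
rewrite /distL1 (ae_eq_integral (cst 0%E))//; first by rewrite integral0.
- apply: measurable_dist => //; exact: measurable_step_real.
- apply: filterS ae_unit_sq => p /(unit_sq_cell n0)[i [j pij]] _.
  by rewrite (step_cell _ pij) subrr normr0.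
Unshelve. all: by end_near. Qed.

Lemma step_approx_dominated (f_ : nat -> plane R -> R) f G :
  (forall k, mfun (f_ k)) -> mfun f -> (forall k, step_approx (f_ k)) ->
  (forall p, f_ k p @[k --> \oo] --> f p) ->
  mu.-integrable setT (EFin \o G) -> (forall k p, `|f_ k p| <= G p) ->
  step_approx f.
Proof.
move=> mf_ mf sf ff iG fG; apply: step_approx_lim => // eps e0.
have [|||||_ + _] := @dominated_convergence _ _ _ mu setT measurableT
  (fun k p => (f_ k p)%:E) (EFin \o f) (EFin \o G).
- by move=> k; exact/measurable_EFinP.
- exact/measurable_EFinP.
- by apply: aeW => p _; apply: cvg_comp (ff p) _; exact: cvg_id.
- exact: iG.
- by apply: aeW => p k _; rewrite lee_fin.
move=> /fine_cvgP[fin] /cvgrPdist_lt/(_ _ e0)[N _ HN].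
case: fin => M _ HM; exists (f_ (maxn M N)); split => //.
have := HN (maxn M N) (leq_maxr _ _); have := HM (maxn M N) (leq_maxl _ _).
rewrite /= sub0r normrN => h1 h2.
rewrite /distL1 -(fineK h1) lte_fin; apply: le_lt_trans h2.
exact: ler_norm.
Qed.

Lemma mfun_indic (A : set (plane R)) : measurable A -> mfun (\1_A).
Proof. exact: measurable_indic. Qed.

Lemma integrable_cst (c : R) : mu.-integrable [set: plane R] (EFin \o cst c).
Proof. by apply: (@bounded_integrable _ _ `|c|) => //; exact: measurable_cst. Qed.

Definition step_approx_set (A : set (plane R)) := measurable A /\ step_approx (\1_A).

Lemma step_approx_setD A B : B `<=` A -> step_approx_set A -> step_approx_set B ->
  step_approx_set (A `\` B).
Proof.
move=> BA [mA sA] [mB sB]; have mAB := measurableD mA mB; split=> //.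
rewrite (_ : \1_(A `\` B) = fun p => \1_A p - \1_B p); last first.
  apply/funext => p; rewrite !indicE in_setD.
  have [pB|pB] := boolP (p \in B); last by rewrite andbT subr0.
  by rewrite (mem_set (BA _ (set_mem pB))) subrr.
by apply: step_approxB => //; exact: mfun_indic.
Qed.

Lemma step_approx_set_bigcup (F : (set (plane R))^nat) :
  {homo F : n m / (n <= m)%N >-> (n <= m)%O} -> (forall k, step_approx_set (F k)) ->
  step_approx_set (\bigcup_k F k).
Proof.
move=> ndF aF; have mF k : measurable (F k) by case: (aF k).
have mU : measurable (\bigcup_k F k) by exact: bigcupT_measurable.
split=> //.
apply: (@step_approx_dominated (fun k => \1_(F k)) _ (cst 1)).
- by move=> k; exact: mfun_indic.
- exact: mfun_indic.
- by move=> k; case: (aF k).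
- move=> p; have [[k _ Fkp]|nF] := pselect ((\bigcup_k F k) p).
    apply: cvg_near_cst; near=> m; rewrite !indicE !mem_set//; first by exists k.
    have : (F k `<=` F m)%classic by apply/subsetPset/ndF; near: m; exact: nbhs_infty_ge.
    exact.
  apply: cvg_near_cst; near=> m; rewrite !indicE !memNset// => Fm; apply: nF.
  by exists m.
- exact: integrable_cst.
- by move=> k p; rewrite indicE; case: (_ \in _); rewrite ?normr1 ?normr0.
Unshelve. all: by end_near. Qed.

Lemma step_approx_set_sq A B : measurable A -> (forall p, unit_sq p -> A p <-> B p) ->
  step_approx_set B -> step_approx_set A.
Proof.
move=> mA AB [mB sB]; split=> //; apply: step_approx_ae sB; [exact: mfun_indic..|].
apply: filterS ae_unit_sq => p /AB pAB; rewrite !indicE; congr (_%:R).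
by congr (nat_of_bool _); apply/idP/idP => /set_mem /pAB/mem_set.
Qed.

Let strip (a h : R) : set (plane R) := `[a - h, a + h]%classic `*` setT.
Let strip' (a h : R) : set (plane R) := setT `*` `[a - h, a + h]%classic.

Let leb_strip (a h : R) : 0 < h -> (mu (strip a h) <= (2 * h)%:E /\ mu (strip' a h) <= (2 * h)%:E)%E.
Proof.
move=> h0.
have mi : lebesgue_measure (`[a - h, a + h]%classic : set (measurableTypeR R)) = (2 * h)%:E.
  rewrite lebesgue_measure_itv /= lte_fin ifT; last by lra.
  by rewrite -EFinB; congr EFin; ring.
have m1 : lebesgue_measure (`[0, 1]%classic : set (measurableTypeR R)) = 1%:E.
  by rewrite lebesgue_measure_itv /= lte_fin ltr01 oppr0 adde0.
have le (A B C D : set (measurableTypeR R)) : measurable A -> measurable B -> measurable C ->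
    measurable D -> (A `*` B) `&` unit_sq `<=` C `*` D ->
    (mu (A `*` B) <= lebesgue_measure C * lebesgue_measure D)%E.
  move=> mA mB mC mD sub; rewrite -product_measure1E// /leb_sq /= /mrestr.
  apply: le_measure sub; rewrite ?inE; last exact: measurableX.
  by apply: measurableI; [exact: measurableX|exact: measurable_unit_sq].
split.
- by rewrite -[leRHS]mule1 -mi -m1; apply: le => // -[x y] [[/= ? _] []].
- by rewrite -[leRHS]mul1e -mi -m1; apply: le => // -[x y] [[/= _ ?] []].
Qed.

(** Deciding a whole cell by its right endpoint can go wrong only within distance 1/n of the edge of
    the ray. *)
Let cell_ray n (i : 'I_n) (a x : R) : cell i x ->
  (i.+1%:R / n%:R < a) = (x < a) \/ a - n%:R^-1 <= x <= a + n%:R^-1.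
Proof.
move=> ci.
have n0 : (0 < n)%N by exact: leq_ltn_trans (ltn_ord i).
have i0 : 0 < n%:R^-1 :> R by rewrite invr_gt0 ltr0n.
have ii : i%:R / n%:R + n%:R^-1 = i.+1%:R / n%:R :> R.
  by rewrite -[X in _ + X]mul1r -mulrDl -natr1.
have [x1 x2] : i%:R / n%:R <= x /\ x <= i.+1%:R / n%:R.
  move: ci; rewrite /cell; case: ifPn => [/eqP ->|_] /=; rewrite in_itv /=.
    by rewrite mul0r mul1r => /andP[].
  by move=> /andP[/ltW].
have [h|h] := ltP (i.+1%:R / n%:R) a.
  by left; rewrite (le_lt_trans x2 h).
have [xa|ax] := ltP x a; last by left.
by right; rewrite -ii in h; apply/andP; split; lra.
Qed.

(** The error is supported by the two strips of half-width 1/n around the edges, each of area at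
    most 2/n inside the square. *)
Lemma step_approx_set_ray (a b : R) :
  step_approx_set (`]-oo, a[%classic `*` `]-oo, b[%classic).
Proof.
have mS : measurable ((`]-oo, a[ `*` `]-oo, b[) : set (plane R)).
  by apply: measurableX; exact: measurable_itv.
split=> // eps e0.
have e4 : 0 < eps / 4 by rewrite divr_gt0.
near=> n.
have n0 : (0 < n)%N by near: n; exact: nbhs_infty_gt.
have i0 : 0 < n%:R^-1 :> R by rewrite invr_gt0 ltr0n.
have ne : 4 * n%:R^-1 < eps.
  rewrite -ltr_pdivlMl// mulrC invf_plt ?posrE ?divr_gt0 ?ltr0n//.
  by near: n; exact: nbhs_infty_gtr.
exists (fun i j => ((i.+1%:R / n%:R < a) && (j.+1%:R / n%:R < b))%:R).
have m1 : measurable (strip a n%:R^-1).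
  by apply: measurableX => //; exact: measurable_itv.
have m2 : measurable (strip' b n%:R^-1).
  by apply: measurableX => //; exact: measurable_itv.
apply: (@le_lt_trans _ _ (\int[mu]_p ((\1_(strip a n%:R^-1) p)%:E + (\1_(strip' b n%:R^-1) p)%:E))%E).
  apply: ae_ge0_le_integral => //.
  - by apply: measurable_dist; [exact: measurable_step_real|exact: mfun_indic].
  - by move=> p _; rewrite -EFinD lee_fin addr_ge0.
  - by apply: emeasurable_funD; apply/measurable_EFinP; exact: mfun_indic.
  apply: filterS ae_unit_sq => -[x y] /(unit_sq_cell n0)[i [j pij]] _.
  rewrite (step_cell _ pij) -EFinD lee_fin !indicE.
  case: (boolP (((x, y) : plane R) \in strip a n%:R^-1)) => [_|/negP nx].
    apply: (@le_trans _ _ 1); last by rewrite lerDl.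
    by case: (_ && _); case: (_ \in _); rewrite ?subrr ?subr0 ?sub0r ?normrN ?normr1 ?normr0.
  case: (boolP (((x, y) : plane R) \in strip' b n%:R^-1)) => [_|/negP ny].
    by case: (_ && _); case: (_ \in _); rewrite ?subrr ?subr0 ?sub0r ?normrN ?normr1 ?normr0 ?addr0 ?add0r.
  have [ci cj] := pij.
  have [->|h] := cell_ray a ci; last by case: nx; apply/mem_set; split.
  have [->|h] := cell_ray b cj; last by case: ny; apply/mem_set; split.
  rewrite (_ : (_ && _) = (((x, y) : plane R) \in (`]-oo, a[%classic `*` `]-oo, b[%classic))) ?subrr ?normr0 ?addr0//.
  apply/idP/idP => [/andP[xa yb]|/set_mem[]] /=.
    by apply/mem_set; split; rewrite /= in_itv.
  by rewrite !in_itv /= => -> ->.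
rewrite ge0_integralD//; [|by apply/measurable_EFinP; exact: mfun_indic..].
rewrite !integral_indic// !setIT.
apply: (@le_lt_trans _ _ ((2 * n%:R^-1)%:E + (2 * n%:R^-1)%:E)%E).
  by apply: leeD; [exact: (leb_strip a i0).1|exact: (leb_strip b i0).2].
by rewrite -EFinD lte_fin; lra.
Unshelve. all: by end_near. Qed.

Lemma ray_lambda (H : set (set (measurableTypeR R))) :
  H setT -> setSD_closed H -> ndseq_closed H ->
  (forall a, H `]-oo, a[%classic) -> forall A, measurable A -> H A.
Proof.
move=> HT HD HU Hray A; rewrite RGenInftyO.measurableE; move: A.
apply: (@lambda_system_subset _ (@RGenInftyO.G R) _ setT H) => //.
- move=> _ _ [x ->] [y ->]; exists (Num.min x y).
  apply/seteqP; split=> z; rewrite /= !in_itv /= lt_min; first by move=> [-> ->].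
  by move=> /andP[].
- by move=> _ [a ->]; exact: Hray.
Qed.

(** Three applications of the pi-lambda theorem: from rays to Borel sets in the second coordinate,
    then in the first one, and finally from rectangles to all measurable sets of the plane. *)
Lemma step_approx_set_all (A : set (plane R)) : measurable A -> step_approx_set A.
Proof.
have S1 a (B : set (measurableTypeR R)) : measurable B ->
    step_approx_set (`]-oo, a[%classic `*` B).
  move: B; apply: ray_lambda.
  (* [leb_sq] does not see the outside of the square, where the second coordinate is at most 1; the
     ray below 2 thus stands for the whole line. *)
  - apply: step_approx_set_sq (step_approx_set_ray a 2).
      by apply: measurableX => //; exact: measurable_itv.
    move=> [x y] [/= _]; rewrite in_itv /= => /andP[_ y1].
    by split=> -[/= ? ?]; split=> //=; rewrite in_itv /= (le_lt_trans y1)// ltr1n.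
  - move=> B B' BB' HB HB'.
    rewrite (_ : _ `*` _ = (`]-oo, a[%classic `*` B) `\` (`]-oo, a[%classic `*` B')).
      by apply: step_approx_setD => // -[x y] [/= ? /BB'].
    apply/seteqP; split=> -[x y] /=; first by move=> [? [? nB]]; split=> // -[].
    by move=> [[? ?] nB]; do 2 split=> //; move=> ?; exact: nB.
  - move=> F ndF HF.
    rewrite (_ : _ `*` _ = \bigcup_k (`]-oo, a[%classic `*` F k)).
      apply: step_approx_set_bigcup => // k l /ndF/subsetPset kl.
      by apply/subsetPset => -[x y] [/= ? /kl].
    by apply/seteqP; split=> -[x y] /=; [move=> [? [k _ ?]]; exists k|move=> [k _ [/= ? ?]]; split=> //; exists k].
  - by move=> b; exact: step_approx_set_ray.
have S2 (B A' : set (measurableTypeR R)) : measurable B -> measurable A' -> step_approx_set (A' `*` B).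
  move=> mB; move: A'; apply: ray_lambda.
  - apply: step_approx_set_sq (S1 2 B mB).
      exact: measurableX.
    move=> [x y] [/=]; rewrite in_itv /= => /andP[_ x1] _.
    by split=> -[/= ? ?]; split=> //=; rewrite in_itv /= (le_lt_trans x1)// ltr1n.
  - move=> A1 A2 A12 HA1 HA2.
    rewrite (_ : _ `*` _ = (A1 `*` B) `\` (A2 `*` B)).
      by apply: step_approx_setD => // -[x y] [/= /A12].
    apply/seteqP; split=> -[x y] /=; first by move=> [[? nA] ?]; split=> // -[].
    by move=> [[? ?] nA]; do 2 split=> //; move=> ?; exact: nA.
  - move=> F ndF HF.
    rewrite (_ : _ `*` _ = \bigcup_k (F k `*` B)).
      apply: step_approx_set_bigcup => // k l /ndF/subsetPset kl.
      by apply/subsetPset => -[x y] [/= /kl].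
    by apply/seteqP; split=> -[x y] /=; [move=> [[k _ ?] ?]; exists k|move=> [k _ [/= ? ?]]; split=> //; exists k].
  - by move=> a; exact: S1.
rewrite measurable_prod_measurableType; move: A.
apply: lambda_system_subset => //.
- move=> _ _ [A1 mA1 [B1 mB1 <-]] [A2 mA2 [B2 mB2 <-]].
  exists (A1 `&` A2); first exact: measurableI.
  exists (B1 `&` B2); first exact: measurableI.
  by apply/seteqP; split=> -[x y] /=; [move=> [[? ?] []]|move=> [[? ?] []]].
- split => //.
  + rewrite -setXTT; exact: S2.
  + exact: step_approx_setD.
  + exact: step_approx_set_bigcup.
- by move=> _ [A1 mA1 [B1 mB1 <-]]; exact: S2.
Qed.

End StepApprox.

(** * Density of step functions in L^1, and cells as test functions for weak convergence *)

Section Density.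
Import HBSimple HBNNSimple.
Context {R : realType}.
Local Notation mu := (@leb_sq R).
Local Notation mfun f := (measurable_fun [set: plane R] (f : plane R -> R)).
Implicit Types (f g h : plane R -> R).

Lemma step_approx_sum (I : Type) (s : seq I) (c : I -> R) (A : I -> set (plane R)) :
  (forall i, measurable (A i)) -> step_approx (fun p => \sum_(i <- s) c i * \1_(A i) p).
Proof.
move=> mA; elim: s => [|i s IH].
  by under eq_fun do rewrite big_nil; exact: step_approx_cst.
under eq_fun do rewrite big_cons; apply: step_approxD => //.
- by apply: measurable_funM; [exact: measurable_cst|exact: mfun_indic].
- apply: measurable_sum => j.
  by apply: measurable_funM; [exact: measurable_cst|exact: mfun_indic].
- apply: step_approxZ; first exact: mfun_indic.
  by have [] := step_approx_set_all (mA i).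
Qed.

Lemma step_approx_integrable g : mu.-integrable setT (EFin \o g) -> step_approx g.
Proof.
have pos (h : plane R -> R) : mu.-integrable setT (EFin \o h) -> (forall p, 0 <= h p) -> step_approx h.
  move=> ih h0; have /integrableP[mh _] := ih.
  have [u [ndu cu]] := approximation measurableT mh (fun p _ => h0 p : (0 <= (EFin \o h) p)%E).
  have u_h k p : u k p <= h p.
    have /fine_cvgP[_ cup] := cu p I.
    rewrite -[leRHS](cvg_lim _ cup)//.
    apply: (@nondecreasing_cvgn_le _ (fun k => u k p)); last by apply/cvg_ex; exists (h p).
    by move=> k1 k2 /ndu/lefP.
  apply: (@step_approx_dominated _ (fun k => u k) _ h) => //.
  - exact/measurable_EFinP.
  - move=> k; rewrite (_ : (u k : _ -> _) = fun p => \sum_(y <- fset_set (range (u k))) y * \1_(u k @^-1` [set y]) p).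
      by apply: step_approx_sum => y; exact: measurable_funPTI.
    apply/funext => p; rewrite {1}fimfunE fsbig_finite//; exact: fimfunP.
  - by move=> p; have /fine_cvgP[_] := cu p I.
  - by move=> k p; rewrite ger0_norm.
move=> ig; have mg : mfun g by case/integrableP : ig => /measurable_EFinP.
have ip (h : plane R -> R) : mfun h -> (forall p, `|h p| <= `|g p|) -> mu.-integrable setT (EFin \o h).
  move=> mh hg; apply: (le_integrable measurableT _ _ ig) => //; first exact/measurable_EFinP.
  by move=> p _; rewrite lee_fin.
have mp : mfun (fun p => Num.max (g p) 0) by exact: measurable_maxr.
have mn : mfun (fun p => Num.max (- g p) 0).
  by apply: measurable_maxr => //; exact: measurableT_comp.
rewrite (_ : g = fun p => Num.max (g p) 0 - Num.max (- g p) 0); last first.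
  by apply/funext => p; case: (leP (g p) 0) => h0; case: (leP (- g p) 0); lra.
apply: step_approxB => //; apply: pos.
- apply: ip => // p; case: (leP (g p) 0) => h0; rewrite ?normr0//.
- by move=> p; rewrite le_max lexx orbT.
- apply: ip => // p; case: (leP (- g p) 0) => h0; rewrite ?normr0 ?normrN//.
- by move=> p; rewrite le_max lexx orbT.
Qed.

Definition clamp (K x : R) := Num.max (- K) (Num.min K x).

Lemma clamp_bound K x : 0 <= K -> `|clamp K x| <= K.
Proof.
by move=> K0; rewrite /clamp ler_norml le_max lexx /= ge_max ge_min lexx /= andbT; lra.
Qed.

Lemma clamp_dist K x y : `|y| <= K -> `|clamp K x - y| <= `|x - y|.
Proof.
rewrite ler_norml => /andP[y1 y2]; rewrite /clamp.
case: (leP K x) => h; last first.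
  case: (leP (- K) x) => h'; first by [].
  by rewrite distrC [leRHS]distrC !ger0_norm; lra.
case: (leP (- K) K) => h'; last by lra.
by rewrite !ger0_norm; lra.
Qed.

(** Clamping the coefficients to [-K, K] only brings them closer to g. The uniform bound is what
    makes the Lipschitz constants of [logmgf_lip] and [tilt_lip] independent of [n]. *)
Lemma step_approx_bounded g (K : R) : mfun g -> (forall p, `|g p| <= K) ->
  forall eps : R, 0 < eps -> \forall n \near \oo,
  exists2 b : 'I_n -> 'I_n -> R, forall i j, `|b i j| <= K & (distL1 (step b) g < eps%:E)%E.
Proof.
move=> mg gK eps e0; have K0 : 0 <= K by exact: le_trans (gK (0, 0)).
have sg : step_approx g by apply: step_approx_integrable; exact: bounded_integrable gK.
near=> n.
have n0 : (0 < n)%N by near: n; exact: nbhs_infty_gt.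
have [b H1] : exists b : 'I_n -> 'I_n -> R, (distL1 (step b) g < eps%:E)%E.
  by near: n; exact: sg.
exists (fun i j => clamp K (b i j)); first by move=> i j; exact: clamp_bound.
apply: le_lt_trans H1; apply: ae_ge0_le_integral => //.
- by apply: measurable_dist => //; exact: measurable_step_real.
- by apply: measurable_dist => //; exact: measurable_step_real.
apply: filterS ae_unit_sq => p /(unit_sq_cell n0)[i [j pij]] _.
by rewrite !(step_cell _ pij) lee_fin clamp_dist.
Unshelve. all: by end_near. Qed.

Lemma Rintegral_mul01_dist h g g' : mfun h -> {ae mu, forall p, 0 <= h p <= 1} ->
  mu.-integrable setT (EFin \o g) -> mu.-integrable setT (EFin \o g') ->
  (`|\int[mu]_p (h p * g p) - \int[mu]_p (h p * g' p)|%:E <= distL1 g g')%E.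
Proof.
move=> mh h01 ig ig'.
have mg : mfun g by case/integrableP : ig => /measurable_EFinP.
have mg' : mfun g' by case/integrableP : ig' => /measurable_EFinP.
have i1 := integrable_mul01 mh h01 ig; have i2 := integrable_mul01 mh h01 ig'.
rewrite -RintegralB//.
have i3 : mu.-integrable setT (EFin \o (fun p => h p * g p - h p * g' p)).
  by apply: eq_integrable (integrableB measurableT i1 i2) => // p _; rewrite /= EFinB.
apply: (@le_trans _ _ (\int[mu]_p `|h p * g p - h p * g' p|)%:E).
  by rewrite lee_fin; exact: le_normr_Rintegral.
rewrite /Rintegral fineK; last first.
  have := integrable_abse i3.
  by move=> /integrable_fin_num -> .
apply: ae_ge0_le_integral => //.
- apply: measurable_dist; exact: measurable_funM.
- exact: measurable_dist.
apply: filterS h01 => p /andP[h0 h1] _.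
by rewrite lee_fin -mulrBr normrM ger0_norm// ler_piMl.
Qed.

Lemma S0_dist (f : @S0 R) g g' :
  mu.-integrable setT (EFin \o g) -> mu.-integrable setT (EFin \o g') ->
  (`|\int[mu]_p ((val f : L2) p * g p) - \int[mu]_p ((val f : L2) p * g' p)|%:E
    <= distL1 g g')%E.
Proof.
by apply: Rintegral_mul01_dist; [exact: L2_measurable|exact: set_mem (valP f)].
Qed.

Definition cell_integral n (i j : 'I_n) (h : plane R -> R) : R :=
  \int[mu]_p (h p * \1_(cell i `*` cell j) p).

Lemma integrable_indic_cell n (i j : 'I_n) :
  mu.-integrable setT (EFin \o (\1_(cell i `*` cell j) : plane R -> R)).
Proof.
apply: (@bounded_integrable _ _ 1).
  by apply: mfun_indic; apply: measurableX; exact: measurable_cell.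
by move=> p; rewrite indicE; case: (_ \in _); rewrite ?normr1 ?normr0.
Qed.

Lemma Rintegral_mul_step h n (b : 'I_n -> 'I_n -> R) :
  mfun h -> {ae mu, forall p, 0 <= h p <= 1} ->
  \int[mu]_p (h p * step b p) = \sum_i \sum_j b i j * cell_integral i j h.
Proof.
move=> mh h01; rewrite /step.
have i1 (i j : 'I_n) : mu.-integrable setT (EFin \o (fun p => h p * \1_(@cell R n i `*` cell j) p)).
  apply: integrable_mul01 => //; exact: integrable_indic_cell.
rewrite pair_bigA /= /Rintegral.
under eq_integral do rewrite pair_bigA /= mulr_sumr -sumEFin.
have E (k : 'I_n * 'I_n) p : (h p * (b k.1 k.2 * \1_(cell k.1 `*` cell k.2) p))%:E =
    ((b k.1 k.2)%:E * (h p * \1_(cell k.1 `*` cell k.2) p)%:E)%E.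
  by rewrite -EFinM mulrCA.
under eq_integral do under eq_bigr do rewrite E.
rewrite integral_sum//; last by move=> k; exact: (integrableZl measurableT (b k.1 k.2) (i1 k.1 k.2)).
rewrite [RHS](_ : _ = fine (\sum_(k : 'I_n * 'I_n) (b k.1 k.2 * cell_integral k.1 k.2 h)%:E)%E).
  congr fine; apply: eq_bigr => k _.
  rewrite (integralZl measurableT (i1 k.1 k.2)) EFinM /cell_integral /Rintegral fineK//.
  exact: integrable_fin_num (i1 _ _).
by rewrite sumEFin.
Qed.

(** Elements of [S0] are bounded by 1, so a test function may be replaced by an L^1-close step
    function with an error uniform along the filter. This leaves a countable family of tests, as the
    almost sure convergence requires. *)
Lemma S0_cvg_cells (F : set_system (@S0 R)) (f : @S0 R) : Filter F ->
  (forall n (i j : 'I_n), cell_integral i j (val h : L2) @[h --> F] -->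
    cell_integral i j (val f : L2)) -> F --> f.
Proof.
move=> FF Fc; apply: S0_cvg => g; rewrite /inner.
apply/cvgrPdist_lt => e e0.
have e3 : 0 < e / 3 by rewrite divr_gt0.
have ig := L2_integrable g.
have [N _ /(_ N (leqnn _))[b bg]] := step_approx_integrable ig e3.
have ib : mu.-integrable setT (EFin \o step b) by exact: integrable_step.
have cb : \int[mu]_p ((val h : L2) p * step b p) @[h --> F] -->
    \int[mu]_p ((val f : L2) p * step b p).
  have E (h : @S0 R) : \int[mu]_p ((val h : L2) p * step b p) =
      \sum_i \sum_j b i j * cell_integral i j (val h : L2).
    by apply: Rintegral_mul_step; [exact: L2_measurable|exact: set_mem (valP h)].
  rewrite E; rewrite (_ : (fun h : @S0 R => _) = fun h : @S0 R =>
    \sum_i \sum_j b i j * cell_integral i j (val h : L2)); last exact/funext.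
  apply: cvg_big => [|i _]; first exact: add_continuous.
  apply: cvg_big => [|j _]; first exact: add_continuous.
  by apply: cvgM; [exact: cvg_cst|exact: Fc].
have := cb => /cvgrPdist_lt/(_ _ e3); apply: filterS => h H.
have d1 := le_lt_trans (S0_dist f ib ig) bg.
have d2 := le_lt_trans (S0_dist h ib ig) bg.
rewrite !lte_fin in d1 d2.
rewrite (_ : _ - _ =
  - (\int[mu]_p ((val f : L2) p * step b p) - \int[mu]_p ((val f : L2) p * (g : L2) p))
  + (\int[mu]_p ((val f : L2) p * step b p) - \int[mu]_p ((val h : L2) p * step b p))
  + (\int[mu]_p ((val h : L2) p * step b p) - \int[mu]_p ((val h : L2) p * (g : L2) p)));
  last by ring.
apply: le_lt_trans (ler_normD _ _) _.
have := ler_normD (- (\int[mu]_p ((val f : L2) p * step b p) - \int[mu]_p ((val f : L2) p * (g : L2) p)))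
 (\int[mu]_p ((val f : L2) p * step b p) - \int[mu]_p ((val h : L2) p * step b p)).
rewrite normrN; lra.
Qed.

End Density.

(** * Compactness *)

Section Compactness.
Context {R : realType}.
Local Notation mu := (@leb_sq R).
Local Notation mfun f := (measurable_fun [set: plane R] (f : plane R -> R)).

Lemma ultra_cvg_bounded (T : Type) (F : set_system T) (u : T -> R) (K : R) :
  UltraFilter F -> (forall x, 0 <= u x <= K) -> exists l : R, u x @[x --> F] --> l.
Proof.
move=> FU uK; have FF : ProperFilter F by apply: ultra_proper.
have : compact `[0, K]%classic by exact: segment_compact.
move=> /(_ (u x @[x --> F]) _) [|l [_ cl]].
  by have : F (u @^-1` `[0, K]) by apply: filterE => x; rewrite /= in_itv /=; exact: uK.
exists l => V lV; have [//|FC] := in_ultra_setVsetC (u @^-1` V) FU.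
by have [y []] := cl (~` V) V FC lV.
Qed.

Lemma S0_of_fun (f : plane R -> R) : mfun f -> (forall p, 0 <= f p <= 1) ->
  exists h : @S0 R, {ae mu, forall p, (val h : L2) p = f p}.
Proof.
move=> mf f01.
have [p|h hf] := @mkL2 R f 1 mf; first by rewrite ger0_norm; case/andP: (f01 p).
have h01 : S0 (h : @weakL2 R) by apply: filterS hf => p /= ->.
by exists (exist _ (h : @weakL2 R) (mem_set h01)).
Qed.

Lemma leb_sq_fin_num (A : set (plane R)) : measurable A -> mu A \is a fin_num.
Proof.
move=> mA; rewrite ge0_fin_numE//; apply: (@le_lt_trans _ _ (mu setT)).
  by apply: le_measure; rewrite ?inE.
by rewrite leb_sq_setT ltry.
Qed.

Lemma le_sandwich_tail (a b x y : R) : x <= y -> 0 <= x ->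
  (a + x) - ((b + y) - b) <= a <= a + x.
Proof. by move=> xy x0; rewrite [b + y]addrC addrK lerBlDr lerD2l xy lerDl. Qed.

Section Ultra.
Variables (F : set_system (@S0 R)).
Hypothesis (FU : UltraFilter F).
Let FF : ProperFilter F. Proof. exact: ultra_proper. Qed.

(** The mass of A under the measure with density h. The value 0 on nonmeasurable sets makes the
    limit along the ultrafilter exist for every A. *)
Let pr (A : set (plane R)) (h : @S0 R) : R :=
  if pselect (measurable A) then \int[mu]_p ((val h : L2) p * \1_A p) else 0.

Let indic_integrable A : measurable A ->
  mu.-integrable setT (EFin \o (\1_A : plane R -> R)).
Proof.
move=> mA; apply: (@bounded_integrable _ _ 1); first exact: mfun_indic.
by move=> p; rewrite indicE; case: (_ \in _); rewrite ?normr1 ?normr0.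
Qed.

Let prE A h : measurable A -> pr A h = \int[mu]_p ((val h : L2) p * \1_A p).
Proof. by rewrite /pr; case: pselect. Qed.

Let pr_le A h : measurable A -> 0 <= pr A h <= fine (mu A).
Proof.
move=> mA; rewrite prE//; have i1 := S0_integrable h (indic_integrable mA).
apply/andP; split.
  rewrite /Rintegral fine_ge0//.
  rewrite (ae_eq_integral (fun p => (`|(val h : L2) p| * \1_A p)%:E))//.
  - by apply: integral_ge0 => p _; rewrite lee_fin mulr_ge0.
  - by case/integrableP : i1.
  - apply/measurable_EFinP; apply: measurable_funM; last exact: mfun_indic.
    by apply: measurableT_comp => //; exact: L2_measurable.
  - by apply: filterS (set_mem (valP h)) => p /andP[h0 _] _; rewrite ger0_norm.
have d := S0_dist h (indic_integrable mA) (@integrable_cst R 0).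
rewrite -lee_fin [leRHS]fineK ?leb_sq_fin_num//.
have -> : mu A = distL1 (\1_A) (cst 0).
  rewrite -[A in LHS]setIT -integral_indic//.
  by apply: eq_integral => p _; rewrite subr0 ger0_norm.
apply: le_trans d; rewrite lee_fin.
have -> : \int[mu]_p ((val h : L2) p * (cst 0 : plane R -> R) p) = 0.
  by rewrite /Rintegral; under eq_integral do rewrite mulr0; rewrite integral0.
by rewrite subr0 ler_norm.
Qed.

Let pr0 A h : ~ measurable A -> pr A h = 0.
Proof. by rewrite /pr; case: pselect. Qed.

Let lim_ex A : exists l : R, pr A h @[h --> F] --> l.
Proof.
have [mA|nA] := pselect (measurable A).
  by apply: (ultra_cvg_bounded FU) => h; exact: pr_le.
by exists 0; under eq_fun do rewrite pr0//; exact: cvg_cst.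
Qed.

Let nu (A : set (plane R)) : \bar R := (lim (pr A h @[h --> F]))%:E.

Let nu_cvg A : pr A h @[h --> F] --> fine (nu A).
Proof. by have [l cl] := lim_ex A; rewrite /nu/= (cvg_lim _ cl). Qed.

Let nuE A l : pr A h @[h --> F] --> l -> nu A = l%:E.
Proof. by move=> cl; rewrite /nu (cvg_lim _ cl). Qed.

Let nu_le A : measurable A -> (nu A <= mu A)%E.
Proof.
move=> mA; rewrite -[leRHS]fineK ?leb_sq_fin_num//.
rewrite /nu lee_fin; apply: limr_le; first by apply/cvg_ex; exact: lim_ex.
by near=> h; have /andP[] := pr_le h mA.
Unshelve. all: by end_near. Qed.

Let nu_ge0 A : (0 <= nu A)%E.
Proof.
rewrite /nu lee_fin; apply: limr_ge; first by apply/cvg_ex; exact: lim_ex.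
near=> h; have [mA|nA] := pselect (measurable A); last by rewrite pr0.
by have /andP[] := pr_le h mA.
Unshelve. all: by end_near. Qed.

Let nu0 : nu set0 = 0%E.
Proof. by apply/eqP; rewrite eq_le nu_ge0 andbT -(measure0 mu) nu_le. Qed.

Let nuU A B : measurable A -> measurable B -> A `&` B = set0 ->
  nu (A `|` B) = (nu A + nu B)%E.
Proof.
move=> mA mB AB; apply: nuE.
have -> : pr (A `|` B) = fun h => pr A h + pr B h.
  apply/funext => h; rewrite !prE//; last exact: measurableU.
  rewrite -RintegralD//; [|exact: S0_integrable (indic_integrable _)..].
  apply: eq_Rintegral => p _; rewrite -mulrDr !indicE in_setU.
case: (boolP (p \in A)) => pA; case: (boolP (p \in B)) => pB; rewrite ?addr0 ?add0r//.
have : (A `&` B) p by split; exact: set_mem.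
by rewrite AB.
by apply: cvgD; exact: nu_cvg.
Qed.

Let nu_bigU (A : (set (plane R))^nat) n : (forall i, measurable (A i)) ->
  trivIset setT A -> nu (\big[setU/set0]_(i < n) A i) = (\sum_(0 <= i < n) nu (A i))%E.
Proof.
move=> mA tA; elim: n => [|n IH]; first by rewrite big_ord0 big_geq// nu0.
rewrite big_ord_recr big_nat_recr//= nuU ?IH//; first exact: bigsetU_measurable.
rewrite -bigcup_mkord -subset0 => p [[i /= ni Aip] Anp].
have ein : i = n by apply: tA => //; exists p.
by rewrite ein ltnn in ni.
Qed.

(** A setwise limit is a priori only finitely additive. Here it is dominated by the finite measure
    [mu], so the mass left in the tail of a disjoint union is at most its [mu]-mass, which tends to
    zero. *)
Let nu_sigma : semi_sigma_additive nu.
Proof.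
move=> A mA tA mU.
have mUn n : measurable (\big[setU/set0]_(i < n) A i) by exact: bigsetU_measurable.
pose s n := fine (nu (\big[setU/set0]_(i < n) A i)).
pose m n := fine (\sum_(0 <= i < n) mu (A i)).
set U := \bigcup_n A n.
have cm : m n @[n --> \oo] --> fine (mu U).
  by apply: fine_cvg; rewrite fineK ?leb_sq_fin_num//; exact: measure_semi_sigma_additive.
have -> : (fun n => (\sum_(0 <= i < n) nu (A i))%E) = EFin \o s.
  by apply/funext => n; rewrite -nu_bigU.
suff cs : s n @[n --> \oo] --> fine (nu U).
  by apply: cvg_comp cs _; exact: cvg_id.
have key n : fine (nu U) - (fine (mu U) - m n) <= s n <= fine (nu U).
  set B := \big[setU/set0]_(i < n) A i; have mB : measurable B := mUn n.
  have AU : B `<=` U by rewrite /B -bigcup_mkord; apply: bigcup_sub => i _; exact: bigcup_sup.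
  have mD : measurable (U `\` B) by exact: measurableD.
  have UE : B `|` (U `\` B) = U by exact: setDUK.
  have dj : B `&` (U `\` B) = set0 by exact: setDIK.
  have e1 : fine (nu U) = fine (nu B) + fine (nu (U `\` B)) by rewrite -{1}UE nuU.
  have e2 : fine (mu U) = fine (mu B) + fine (mu (U `\` B)).
    by rewrite -fineD ?leb_sq_fin_num// -[in LHS]UE measureU.
  have e3 : m n = fine (mu B).
    by rewrite /m /B big_mkord; congr fine; apply/esym/measure_semi_additive.
  have d1 : fine (nu (U `\` B)) <= fine (mu (U `\` B)).
    by rewrite fine_le ?leb_sq_fin_num//; exact: nu_le.
  have d2 : 0 <= fine (nu (U `\` B)) by rewrite fine_ge0.
  by rewrite /s -/B e1 e2 e3; exact: le_sandwich_tail.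
apply: (@squeeze_cvgr _ _ _ _ (fun n => fine (nu U) - (fine (mu U) - m n)) (fun=> fine (nu U))).
- by apply: nearW => n; exact: key.
- rewrite -[X in _ --> X]subr0 -[X in _ - X](subrr (fine (mu U))).
  apply: cvgB; first exact: cvg_cst.
  by apply: cvgB => //; exact: cvg_cst.
- exact: cvg_cst.
Qed.

(** The limit is the Radon-Nikodym density of [nu], truncated at 1. It is tested on cells, where
    convergence is the definition of [nu]. *)
Lemma ultra_S0_cvg : exists f : @S0 R, F --> f.
Proof.
have [nuF nuFE] : exists m : {finite_measure set (plane R) -> \bar R}, forall A, m A = nu A.
  pose nuM : {measure set (plane R) -> \bar R} := HB.pack_for
    {measure set (plane R) -> \bar R} nu (isMeasure.Build _ _ _ nu nu0 nu_ge0 nu_sigma).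
  have nufin : fin_num_fun nuM by move=> A mA; rewrite /= /nu.
  by exists (HB.pack_for {finite_measure set (plane R) -> \bar R} nu
    (isMeasure.Build _ _ _ nu nu0 nu_ge0 nu_sigma) (Measure_isFinite.Build _ _ _ nuM nufin)).
have [muF muFE] : exists m : {finite_measure set (plane R) -> \bar R}, forall A, m A = mu A.
  have mufin : fin_num_fun (mu : set (plane R) -> \bar R) by exact: leb_sq_fin_num.
  by exists (HB.pack_for {finite_measure set (plane R) -> \bar R} (mrestr leb2 measurable_unit_sq)
    (Measure_isFinite.Build _ _ _ (mrestr leb2 measurable_unit_sq) mufin)).
have intE (C : set (plane R)) (k : plane R -> \bar R) :
    (\int[muF]_(x in C) k x = \int[mu]_(x in C) k x)%E.
  by apply: eq_measure_integral => A mA _; exact: muFE.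
have [A nA B mB BA|f [f0 intf nuf]] := @radon_nikodym_finite _ _ _ muF nuF.
  have mB0 : mu B = 0%E by rewrite -muFE; exact: nA.
  by apply/eqP; rewrite nuFE eq_le nu_ge0 andbT -mB0; exact: nu_le.
have mf : measurable_fun setT f by case/integrableP : intf.
pose N := [set p | (1%:E < f p)%E].
have mN : measurable N.
  by rewrite -[N]setTI; apply: emeasurable_fun_o_infty.
(* On a measurable part E of the set where f > 1, the integral of f is at least mu E and equals nu
   E, which is at most mu E. Hence f = 1 almost everywhere where f > 1, and that set is null. *)
have f1 : {ae mu, forall p, (f p <= 1)%E}.
  have : ae_eq muF N (cst 1%:E) f.
    apply: integral_ae_eq => //.
    - exact: finite_measure_integrable_cst.
    - exact: measurable_funTS.
    move=> E EN mE; apply/eqP; rewrite eq_le; apply/andP; split.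
      apply: ge0_le_integral => //; first exact: measurable_funTS.
      by move=> p /EN /ltW.
    by rewrite integral_cst// mul1e; have := nu_le mE; rewrite -muFE -nuFE nuf.
  move=> [B [mB B0 NB]]; exists B; split => //; first by rewrite -muFE.
  move=> p /= /negP; rewrite -ltNge => fp; apply: NB => /= /(_ fp) e.
  by move: fp; rewrite -e /= ltxx.
pose f' p := fine (mine (f p) 1%:E).
have f'E p : (f p <= 1)%E -> (f' p)%:E = f p.
  move=> fp; rewrite /f' min_l// fineK// ge0_fin_numE ?f0//.
  by rewrite (le_lt_trans fp)// ltry.
have mf' : mfun f'.
  by apply: measurableT_comp => //; exact: measurable_mine.
have f'01 p : 0 <= f' p <= 1.
  rewrite /f'; have f0p := f0 p.
  have fin : mine (f p) 1%E \is a fin_num.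
    rewrite ge0_fin_numE; last by rewrite le_min f0p lee01.
    by rewrite gt_min ltry orbT.
  by rewrite -!lee_fin fineK// le_min f0p lee01 ge_min lexx orbT.
have [h hf] := S0_of_fun mf' f'01.
exists h; apply: S0_cvg_cells => n i j.
pose C : set (plane R) := cell i `*` cell j.
have mC : measurable C by apply: measurableX; exact: measurable_cell.
rewrite (_ : (fun k : @S0 R => _) = pr C); last first.
  by apply/funext => k; rewrite prE.
suff -> : cell_integral i j (val h : L2) = fine (nu C) by exact: nu_cvg.
rewrite -nuFE nuf// intE /cell_integral /Rintegral [in RHS]integral_mkcond; congr fine.
apply: ae_eq_integral => //.
- apply/measurable_EFinP; apply: measurable_funM; last exact: mfun_indic.
  exact: L2_measurable.
- by apply: (measurable_restrictT f mC).1; exact: measurable_funTS.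
apply: filterS2 hf f1 => p hp fp _.
rewrite hp EFinM f'E// /patch indicE; case: ifP => _; rewrite ?mule1 ?mule0//.
Qed.
End Ultra.

Lemma compact_S0 : compact [set: @S0 R].
Proof.
rewrite compact_ultra => F FU _; have [f Ff] := ultra_S0_cvg FU.
by exists f.
Qed.

Lemma compact_ptws_S0 (I : eqType) : compact [set: {ptws I -> @S0 R}].
Proof.
have := @tychonoff I (fun=> @S0 R) (fun=> setT) (fun=> compact_S0).
by congr compact; apply/seteqP; split.
Qed.

End Compactness.

(** * Product weights *)

Section ProductWeights.
Context {R : realType}.

Definition prod_weight (K : finType) (l : K -> bool -> R) (y : {ffun K -> bool}) : R :=
  \prod_k l k (y k).

Lemma prod_weight_ge0 (K : finType) (l : K -> bool -> R) y :
  (forall k b, 0 <= l k b) -> 0 <= prod_weight l y.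
Proof. by move=> l0; apply: prodr_ge0 => k _. Qed.

Lemma prod_weight_mgf (K : finType) (l : K -> bool -> R) (c : K -> R) :
  \sum_(y : {ffun K -> bool}) prod_weight l y * expR (\sum_k c k * (y k)%:R) =
  \prod_k (l k false + l k true * expR (c k)).
Proof.
have E k : l k false + l k true * expR (c k) =
    \sum_(b : bool) l k b * expR (c k * b%:R).
  by rewrite big_bool /= mulr1 mulr0 expR0 mulr1 addrC.
under [RHS]eq_bigr do rewrite E.
rewrite bigA_distr_bigA /=; apply: eq_bigr => y _.
by rewrite expR_sum /prod_weight -big_split.
Qed.

(** The exponential Markov inequality for weights of arbitrary total mass, which is accounted for by
    the product on the right. *)
Lemma chernoff (K : finType) (l : K -> bool -> R) (c : K -> R) (a : R) :
  (forall k b, 0 <= l k b) ->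
  \sum_(y : {ffun K -> bool} | a <= \sum_k c k * (y k)%:R) prod_weight l y <=
  expR (- a) * \prod_k (l k false + l k true * expR (c k)).
Proof.
move=> l0; rewrite -prod_weight_mgf mulr_sumr big_mkcond /=.
apply: ler_sum => y _; have w0 := prod_weight_ge0 y l0.
case: ifPn => h; last by rewrite mulr_ge0 ?mulr_ge0 ?expR_ge0.
rewrite mulrCA -expRD; apply: ler_peMr => //.
by rewrite -[X in X <= _]expR0 ler_expR addrC subr_ge0.
Qed.

End ProductWeights.

(** * Weights on configurations and the uniform Chernoff bound *)

Section Weights.
Context {R : realType} (I : finType).
Local Notation mu := (@leb_sq R).
Local Notation mfun f := (measurable_fun [set: plane R] (f : plane R -> R)).

Lemma sumr_cst (J : finType) (c : R) : \sum_(j : J) c = #|J|%:R * c.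
Proof. by rewrite (eq_bigl (mem J))// sumr_const mulr_natl. Qed.

Definition cfg n := {ffun I * ('I_n * 'I_n) -> bool}.

Definition cfg_step n (y : cfg n) (t : I) : plane R -> R :=
  step (fun i j => (y (t, (i, j)))%:R).

Definition pairing n (y : cfg n) (t : I) (phi : plane R -> R) : R :=
  \int[mu]_p (cfg_step y t p * phi p).

Definition cfg_weight n (l : I -> 'I_n -> 'I_n -> bool -> R) (y : cfg n) : R :=
  prod_weight (fun k => l k.1 k.2.1 k.2.2) y.

(** The only information on the chains that the large deviation estimates use. Both masses are
    compared with their limits, as they need not sum to one; the lower bound 1/2 on the sum keeps
    the logarithms in [logmgf] under control. *)
Definition near_weights n (W : I -> plane R -> R) (eta : R)
    (l : I -> 'I_n -> 'I_n -> bool -> R) := forall t,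
  [/\ forall i j b, 0 <= l t i j b,
      forall i j, 2^-1 <= l t i j false + l t i j true,
      (distL1 (step (fun i j => l t i j true)) (W t) < eta%:E)%E &
      (distL1 (step (fun i j => l t i j false)) (fun p => (1 - W t p)%R) < eta%:E)%E].

Lemma near_weights_le W n l (e e' : R) : e <= e' ->
  @near_weights n W e l -> @near_weights n W e' l.
Proof.
move=> le lW t; have [? ? h1 h2] := lW t; split => //.
  by apply: lt_le_trans h1 _; rewrite lee_fin.
by apply: lt_le_trans h2 _; rewrite lee_fin.
Qed.

(** The class of near weights shrinks with [eta], so finitely many requirements are met together by
    taking the minimum. *)
Lemma near_weights_forall (J : finType) W
    (Q : J -> forall n, (I -> 'I_n -> 'I_n -> bool -> R) -> Prop) :
  (forall j, exists2 eta : R, 0 < eta & \forall n \near \oo,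
     forall l, @near_weights n W eta l -> Q j n l) ->
  exists2 eta : R, 0 < eta & \forall n \near \oo,
    forall l, @near_weights n W eta l -> forall j, Q j n l.
Proof.
move=> H; have /choice[eta etaP] : forall j, exists eta : R, 0 < eta /\
    \forall n \near \oo, forall l, @near_weights n W eta l -> Q j n l.
  by move=> j; have [eta] := H j; exists eta.
exists (\big[Num.min/1]_j eta j).
  by apply: (big_ind (fun e => 0 < e)) => // [u v u0 v0|j _]; [rewrite lt_min u0|case: (etaP j)].
have : \forall n \near \oo, forall j l, @near_weights n W (eta j) l -> Q j n l.
  by apply: filter_forall => j; case: (etaP j).
apply: filterS => n Hn l lW j; apply: Hn; apply: near_weights_le lW.
exact: bigmin_le.
Qed.

Lemma cfg_step01 n (y : cfg n) t p : 0 <= cfg_step y t p <= 1.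
Proof. exact: step01. Qed.

Lemma measurable_cfg_step n (y : cfg n) t : mfun (cfg_step y t).
Proof. exact: measurable_step_real. Qed.

Lemma pairing_dist n (y : cfg n) t phi psi :
  mu.-integrable setT (EFin \o phi) -> mu.-integrable setT (EFin \o psi) ->
  (`|pairing y t phi - pairing y t psi|%:E <= distL1 phi psi)%E.
Proof.
apply: Rintegral_mul01_dist; first exact: measurable_cfg_step.
by apply: aeW => p; exact: cfg_step01.
Qed.

Lemma pairing_step n (y : cfg n) t (b : 'I_n -> 'I_n -> R) :
  pairing y t (step b) = n%:R^-2 * \sum_i \sum_j b i j * (y (t, (i, j)))%:R.
Proof.
rewrite /pairing /cfg_step; under eq_Rintegral do rewrite step_mul.
rewrite Rintegral_step; congr (_ * _); apply: eq_bigr => i _; apply: eq_bigr => j _.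
by rewrite mulrC.
Qed.

Lemma Rintegral_dist f g :
  mu.-integrable setT (EFin \o f) -> mu.-integrable setT (EFin \o g) ->
  (`|\int[mu]_p f p - \int[mu]_p g p|%:E <= distL1 f g)%E.
Proof.
move=> fi gi.
have := @Rintegral_mul01_dist R (cst 1) f g (measurable_cst _).
under [X in _ -> _ -> _ -> (`|X - _|%:E <= _)%E]eq_Rintegral do rewrite mul1r.
under [X in _ -> _ -> _ -> (`|_ - X|%:E <= _)%E]eq_Rintegral do rewrite mul1r.
by apply => //; apply: aeW => p /=; rewrite ler01 lexx.
Qed.

Variable W : I -> plane R -> R.
Hypothesis mW : forall t, mfun (W t).
Hypothesis W01 : forall t p, 0 < W t p < 1.

Lemma measurable_funV (w : plane R -> R) : mfun w -> mfun (fun p => (w p)^-1).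
Proof.
move=> mw; have mexp (u : plane R -> R) : mfun u -> mfun (fun p => expR (- ln (u p))).
  move=> mu_; apply: measurableT_comp => //; apply: measurableT_comp => //.
  by apply: measurableT_comp => //; exact: measurable_ln.
rewrite (_ : (fun p => _) = fun p => if 0 < w p then expR (- ln (w p)) else
    if w p < 0 then - expR (- ln (- w p)) else 0).
  apply: measurable_fun_ifT; [exact: measurable_fun_ltr|exact: mexp|].
  apply: measurable_fun_ifT => //; first exact: measurable_fun_ltr.
  by apply: measurableT_comp => //; apply: mexp; exact: measurableT_comp.
apply/funext => p; rewrite !expRN; have [w0|w0|<-] := ltgtP 0 (w p).
- by rewrite lnK.
- by rewrite lnK ?posrE ?oppr_gt0// invrN opprK.
- exact: invr0.
Qed.

Lemma measurable_logmgf f g h : mfun f -> mfun g -> mfun h ->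
  mfun (fun p => logmgf (f p) (g p) (h p)).
Proof.
move=> mf mg mh; apply: measurableT_comp; first exact: measurable_ln.
apply: measurable_funD => //; apply: measurable_funM => //.
by apply: measurableT_comp.
Qed.

Lemma measurable_tilt f g : mfun f -> mfun g ->
  mfun (fun p => tilt (1 - f p) (f p) (g p)).
Proof.
move=> mf mg; have me : mfun (fun p => f p * expR (g p)).
  by apply: measurable_funM => //; exact: measurableT_comp.
apply: measurable_funM => //; apply: measurable_funV.
by apply: measurable_funD => //; exact: measurable_funB.
Qed.

Lemma bounded_integral_logmgf t g (K : R) : mfun g -> (forall p, `|g p| <= K) ->
  mu.-integrable setT (fun p => (logmgf (1 - W t p) (W t p) (g p))%:E).
Proof.
move=> mg gK; apply: (@bounded_integrable _ _ K).
  by apply: measurable_logmgf => //; exact: measurable_funB.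
move=> p; have /andP[w0 w1] := W01 t p.
have := gK p; rewrite ler_norml => /andP[g1 g2].
have K0 : 0 <= K by exact: le_trans (normr_ge0 _) (gK p).
have e1 : expR (- K) <= expR (g p) by rewrite ler_expR.
have e2 : expR (g p) <= expR K by rewrite ler_expR.
have k1 : expR (- K) <= 1 by rewrite -expR0 ler_expR; lra.
have k2 : 1 <= expR K by rewrite -expR0 ler_expR.
have k0 := expR_gt0 (- K).
have D1 : expR (- K) <= 1 - W t p + W t p * expR (g p) by nra.
have D2 : 1 - W t p + W t p * expR (g p) <= expR K by nra.
rewrite /logmgf ler_norml -[X in X <= _]expRK -[X in _ && (_ <= X)]expRK.
have D0 := lt_le_trans k0 D1.
by rewrite !ler_ln ?posrE ?expR_gt0 ?D1 ?D2.
Qed.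

(** One choice of coefficients has to serve three purposes: approximate the test function, its
    log-moment generating function, and the tilted parameter. *)
Definition step_data n (l : I -> 'I_n -> 'I_n -> bool -> R) t (phi : plane R -> R)
    (K eps : R) (b : 'I_n -> 'I_n -> R) :=
  [/\ forall i j, `|b i j| <= K,
    (distL1 (step b) phi < eps%:E)%E,
    (distL1 (step (fun i j => logmgf (l t i j false) (l t i j true) (b i j)))
       (fun p => logmgf (1 - W t p)%R (W t p) (phi p)) < eps%:E)%E &
    (distL1 (step (fun i j => tilt (l t i j false) (l t i j true) (b i j)))
       (fun p => tilt (1 - W t p)%R (W t p) (phi p)) < eps%:E)%E].

Lemma near_weights_approx (phi : plane R -> R) (K : R) t :
  mfun phi -> (forall p, `|phi p| <= K) -> forall eps : R, 0 < eps ->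
  exists2 eta : R, 0 < eta & \forall n \near \oo, forall l, @near_weights n W eta l ->
  exists b, @step_data n l t phi K eps b.
Proof.
move=> mphi phiK eps e0.
have K0 : 0 <= K by exact: le_trans (phiK (0, 0)).
pose C := 2 * expR K * expR K.
have eK : 1 <= expR K by rewrite -expR0 ler_expR.
have C1 : 1 <= C by rewrite /C; nra.
have C0 : 0 < C by lra.
(* Three L^1 errors below [eta] (two masses and the test function), multiplied by the Lipschitz
   constant C, give at most 3/4 of [eps]. *)
pose eta : R := eps / (4 * C).
have eta0 : 0 < eta by apply: divr_gt0 => //; apply: mulr_gt0.
have etaE : C * (3 * eta) < eps.
  rewrite (_ : C * (3 * eta) = 3 / 4 * eps) /eta; first by lra.
  by field; rewrite gt_eqF.
exists eta => //; near=> n.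
have n0 : (0 < n)%N by near: n; exact: nbhs_infty_gt.
move=> l lW.
have [b bK bphi] : exists2 b : 'I_n -> 'I_n -> R, forall i j, `|b i j| <= K
    & (distL1 (step b) phi < eta%:E)%E.
  by near: n; exact: step_approx_bounded.
exists b; have [l0 l2 l1W l0W] := lW t.
have mW1 : mfun (fun p => 1 - W t p) by exact: measurable_funB.
have main (F : R -> R -> R -> R) : mfun (fun p => F (1 - W t p) (W t p) (phi p)) ->
    (forall i j p, `|F (l t i j false) (l t i j true) (b i j) -
       F (1 - W t p) (W t p) (phi p)| <= C * (`|l t i j false - (1 - W t p)| +
       `|l t i j true - W t p| + `|b i j - phi p|)) ->
    (distL1 (step (fun i j => F (l t i j false) (l t i j true) (b i j)))
       (fun p => F (1 - W t p)%R (W t p) (phi p)) < eps%:E)%E.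
  move=> mF FC.
  have := @distL1_sum R _ (enum 'I_3)
    (fun k => nth (cst 0) [:: step (fun i j => l t i j false);
       step (fun i j => l t i j true); step b] (k : nat))
    (fun k => nth (cst 0) [:: (fun p => 1 - W t p); W t; phi] (k : nat)) C
    (step (fun i j => F (l t i j false) (l t i j true) (b i j)))
    (fun p => F (1 - W t p) (W t p) (phi p)) (ltW C0).
  rewrite !enum_ordSl enum_ord0 !big_cons big_nil /= adde0.
  move=> H; apply: (le_lt_trans (H _ _ _ _ _)) => //.
  - by case => -[|[|[|//]]] //= _; exact: measurable_step_real.
  - by case => -[|[|[|//]]] /=.
  - exact: measurable_step_real.
  - apply: filterS ae_unit_sq => p /(unit_sq_cell n0)[i [j pij]].
    by rewrite !big_cons big_nil /= !(step_cell _ pij) addr0 addrA.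
  apply: (@lt_trans _ _ (C%:E * (eta%:E + (eta%:E + eta%:E)))%E).
    by rewrite lte_pmul2l ?lte_fin// lteD// lteD.
  rewrite -!EFinD -EFinM lte_fin; apply: le_lt_trans etaE.
  by rewrite (_ : eta + (eta + eta) = 3 * eta)//; ring.
have pre i j p := (l0 i j false, l0 i j true, l2 i j, bK i j, phiK p).
split => //.
- apply: (lt_trans bphi); rewrite lte_fin; nra.
- apply: main; first exact: measurable_logmgf.
  move=> i j p; have /andP[w0 w1] := W01 t p.
  by apply: logmgf_lip; rewrite ?pre ?subr_ge0 ?ltW//; ring.
- apply: main; first by apply: measurable_tilt.
  move=> i j p; have /andP[w0 w1] := W01 t p.
  by apply: tilt_lip; rewrite ?pre ?subr_ge0 ?ltW//; ring.
Unshelve. all: by end_near. Qed.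

Lemma near_weights_approx_all (phi : I -> plane R -> R) (K : R) :
  (forall t, mfun (phi t)) -> (forall t p, `|phi t p| <= K) -> forall eps : R, 0 < eps ->
  exists2 eta : R, 0 < eta & \forall n \near \oo, forall l, @near_weights n W eta l ->
  exists b, forall t, @step_data n l t (phi t) K eps (b t).
Proof.
move=> mphi phiK eps e0.
have [eta eta0 H] := near_weights_forall (fun t => near_weights_approx t (mphi t) (phiK t) e0).
by exists eta => //; apply: filterS H => n H l /H/choice[b bP]; exists b.
Qed.

Lemma sum_cfg_index n (F : I -> 'I_n -> 'I_n -> R) :
  \sum_(k : I * ('I_n * 'I_n)) F k.1 k.2.1 k.2.2 = \sum_t \sum_i \sum_j F t i j.
Proof.
rewrite -(pair_bigA _ (fun t ij => F t ij.1 ij.2)) /=; apply: eq_bigr => t _.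
by rewrite -(pair_bigA _ (fun i j => F t i j)).
Qed.

Lemma Rintegral_step_le n (b : 'I_n -> 'I_n -> R) f (eps : R) :
  mu.-integrable setT (EFin \o f) -> (distL1 (step b) f < eps%:E)%E ->
  `|n%:R^-2 * \sum_i \sum_j b i j - \int[mu]_p f p| < eps.
Proof.
move=> fi d; rewrite -lte_fin; apply: le_lt_trans d; rewrite -Rintegral_step.
by apply: Rintegral_dist => //; exact: integrable_step.
Qed.

Lemma pairing_step_le n (y : cfg n) t (b : 'I_n -> 'I_n -> R) f (eps : R) :
  mu.-integrable setT (EFin \o f) -> (distL1 (step b) f < eps%:E)%E ->
  `|n%:R^-2 * \sum_i \sum_j b i j * (y (t, (i, j)))%:R - pairing y t f| < eps.
Proof.
move=> fi d; rewrite -lte_fin; apply: le_lt_trans d; rewrite -pairing_step.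
by apply: pairing_dist => //; exact: integrable_step.
Qed.

Lemma logmgf_sum_prod n (l : I -> 'I_n -> 'I_n -> bool -> R) (b : I -> 'I_n -> 'I_n -> R) :
  (forall t i j x, 0 <= l t i j x) -> (forall t i j, 2^-1 <= l t i j false + l t i j true) ->
  \prod_(k : I * ('I_n * 'I_n)) (l k.1 k.2.1 k.2.2 false +
      l k.1 k.2.1 k.2.2 true * expR (b k.1 k.2.1 k.2.2)) =
  expR (\sum_t \sum_i \sum_j logmgf (l t i j false) (l t i j true) (b t i j)).
Proof.
move=> l0 l2; rewrite -(sum_cfg_index (fun t i j => logmgf (l t i j false) (l t i j true) (b t i j))).
rewrite expR_sum; apply: eq_bigr => k _; rewrite lnK// posrE.
have := mgf_ge (lexx `|b k.1 k.2.1 k.2.2|) (l0 k.1 k.2.1 k.2.2 false)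
  (l0 k.1 k.2.1 k.2.2 true) (l2 k.1 k.2.1 k.2.2) (lexx _).
apply: lt_le_trans.
by rewrite divr_gt0 ?expR_gt0.
Qed.

(** Chernoff's bound for step coefficients approximating [phi], rescaled by n^2. Neither [eta] nor
    the threshold on [n] depends on the level a, which is shifted by a dual constant in
    [graphon_upper]. *)
Lemma weight_upper (phi : I -> plane R -> R) (K : R) :
  (forall t, mfun (phi t)) -> (forall t p, `|phi t p| <= K) -> forall eps : R, 0 < eps ->
  exists2 eta : R, 0 < eta & \forall n \near \oo, forall l, @near_weights n W eta l ->
  forall a : R, \sum_(y : cfg n | a <= \sum_t pairing y t (phi t)) cfg_weight l y <=
    expR (n%:R ^+ 2 * (- a + \sum_t \int[mu]_p logmgf (1 - W t p) (W t p) (phi t p) + eps)).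
Proof.
move=> mphi phiK eps e0.
(* Each time costs one error in the pairing and one in the log-moment generating function. The
   successor avoids a division by zero when the index type is empty. *)
pose e1 : R := eps / (2 * #|I|.+1%:R).
have e10 : 0 < e1 by apply: divr_gt0 => //; apply: mulr_gt0.
have e1E : 2 * (#|I|%:R * e1) <= eps.
  have h : (#|I|%:R : R) <= #|I|.+1%:R by rewrite ler_nat.
  have h0 : 0 < (#|I|.+1%:R : R) by rewrite ltr0n.
  rewrite /e1 [leLHS](_ : _ = #|I|%:R / #|I|.+1%:R * eps).
    by rewrite ger_pMl// ler_pdivrMr// mul1r.
  by field; rewrite gt_eqF.
have [eta eta0 etaP] := near_weights_approx_all mphi phiK e10.
exists eta => //; near=> n.
have n0 : (0 < n)%N by near: n; exact: nbhs_infty_gt.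
have n2 : (n%:R ^+ 2 : R) != 0 by rewrite expf_neq0// pnatr_eq0 -lt0n.
move=> l lW a.
have [b bP] : exists b, forall t, @step_data n l t (phi t) K e1 (b t).
  by move: l lW; near: n.
have l0 t i j x : 0 <= l t i j x by have [h _ _ _] := lW t; exact: h.
have l2 t i j : 2^-1 <= l t i j false + l t i j true by have [_ h _ _] := lW t; exact: h.
have iphi t : mu.-integrable setT (EFin \o phi t) by exact: bounded_integrable (mphi t) (phiK t).
pose a' := n%:R ^+ 2 * (a - #|I|%:R * e1).
apply: (@le_trans _ _ (\sum_(y : cfg n | a' <= \sum_(k : I * ('I_n * 'I_n))
    b k.1 k.2.1 k.2.2 * (y k)%:R) cfg_weight l y)).
  rewrite big_mkcond [leRHS]big_mkcond /=; apply: ler_sum => y _.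
  case: ifPn => [h|_]; last by case: ifP => // _; apply: prod_weight_ge0 => k x; exact: l0.
  rewrite ifT// /a'.
  have -> : \sum_(k : I * ('I_n * 'I_n)) b k.1 k.2.1 k.2.2 * (y k)%:R =
      \sum_t \sum_i \sum_j b t i j * (y (t, (i, j)))%:R.
    rewrite -(sum_cfg_index (fun t i j => b t i j * (y (t, (i, j)))%:R)).
    by apply: eq_bigr => -[t [i j]] _.
  rewrite -ler_pdivlMl ?exprn_gt0 ?ltr0n// mulr_sumr lerBlDr.
  apply: (le_trans h); rewrite -sumr_cst -big_split /=; apply: ler_sum => t _.
  have [_ d _ _] := bP t; have := pairing_step_le y t (iphi t) d.
  by rewrite ltr_norml => /andP[]; lra.
apply: (le_trans (chernoff _ _ _)); first by move=> k x; exact: l0.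
rewrite logmgf_sum_prod// -expRD ler_expR.
rewrite /a' -mulrN [X in _ + X](_ : _ = n%:R ^+ 2 * \sum_t (n%:R^-2 *
  \sum_i \sum_j logmgf (l t i j false) (l t i j true) (b t i j))); last first.
  by rewrite -mulr_sumr mulrA divff// mul1r.
rewrite -mulrDr ler_wpM2l ?sqr_ge0//.
have : \sum_t n%:R^-2 * (\sum_i \sum_j logmgf (l t i j false) (l t i j true) (b t i j)) <=
    \sum_t (\int[mu]_p logmgf (1 - W t p) (W t p) (phi t p)) + #|I|%:R * e1.
  rewrite -sumr_cst -big_split /=; apply: ler_sum => t _.
  have [_ _ d _] := bP t.
  have := Rintegral_step_le (bounded_integral_logmgf t (mphi t) (phiK t)) d.
  by rewrite ltr_norml => /andP[]; lra.
by move: e1E; lra.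
Unshelve. all: by end_near. Qed.

End Weights.

(** * Concentration of nearby weights around their limit *)

Section Concentration.
Context {R : realType} (I : finType).
Local Notation mu := (@leb_sq R).
Local Notation mfun f := (measurable_fun [set: plane R] (f : plane R -> R)).
Variable W : I -> plane R -> R.
Hypothesis mW : forall t, mfun (W t).
Hypothesis W01 : forall t p, 0 < W t p < 1.

Lemma integrable_W_mul t phi K : mfun phi -> (forall p, `|phi p| <= K) ->
  mu.-integrable setT (EFin \o (fun p => W t p * phi p)).
Proof.
move=> mphi phiK; apply: integrable_mul01 => //; last exact: bounded_integrable phiK.
by apply: aeW => p; have /andP[w0 w1] := W01 t p; rewrite !ltW.
Qed.

Lemma Rintegral_leb_sq_cst (c : R) : \int[mu]_p c = c.
Proof.
rewrite /Rintegral (_ : (fun=> c%:E) = cst c%:E)// integral_cst// leb_sq_setT mule1//.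
Qed.

Lemma pairingZ n (y : cfg I n) t c phi K : mfun phi -> (forall p, `|phi p| <= K) ->
  pairing y t (fun p => c * phi p) = c * pairing y t phi.
Proof.
move=> mphi phiK; rewrite /pairing -RintegralZl//.
  by apply: eq_Rintegral => p _; rewrite mulrCA.
apply: integrable_mul01; [exact: measurable_cfg_step| |exact: bounded_integrable phiK].
by apply: aeW => p; exact: cfg_step01.
Qed.

Lemma pairing0 n (y : cfg I n) t : pairing y t (fun=> 0 : R) = 0.
Proof. by rewrite /pairing; under eq_Rintegral do rewrite mulr0; rewrite Rintegral_leb_sq_cst. Qed.

(* Chernoff's bound with a small parameter [th]: the exponent
   [- th * d + 2 * (th * K) ^+ 2] is negative. *)
Lemma weight_upper_tail t phi (K d : R) : 0 < K -> 0 < d ->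
  mfun phi -> (forall p, `|phi p| <= K) ->
  exists2 kap : R, 0 < kap & exists2 eta : R, 0 < eta & \forall n \near \oo,
  forall l, @near_weights R I n W eta l ->
  \sum_(y : cfg I n | \int[mu]_p (W t p * phi p) + d <= pairing y t phi) cfg_weight l y
    <= expR (- (n%:R ^+ 2 * kap)).
Proof.
move=> K0 d0 mphi phiK.
(* The first bound gives |th phi| <= 1/2, the range of [logmgf_le]; the second keeps the quadratic
   term below half of the gain th d. A further quarter pays for the error in [weight_upper], and the
   last quarter is the rate [kap]. *)
pose th : R := Num.min (2 * K)^-1 (d / (4 * K ^+ 2)).
have th0 : 0 < th.
  by rewrite /th lt_min invr_gt0 mulr_gt0//= divr_gt0// mulr_gt0// exprn_gt0.
have th1 : th * K <= 2^-1.
  have : th <= (2 * K)^-1 by rewrite /th ge_min lexx.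
  by rewrite -(ler_pM2r K0) => /le_trans; apply; rewrite invfM mulfVK// gt_eqF.
have th2 : 2 * (th * K) ^+ 2 <= th * d / 2.
  have : th <= d / (4 * K ^+ 2) by rewrite /th ge_min lexx orbT.
  rewrite ler_pdivlMr ?mulr_gt0 ?exprn_gt0// => h.
  by rewrite exprMn expr2 !expr2 in h *; nra.
exists (th * d / 4); first by rewrite divr_gt0 ?mulr_gt0.
(* Testing the other times by zero removes them: the pairing vanishes, and so does the limiting
   log-moment generating function because W and 1 - W sum to one. *)
pose phi' s : plane R -> R := if s == t then (fun p => th * phi p) else (fun=> 0).
have mphi' s : mfun (phi' s).
  by rewrite /phi'; case: ifP => _; [exact: measurable_funM|exact: measurable_cst].
have phi'K s p : `|phi' s p| <= 2^-1.
  rewrite /phi'; case: ifP => _; last by rewrite normr0 invr_ge0.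
  by rewrite normrM (gtr0_norm th0) (le_trans _ th1)// ler_pM2l.
have e0 : 0 < th * d / 4 by rewrite divr_gt0 ?mulr_gt0.
have [eta eta0 etaP] := weight_upper mW W01 mphi' phi'K e0.
exists eta => //; apply: filterS etaP => n H l lW.
have E (y : cfg I n) : \sum_s pairing y s (phi' s) = th * pairing y t phi.
  rewrite (bigD1 t)//= big1 ?addr0 => [|s /negbTE st].
    by rewrite /phi' eqxx (pairingZ _ _ _ mphi phiK).
  by rewrite /phi' st pairing0.
have EL : \sum_s \int[mu]_p logmgf (1 - W s p) (W s p) (phi' s p) <=
    th * \int[mu]_p (W t p * phi p) + 2 * (th * K) ^+ 2.
  rewrite (bigD1 t)//= [X in _ + X]big1 ?addr0 => [|s /negbTE st]; last first.
    rewrite -[RHS](Rintegral_leb_sq_cst 0); apply: eq_Rintegral => p _.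
    by rewrite /phi' st /logmgf expR0 mulr1 subrK ln1.
  have iW := integrable_W_mul t mphi phiK.
  have iZ : mu.-integrable setT (EFin \o (fun p => th * (W t p * phi p))).
    by apply: eq_integrable (integrableZl measurableT th iW) => // p _; rewrite /= EFinM.
  rewrite -[X in _ + X]Rintegral_leb_sq_cst -RintegralZl// -RintegralD//; last exact: integrable_cst.
  apply: le_Rintegral => //.
  - exact: bounded_integral_logmgf.
  - by apply: eq_integrable (integrableD measurableT iZ (integrable_cst (2 * (th * K) ^+ 2))) => // p _; rewrite /= EFinD.
  move=> p _; have /andP[w0 w1] := W01 t p.
  rewrite mulrCA; have -> : phi' t p = th * phi p by rewrite /phi' eqxx.
  apply: logmgf_le; first by rewrite !ltW.
    by have := phi'K t p; rewrite /phi' eqxx.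
  by rewrite normrM (gtr0_norm th0) ler_pM2l.
have := H l lW (th * (\int[mu]_p (W t p * phi p) + d)).
under eq_bigl do rewrite E ler_pM2l//.
move=> /le_trans; apply; rewrite ler_expR -[X in _ <= X]mulrN ler_wpM2l ?sqr_ge0//.
by move: EL th2; rewrite mulrDr; lra.
Qed.

Lemma weight_concentration t phi (K d : R) : 0 < K -> 0 < d ->
  mfun phi -> (forall p, `|phi p| <= K) ->
  exists2 kap : R, 0 < kap & exists2 eta : R, 0 < eta & \forall n \near \oo,
  forall l, @near_weights R I n W eta l ->
  \sum_(y : cfg I n | d <= `|pairing y t phi - \int[mu]_p (W t p * phi p)|) cfg_weight l y
    <= 2 * expR (- (n%:R ^+ 2 * kap)).
Proof.
move=> K0 d0 mphi phiK.
have mphiN : mfun (fun p => -1 * phi p) by exact: measurable_funM.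
have phiNK p : `|-1 * phi p| <= K by rewrite mulN1r normrN.
have [k1 k10 [e1 e10 H1]] := weight_upper_tail t K0 d0 mphi phiK.
have [k2 k20 [e2 e20 H2]] := weight_upper_tail t K0 d0 mphiN phiNK.
exists (Num.min k1 k2); first by rewrite lt_min k10.
exists (Num.min e1 e2); first by rewrite lt_min e10.
apply: filterS2 H1 H2 => n H1 H2 l lW.
have l0 k x : 0 <= l k.1 k.2.1 k.2.2 x by have [h _ _ _] := lW k.1; exact: h.
apply: (@le_trans _ _ (expR (- (n%:R ^+ 2 * k1)) + expR (- (n%:R ^+ 2 * k2)))); last first.
  rewrite mulrDl !mul1r; apply: lerD; rewrite ler_expR lerN2 ler_wpM2l ?sqr_ge0// ge_min lexx ?orbT//.
apply: le_trans (lerD (H1 l _) (H2 l _)); last 2 first.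
- by apply: near_weights_le lW; rewrite ge_min lexx.
- by apply: near_weights_le lW; rewrite ge_min lexx orbT.
rewrite big_mkcond [X in _ <= X + _]big_mkcond [X in _ <= _ + X]big_mkcond -big_split /=.
apply: ler_sum => y _; have w0 := prod_weight_ge0 y l0.
have -> : \int[mu]_p (W t p * (-1 * phi p)) = - \int[mu]_p (W t p * phi p).
  rewrite -[RHS]mulN1r -RintegralZl//; last exact: integrable_W_mul phiK.
  by apply: eq_Rintegral => p _; rewrite mulrCA.
rewrite (pairingZ _ _ _ mphi phiK) mulN1r.
case: ifPn => [|_]; last by case: ifP => _; case: ifP => _; rewrite ?addr0 ?add0r ?addr_ge0.
rewrite ler_normr => /orP[h|h].
  by rewrite ifT ?lerDl; [case: ifP|lra].
by rewrite [X in _ <= _ + X]ifT ?lerDr; [case: ifP|lra].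
Qed.

Lemma expR_sqr_lt (kap e : R) : 0 < kap -> 0 < e ->
  \forall n \near \oo, expR (- (n%:R ^+ 2 * kap)) < e.
Proof.
move=> k0 e0; near=> n.
have n0 : (0 < n)%N by near: n; exact: nbhs_infty_gt.
have ne : (kap * e)^-1 < n%:R by near: n; exact: nbhs_infty_gtr.
rewrite expRN invf_plt ?posrE ?expR_gt0//.
apply: (@lt_le_trans _ _ (1 + n%:R ^+ 2 * kap)); last exact: expR_ge1Dx.
have : e^-1 < n%:R * kap by rewrite -ltr_pdivrMr// -invfM mulrC.
move=> /lt_le_trans; apply; have : (1 : R) <= n%:R by rewrite ler1n.
move=> h; rewrite expr2 -mulrA (le_trans (ler_peMl _ h)) ?lerDr//.
by rewrite mulr_ge0// ltW.
Unshelve. all: by end_near. Qed.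

Lemma weight_concentration_all (J : finType) (tt : J -> I) (phi : J -> plane R -> R)
    (K d : R) : 0 < d -> (forall j, mfun (phi j)) -> (forall j p, `|phi j p| <= K) ->
  exists2 eta : R, 0 < eta & \forall n \near \oo, forall l, @near_weights R I n W eta l ->
  \sum_(y : cfg I n | ~~ [forall j, `|pairing y (tt j) (phi j) -
     \int[mu]_p (W (tt j) p * phi j p)| < d]) cfg_weight l y <= 2^-1.
Proof.
move=> d0 mphi phiK.
(* [weight_concentration] wants a positive bound, whereas K may be zero, and is arbitrary when J is
   empty. *)
pose K1 : R := `|K| + 1; have K10 : 0 < K1 by rewrite /K1 ltr_wpDl.
have phiK1 j p : `|phi j p| <= K1.
  by rewrite (le_trans (phiK j p))// /K1 (le_trans (ler_norm _))// lerDl.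
pose Q j n (l : I -> 'I_n -> 'I_n -> bool -> R) :=
  \sum_(y : cfg I n | d <= `|pairing y (tt j) (phi j) - \int[mu]_p (W (tt j) p * phi j p)|)
    cfg_weight l y <= (2 * #|J|.+1%:R)^-1.
have [|eta eta0 HQ] := @near_weights_forall R I J W Q.
  move=> j; have [k k0 [eta eta0 H]] := weight_concentration (tt j) K10 d0 (mphi j) (phiK1 j).
  exists eta => //.
  have e0 : 0 < (4 * #|J|.+1%:R)^-1 :> R by rewrite invr_gt0 mulr_gt0.
  apply: filterS2 H (expR_sqr_lt k0 e0) => n H h l lW; apply: (le_trans (H l lW)).
  rewrite (_ : (2 * _)^-1 = 2 * (4 * #|J|.+1%:R)^-1); first by rewrite ler_pM2l// ltW.
  by field.
exists eta => //; apply: filterS HQ => n HQ l lW.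
have l0 k x : 0 <= l k.1 k.2.1 k.2.2 x by have [h _ _ _] := lW k.1; exact: h.
apply: (@le_trans _ _ (\sum_j (2 * #|J|.+1%:R)^-1)); last first.
  rewrite sumr_cst invfM mulrCA ler_piMr ?invr_ge0//.
  by rewrite ler_pdivrMr ?ltr0n// mul1r ler_nat.
apply: le_trans (ler_sum _ (fun j _ => HQ l lW j)).
under [leRHS]eq_bigr do rewrite big_mkcond.
rewrite exchange_big /= big_mkcond; apply: ler_sum => y _.
have w0 := prod_weight_ge0 y l0.
case: ifPn => [/forallPn[j]|_]; last by apply: sumr_ge0 => j _; case: ifP.
by rewrite -leNgt => h; rewrite (bigD1 j)//= h lerDl; apply: sumr_ge0 => i _; case: ifP.
Qed.

End Concentration.

(** * Change of weights and the lower bound *)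

Section LowerBound.
Context {R : realType} (I : finType).
Local Notation mu := (@leb_sq R).
Local Notation mfun f := (measurable_fun [set: plane R] (f : plane R -> R)).
Variable W : I -> plane R -> R.
Hypothesis mW : forall t, mfun (W t).
Hypothesis W01 : forall t p, 0 < W t p < 1.
Variables (g : I -> plane R -> R) (K : R).
Hypothesis mg : forall t, mfun (g t).
Hypothesis gK : forall t p, `|g t p| <= K.

Let V t p := tilt (1 - W t p) (W t p) (g t p).

Let mV t : mfun (V t). Proof. exact: measurable_tilt. Qed.

Let V01 t p : 0 < V t p < 1. Proof. exact: tilt01. Qed.

Section Tilted.
Variables (n : nat) (l : I -> 'I_n -> 'I_n -> bool -> R) (b : I -> 'I_n -> 'I_n -> R).
Hypothesis n_gt0 : (0 < n)%N.
Hypothesis l0 : forall t i j x, 0 <= l t i j x.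
Hypothesis l2 : forall t i j, 2^-1 <= l t i j false + l t i j true.

(** The second mass is defined as 1 - v, so these weights are exactly normalised although [l] is
    not; the complement of an unlikely event then has mass at least 1/2. *)
Definition tilted_weights t (i j : 'I_n) (x : bool) : R :=
  let v := tilt (l t i j false) (l t i j true) (b t i j) in if x then v else 1 - v.

Let D_gt0 t i j : 0 < l t i j false + l t i j true * expR (b t i j).
Proof.
have := mgf_ge (lexx `|b t i j|) (l0 t i j false) (l0 t i j true) (l2 t i j) (lexx _).
apply: lt_le_trans.
by rewrite divr_gt0 ?expR_gt0.
Qed.

Lemma tilted_weights_ge0 t i j x : 0 <= tilted_weights t i j x.
Proof.
rewrite /tilted_weights; case: x.
  by rewrite /tilt divr_ge0 ?addr_ge0 ?mulr_ge0 ?expR_ge0.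
by rewrite tilt_compl ?gt_eqF// divr_ge0// ltW.
Qed.

Lemma tilted_weightsE t i j x : l t i j x = tilted_weights t i j x *
  expR (logmgf (l t i j false) (l t i j true) (b t i j) - b t i j * x%:R).
Proof.
have D0 := D_gt0 t i j; rewrite /logmgf expRB lnK ?posrE// /tilted_weights.
have eb : expR (b t i j) != 0 by rewrite gt_eqF ?expR_gt0.
case: x; rewrite ?mulr1 ?mulr0 ?expR0.
  by rewrite /tilt [_ * expR _ + _]addrC; field; rewrite eb gt_eqF.
by rewrite tilt_compl ?gt_eqF// divr1 mulfVK// gt_eqF.
Qed.

Lemma near_tilted_weights eta :
  (forall t, (distL1 (step (fun i j => tilt (l t i j false) (l t i j true) (b t i j)))
       (V t) < eta%:E)%E) -> @near_weights R I n V eta tilted_weights.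
Proof.
move=> d t; split => //.
- by move=> i j x; exact: tilted_weights_ge0.
- by move=> i j; rewrite /tilted_weights subrK; lra.
- exact: d.
rewrite /distL1 (ae_eq_integral (fun p => `|step (fun i j => tilt (l t i j false) (l t i j true) (b t i j)) p - V t p|%:E)) //.
- exact: d.
- by apply: measurable_dist; [exact: measurable_step_real|exact: measurable_funB].
- by apply: measurable_dist => //; exact: measurable_step_real.
apply: filterS ae_unit_sq => p /(unit_sq_cell n_gt0)[i [j pij]] _.
rewrite !(step_cell _ pij) /tilted_weights; congr (_%:E).
by rewrite -[RHS]normrN; congr (`|_|); ring.
Qed.

Lemma cfg_weight_tilted (y : cfg I n) : cfg_weight l y = cfg_weight tilted_weights y *
  expR (\sum_t \sum_i \sum_j logmgf (l t i j false) (l t i j true) (b t i j) -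
        \sum_t \sum_i \sum_j b t i j * (y (t, (i, j)))%:R).
Proof.
rewrite -!sumrB; under eq_bigr => t _ do rewrite -sumrB.
under eq_bigr => t _ do under eq_bigr => i _ do rewrite -sumrB.
rewrite -(sum_cfg_index (fun t i j => logmgf (l t i j false) (l t i j true) (b t i j) -
  b t i j * (y (t, (i, j)))%:R)) expR_sum /cfg_weight /prod_weight -big_split /=.
by apply: eq_bigr => -[t [i j]] _ /=; exact: tilted_weightsE.
Qed.

Lemma sum_tilted_weights : \sum_(y : cfg I n) cfg_weight tilted_weights y = 1.
Proof.
rewrite /cfg_weight /prod_weight.
rewrite -(bigA_distr_bigA (fun (k : I * ('I_n * 'I_n)) x => tilted_weights k.1 k.2.1 k.2.2 x)) /=.
by rewrite big1// => k _; rewrite big_bool /= /tilted_weights addrC subrK.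
Qed.

End Tilted.

(** On the event that the pairings are close to their tilted means, the density between [l] and its
    tilt is at least exp(-n^2 (E + eps/2)). That event has tilted mass at least 1/2, and the factor
    1/2 is absorbed by the remaining eps/2. *)
Lemma weight_lower (J : finType) (tt : J -> I) (phi : J -> plane R -> R) (K' d eps : R) :
  0 < d -> 0 < eps -> (forall j, mfun (phi j)) -> (forall j p, `|phi j p| <= K') ->
  exists2 eta : R, 0 < eta & \forall n \near \oo, forall l, @near_weights R I n W eta l ->
  expR (- (n%:R ^+ 2 * (\sum_t (\int[mu]_p (V t p * g t p) -
      \int[mu]_p logmgf (1 - W t p) (W t p) (g t p)) + eps))) <=
  \sum_(y : cfg I n | [forall j, `|pairing y (tt j) (phi j) -
     \int[mu]_p (V (tt j) p * phi j p)| < d]) cfg_weight l y.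
Proof.
move=> d0 eps0 mphi phiK'.
(* Three errors per time, which together may use half of [eps]: the step approximations of g and of
   its log-moment generating function, and the concentration of the pairing with g. *)
pose e1 : R := eps / (6 * #|I|.+1%:R).
have e10 : 0 < e1 by apply: divr_gt0 => //; apply: mulr_gt0.
have e1E : 3 * (#|I|%:R * e1) <= eps / 2.
  have h : (#|I|%:R : R) <= #|I|.+1%:R by rewrite ler_nat.
  have h0 : 0 < (#|I|.+1%:R : R) by rewrite ltr0n.
  rewrite /e1 [leLHS](_ : _ = #|I|%:R / #|I|.+1%:R * (eps / 2)).
    by rewrite ger_pMl ?divr_gt0// ler_pdivrMr// mul1r.
  by field; rewrite gt_eqF.
pose d' : R := Num.min d e1; have d'0 : 0 < d' by rewrite lt_min d0.
(* The tilting functions g are added to the tests: concentration of their pairings is what controls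
   the exponent of the density. *)
pose tt' (s : J + I) := match s with inl j => tt j | inr t => t end.
pose phi' (s : J + I) := match s with inl j => phi j | inr t => g t end.
have mphi' s : mfun (phi' s) by case: s.
have phi'K s p : `|phi' s p| <= Num.max K' K.
  by case: s => s; rewrite le_max ?phiK' ?gK ?orbT.
have [eta1 eta10 H1] := weight_concentration_all mV V01 tt' d'0 mphi' phi'K.
pose e2 : R := Num.min e1 eta1; have e20 : 0 < e2 by rewrite lt_min e10.
have [eta eta0 H2] := near_weights_approx_all mW W01 mg gK e20.
exists eta => //; near=> n.
have n0 : (0 < n)%N by near: n; exact: nbhs_infty_gt.
have H1n : forall l, @near_weights R I n V eta1 l -> \sum_(y : cfg I n | ~~ [forall s,
    `|pairing y (tt' s) (phi' s) - \int[mu]_p (V (tt' s) p * phi' s p)| < d'])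
    cfg_weight l y <= 2^-1 by near: n.
have n2 : (n%:R ^+ 2 : R) != 0 by rewrite expf_neq0// pnatr_eq0 -lt0n.
move=> l lW.
have l0 t i j x : 0 <= l t i j x by have [h _ _ _] := lW t; exact: h.
have l2 t i j : 2^-1 <= l t i j false + l t i j true by have [_ h _ _] := lW t; exact: h.
have [b bP] : exists b, forall t, @step_data R I W n l t (g t) K e2 (b t).
  by move: l lW {l0 l2}; near: n.
have e2e1 : e2 <= e1 by rewrite /e2 ge_min lexx.
have nV : @near_weights R I n V eta1 (tilted_weights l b).
  apply: near_tilted_weights => // t; have [_ _ _ h] := bP t.
  by apply: (lt_le_trans h); rewrite lee_fin /e2 ge_min lexx orbT.
pose good (y : cfg I n) := [forall s, `|pairing y (tt' s) (phi' s) -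
     \int[mu]_p (V (tt' s) p * phi' s p)| < d'].
have gd : 2^-1 <= \sum_(y | good y) cfg_weight (tilted_weights l b) y.
  have hb : \sum_(y | ~~ good y) cfg_weight (tilted_weights l b) y <= 2^-1.
    exact: H1n.
  have := @sum_tilted_weights n l b; rewrite (bigID good)/=.
  by move: hb; lra.
set E := \sum_t _.
have key (y : cfg I n) : good y -> expR (- (n%:R ^+ 2 * (E + eps / 2))) <=
    expR (\sum_t \sum_i \sum_j logmgf (l t i j false) (l t i j true) (b t i j) -
        \sum_t \sum_i \sum_j b t i j * (y (t, (i, j)))%:R).
  move=> /forallP gy; rewrite ler_expR.
  rewrite [leRHS](_ : _ = n%:R ^+ 2 * \sum_t (n%:R^-2 * \sum_i \sum_j logmgf (l t i j false) (l t i j true) (b t i j)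
    - n%:R^-2 * \sum_i \sum_j b t i j * (y (t, (i, j)))%:R)); last first.
    by rewrite sumrB -!mulr_sumr -mulrBr mulrA divff// mul1r.
  rewrite -mulrN ler_wpM2l ?sqr_ge0//.
  apply: (@le_trans _ _ (- E - 3 * (#|I|%:R * e1))); first by move: e1E; lra.
  rewrite mulrCA -sumr_cst /E -sumrN -sumrB; apply: ler_sum => t _.
  have [_ b1 b2 _] := bP t.
  have := pairing_step_le y t (bounded_integrable (mg t) (gK t)) b1.
  have := Rintegral_step_le (bounded_integral_logmgf mW W01 t (mg t) (gK t)) b2.
  have := gy (inr t); rewrite /= lt_min => /andP[_].
  rewrite !ltr_norml => /andP[_ +] /andP[+ _] /andP[_ +].
  by lra.
apply: (@le_trans _ _ (\sum_(y | good y) cfg_weight l y)); last first.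
  rewrite big_mkcond [leRHS]big_mkcond /=; apply: ler_sum => y _.
  have w0 : 0 <= cfg_weight l y by apply: prod_weight_ge0 => k x; exact: l0.
  case: ifPn => [/forallP gy|_]; last by case: ifP.
  rewrite ifT//; apply/forallP => j; have := gy (inl j).
  by rewrite /= lt_min => /andP[].
apply: (@le_trans _ _ (2^-1 * expR (- (n%:R ^+ 2 * (E + eps / 2))))).
  have h : expR (- (n%:R ^+ 2 * (eps / 2))) <= 2^-1.
    by apply/ltW; near: n; apply: expR_sqr_lt => //; rewrite divr_gt0.
  rewrite (_ : E + eps = eps / 2 + (E + eps / 2)); last by field.
  by rewrite mulrDr opprD expRD ler_wpM2r ?expR_ge0.
apply: (@le_trans _ _ (\sum_(y | good y) (cfg_weight (tilted_weights l b) y *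
    expR (- (n%:R ^+ 2 * (E + eps / 2)))))).
  by rewrite -mulr_suml ler_wpM2r ?expR_ge0.
apply: ler_sum => y gy; rewrite (cfg_weight_tilted b l0 l2 y) ler_wpM2l ?key//.
by apply: prod_weight_ge0 => k x; exact: tilted_weights_ge0.
Unshelve. all: by end_near. Qed.

End LowerBound.

(** * The rate function *)

Lemma cvgr_EFin (R : realType) (T : Type) (F : set_system T) (u : T -> R) (l : R) :
  Filter F -> u x @[x --> F] --> l -> (u x)%:E @[x --> F] --> l%:E.
Proof. by move=> FF ul; apply: cvg_comp ul _; exact: cvg_id. Qed.

Section Rate.
Context {R : realType} (I : finType).
Local Notation mu := (@leb_sq R).
Local Notation mfun f := (measurable_fun [set: plane R] (f : plane R -> R)).
Variable W : I -> plane R -> R.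
Hypothesis mW : forall t, mfun (W t).
Hypothesis W01 : forall t p, 0 < W t p < 1.

Definition rate (f : {ptws I -> @S0 R}) : \bar R :=
  (\sum_t \int[mu]_p (Q2 ((val (f t) : L2) p) (W t p))%:E)%E.

Definition dual_rate (f : {ptws I -> @S0 R}) (g : I -> plane R -> R) : R :=
  \sum_t (\int[mu]_p ((val (f t) : L2) p * g t p) -
          \int[mu]_p logmgf (1 - W t p) (W t p) (g t p)).

Lemma measurable_Q2 (u v : plane R -> R) : mfun u -> mfun v ->
  mfun (fun p => Q2 (u p) (v p)).
Proof.
move=> mu_ mv; have m1 (w : plane R -> R) : mfun w -> mfun (fun p => 1 - w p).
  by move=> ?; exact: measurable_funB.
have mln (w : plane R -> R) : mfun w -> mfun (fun p => ln (w p)).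
  by move=> mw; apply: measurableT_comp => //; exact: measurable_ln.
rewrite /Q2; apply: measurable_funD; apply: measurable_funM => //.
- by apply: mln; apply: measurable_funM => //; exact: measurable_funV.
- exact: m1.
- by apply: mln; apply: measurable_funM; [|apply: measurable_funV]; exact: m1.
Qed.

(** Representatives of elements of [S0] lie in [0, 1] only almost everywhere. Clamping yields a
    version to which the scalar inequalities apply at every point. *)
Definition unit_clamp (x : R) := Num.max 0 (Num.min 1 x).

Lemma unit_clamp01 x : 0 <= unit_clamp x <= 1.
Proof. by rewrite /unit_clamp le_max lexx /= ge_max ler01 ge_min lexx. Qed.

Lemma unit_clamp_id x : 0 <= x <= 1 -> unit_clamp x = x.
Proof. by move=> /andP[x0 x1]; rewrite /unit_clamp min_r// max_r. Qed.

Lemma measurable_unit_clamp (u : plane R -> R) : mfun u -> mfun (fun p => unit_clamp (u p)).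
Proof.
move=> mu_; apply: measurable_maxr; first exact: measurable_cst.
by apply: measurable_minr => //; exact: measurable_cst.
Qed.

Lemma unit_clamp_ae (h : @S0 R) : {ae mu, forall p, unit_clamp ((val h : L2) p) = (val h : L2) p}.
Proof. by apply: filterS (set_mem (valP h)) => p; exact: unit_clamp_id. Qed.

Section Point.
Variable f : {ptws I -> @S0 R}.
Let u t p := unit_clamp ((val (f t) : L2) p).
Let u01 t p : 0 <= u t p <= 1. Proof. exact: unit_clamp01. Qed.
Let mu_ t : mfun (u t).
Proof. by apply: measurable_unit_clamp; exact: L2_measurable. Qed.

Lemma rate_clampE : rate f = (\int[mu]_p (\sum_t Q2 (u t p) (W t p))%:E)%E.
Proof.
rewrite /rate; under [RHS]eq_integral do rewrite -sumEFin.
rewrite ge0_integral_sum//; last 2 first.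
- by move=> t; apply/measurable_EFinP; exact: measurable_Q2.
- by move=> t p _; rewrite lee_fin Q2_ge0.
apply: eq_bigr => t _; apply: ae_eq_integral => //.
- by apply/measurable_EFinP; apply: measurable_Q2 => //; exact: L2_measurable.
- by apply/measurable_EFinP; exact: measurable_Q2.
by apply: filterS (unit_clamp_ae (f t)) => p H _; rewrite /u H.
Qed.

Lemma rate_ge0 : (0 <= rate f)%E.
Proof.
rewrite rate_clampE; apply: integral_ge0 => p _.
by rewrite lee_fin sumr_ge0// => t _; rewrite Q2_ge0.
Qed.

Lemma measurable_dual_integrand (g : I -> plane R -> R) : (forall t, mfun (g t)) ->
  mfun (fun p => \sum_t (u t p * g t p - logmgf (1 - W t p) (W t p) (g t p))).
Proof.
move=> mg; apply: measurable_sum => t; apply: measurable_funB.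
  exact: measurable_funM.
by apply: measurable_logmgf => //; exact: measurable_funB.
Qed.

Lemma dual_rateE (g : I -> plane R -> R) (K : R) :
  (forall t, mfun (g t)) -> (forall t p, `|g t p| <= K) ->
  ((dual_rate f g)%:E = \int[mu]_p (\sum_t (u t p * g t p -
     logmgf (1 - W t p) (W t p) (g t p)))%:E)%E.
Proof.
move=> mg gK; under [RHS]eq_integral do rewrite -sumEFin.
have iL t := bounded_integral_logmgf mW W01 t (mg t) (gK t).
have ig t := bounded_integrable (mg t) (gK t).
have ifg t := S0_integrable (f t) (ig t).
have iug t : mu.-integrable setT (EFin \o (fun p => u t p * g t p)).
  by apply: integrable_mul01 => //; apply: aeW => p; exact: u01.
rewrite integral_sum//; last first.
  by move=> t; apply: eq_integrable (integrableB measurableT (iug t) (iL t)) => // p _; rewrite /= EFinB.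
rewrite /dual_rate -sumEFin; apply: eq_bigr => t _.
under eq_integral do rewrite EFinB.
rewrite integralB_EFin//; last exact: iL.
have -> : (\int[mu]_p (u t p * g t p)%:E = (\int[mu]_p ((val (f t) : L2) p * g t p))%:E)%E.
  rewrite /Rintegral fineK; last exact: integrable_fin_num.
  apply: ae_eq_integral => //.
  - by case/integrableP : (iug t).
  - by case/integrableP : (ifg t).
  by apply: filterS (unit_clamp_ae (f t)) => p H _; rewrite /u H.
by rewrite EFinB /Rintegral [X in (_ - X)%E]fineK//; exact: integrable_fin_num.
Qed.

Lemma dual_rate_le (g : I -> plane R -> R) (K : R) :
  (forall t, mfun (g t)) -> (forall t p, `|g t p| <= K) -> ((dual_rate f g)%:E <= rate f)%E.
Proof.
move=> mg gK; rewrite (dual_rateE mg gK) rate_clampE.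
have mQ : measurable_fun setT (fun p => (\sum_t Q2 (u t p) (W t p))%:E).
  by apply/measurable_EFinP; apply: measurable_sum => t; exact: measurable_Q2.
have Q0 p : (0 <= (\sum_t Q2 (u t p) (W t p))%:E)%E.
  by rewrite lee_fin sumr_ge0// => t _; rewrite Q2_ge0.
have [fin|] := boolP ((\int[mu]_p (\sum_t Q2 (u t p) (W t p))%:E < +oo)%E); last first.
  by rewrite -leNgt => /(le_trans _); apply; rewrite leey.
apply: le_integral => //.
- have iL t := bounded_integral_logmgf mW W01 t (mg t) (gK t).
  have ig t := bounded_integrable (mg t) (gK t).
  have iug t : mu.-integrable setT (EFin \o (fun p => u t p * g t p)).
    by apply: integrable_mul01 => //; apply: aeW => p; exact: u01.
  have iS := @integrable_sum _ _ _ mu setT measurableT _ (index_enum I) xpredT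
    (fun t p => (u t p * g t p - logmgf (1 - W t p) (W t p) (g t p))%:E).
  apply: eq_integrable (iS _) => // [p _|t _]; first by rewrite sumEFin.
  by apply: eq_integrable (integrableB measurableT (iug t) (iL t)) => // p _; rewrite /= EFinB.
- by apply/integrableP; split => //; under eq_integral do rewrite gee0_abs//.
by move=> p _; rewrite lee_fin; apply: ler_sum => t _; exact: young.
Qed.

Definition opt_dual (n : nat) t p := trunc_logit n.+2%:R^-1 (u t p) (W t p).

Let eps01 n : 0 < (n.+2%:R^-1 : R) < 1.
Proof. by rewrite invr_gt0 ltr0n /= invf_lt1 ?ltr0n// ltr1n. Qed.

Lemma opt_dual_bound n t p : `|opt_dual n t p| <= - ln (n.+2%:R^-1).
Proof. exact: trunc_logit_bound. Qed.

Lemma measurable_opt_dual n t : mfun (opt_dual n t).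
Proof.
have e0 : 0 < (n.+2%:R^-1 : R) by rewrite invr_gt0.
pose A p := u t p * (1 - W t p); pose B p := (1 - u t p) * W t p.
have mA : mfun A by apply: measurable_funM => //; exact: measurable_funB.
have mB : mfun B by apply: measurable_funM => //; exact: measurable_funB.
rewrite (_ : opt_dual n t = fun p => ln (A p + n.+2%:R^-1 * B p) - ln (B p + n.+2%:R^-1 * A p)).
  apply: measurable_funB; (apply: measurableT_comp; first exact: measurable_ln);
    by apply: measurable_funD => //; exact: measurable_funM.
apply/funext => p; rewrite /opt_dual /trunc_logit ln_div// posrE.
  exact: trunc_logit_num_gt0.
exact: trunc_logit_den_gt0.
Qed.

(** Fatou's lemma, the dual integrands converging pointwise to Q2. It also covers an infinite rate,
    where dominated convergence would fail. With [dual_rate_le], the rate is the supremum of the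
    dual values. *)
Lemma rate_le_limn_einf : (rate f <= limn_einf (fun n => (dual_rate f (opt_dual n))%:E))%E.
Proof.
rewrite rate_clampE.
pose F n p := (\sum_t (u t p * opt_dual n t p - logmgf (1 - W t p) (W t p) (opt_dual n t p)))%:E.
have mF n : measurable_fun setT (F n).
  by apply/measurable_EFinP; apply: measurable_dual_integrand => t; exact: measurable_opt_dual.
(* The integrand decreases when u is replaced by the tilted parameter, and it then equals the
   entropy of that parameter relative to W. *)
have F0 n p : (0 <= F n p)%E.
  rewrite lee_fin; apply: sumr_ge0 => t _.
  apply: le_trans (tilt_trunc_logit_entropy (u01 t p) (W01 t p) (eps01 n)).
  have /andP[t0 t1] := tilt01 (opt_dual n t p) (W01 t p).
  rewrite ug_logmgfE//; last by rewrite !ltW.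
  by rewrite Q2xx ?t0// subr0 Q2_ge0// !ltW.
have := @fatou _ _ _ mu setT measurableT F mF (fun n p _ => F0 n p).
under [X in _ -> (_ <= limn_einf X)%E]eq_fun => n.
  rewrite (dual_rateE (measurable_opt_dual n) (opt_dual_bound n)); over.
apply: le_trans; rewrite le_eqVlt; apply/orP; left; apply/eqP.
apply: eq_integral => p _.
suff H : F n p @[n --> \oo] --> (\sum_t Q2 (u t p) (W t p))%:E.
  by rewrite (cvg_limn_einf_sup H).1.
rewrite /F; apply: cvgr_EFin.
apply: cvg_big => [|t _]; first exact: add_continuous.
exact: cvg_trunc_logit.
Qed.

Lemma rate_gt_dual (a : R) : (a%:E < rate f)%E ->
  exists n, a < dual_rate f (opt_dual n).
Proof.
move=> ar; apply: contrapT => /forallNP H.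
have := lt_le_trans ar rate_le_limn_einf; apply/negP; rewrite -leNgt.
apply: le_trans (limn_einf_sup _) _; rewrite limn_esup_lim.
apply: lime_le; first exact: is_cvg_esups.
apply: nearW => n; apply: ub_ereal_sup => _ [k _ <-].
by rewrite lee_fin leNgt; apply/negP; exact: H.
Qed.

Definition opt_tilt n t p := tilt (1 - W t p) (W t p) (opt_dual n t p).

(** The left-hand side is the entropic cost of the tilt. The sign property of the truncated logit
    bounds it by the dual value at f, hence by the rate, for each n and not just in the limit. *)
Lemma opt_tilt_entropy n :
  ((\sum_t (\int[mu]_p (opt_tilt n t p * opt_dual n t p) -
      \int[mu]_p logmgf (1 - W t p) (W t p) (opt_dual n t p)))%:E <= rate f)%E.
Proof.
apply: le_trans (dual_rate_le (measurable_opt_dual n) (opt_dual_bound n)).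
rewrite lee_fin; apply: ler_sum => t _; rewrite lerD2r.
have mV : mfun (opt_tilt n t).
  by apply: measurable_tilt => //; exact: measurable_opt_dual.
have V01 p : 0 <= opt_tilt n t p <= 1.
  by have /andP[t0 t1] := tilt01 (opt_dual n t p) (W01 t p); rewrite !ltW.
have ig := bounded_integrable (measurable_opt_dual n t) (opt_dual_bound n t).
have e1 : \int[mu]_p ((val (f t) : L2) p * opt_dual n t p) = \int[mu]_p (u t p * opt_dual n t p).
  apply: ae_eq_Rintegral.
  - by apply: measurable_funM; [exact: L2_measurable|exact: measurable_opt_dual].
  - by apply: measurable_funM => //; exact: measurable_opt_dual.
  by apply: filterS (unit_clamp_ae (f t)) => p H; rewrite /u H.
rewrite e1; apply: le_Rintegral => //.
- by apply: integrable_mul01 => //; apply: aeW => p; exact: V01.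
- by apply: integrable_mul01 => //; apply: aeW => p; exact: u01.
by move=> p _; have := tilt_trunc_logit_entropy (u01 t p) (W01 t p) (eps01 n); rewrite lerD2r.
Qed.

Lemma cvg_opt_tilt t phi (K : R) : mfun phi -> (forall p, `|phi p| <= K) ->
  \int[mu]_p (opt_tilt n t p * phi p) @[n --> \oo] --> \int[mu]_p ((val (f t) : L2) p * phi p).
Proof.
move=> mphi phiK.
have mV n : mfun (opt_tilt n t).
  by apply: measurable_tilt => //; exact: measurable_opt_dual.
have V01 n p : 0 <= opt_tilt n t p <= 1.
  by have /andP[t0 t1] := tilt01 (opt_dual n t p) (W01 t p); rewrite !ltW.
have -> : \int[mu]_p ((val (f t) : L2) p * phi p) = \int[mu]_p (u t p * phi p).
  apply: ae_eq_Rintegral.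
  - by apply: measurable_funM => //; exact: L2_measurable.
  - exact: measurable_funM.
  by apply: filterS (unit_clamp_ae (f t)) => p H; rewrite /u H.
have [|||||_ _ H] := @dominated_convergence _ _ _ mu setT measurableT
  (fun n p => (opt_tilt n t p * phi p)%:E) (fun p => (u t p * phi p)%:E) (cst K%:E).
- by move=> n; apply/measurable_EFinP; exact: measurable_funM.
- by apply/measurable_EFinP; exact: measurable_funM.
- apply: aeW => p _; apply: cvgr_EFin.
  by apply: cvgM; [exact: cvg_tilt_trunc_logit|exact: cvg_cst].
- exact: integrable_cst.
- apply: aeW => p n _; rewrite lee_fin normrM -[leRHS]mul1r ler_pM//.
  by have /andP[? ?] := V01 n p; rewrite ger0_norm.
apply: fine_cvg; rewrite fineK//.
apply: integrable_fin_num => //; apply: integrable_mul01 => //; last exact: bounded_integrable phiK.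
by apply: aeW => p; exact: u01.
Qed.

End Point.
End Rate.

(** * Large deviations of product weights *)

Lemma le_sum_mem (R : realType) (T : eqType) (s : seq T) (F : T -> R) f :
  f \in s -> (forall i, 0 <= F i) -> F f <= \sum_(i <- s) F i.
Proof. by move=> fs F0; rewrite (big_rem f fs) lerDl sumr_ge0. Qed.

Section AbstractLDP.
Context {R : realType} (I : finType).
Local Notation mu := (@leb_sq R).
Local Notation mfun f := (measurable_fun [set: plane R] (f : plane R -> R)).

Definition cfg_graphon n (y : cfg I n) : {ptws I -> @S0 R} :=
  fun t => graphon (fun i j => y (t, (i, j))).

Lemma pairing_graphon n (y : cfg I n) t phi : mfun phi ->
  \int[mu]_p ((val (cfg_graphon y t) : L2) p * phi p) = pairing y t phi.
Proof.
move=> mphi; apply: ae_eq_Rintegral.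
- by apply: measurable_funM => //; exact: L2_measurable.
- by apply: measurable_funM => //; exact: measurable_cfg_step.
by apply: filterS (@graphon_classE R n (fun i j => y (t, (i, j)))) => p /= ->.
Qed.

Lemma pairing_continuous t phi (K : R) : mfun phi -> (forall p, `|phi p| <= K) ->
  continuous (fun h : {ptws I -> @S0 R} => \int[mu]_p ((val (h t) : L2) p * phi p)).
Proof.
move=> mphi phiK; have [k kphi] := mkL2 mphi phiK.
rewrite (_ : (fun h => _) = fun h : {ptws I -> @S0 R} => inner (val (h t)) k).
  move=> h; apply: (@continuous_comp _ _ _ (fun h : {ptws I -> @S0 R} => h t)
    (fun x : @S0 R => inner (val x) k)); first exact: ptws_proj_continuous.
  exact: inner_continuous.
apply/funext => h; apply: ae_eq_Rintegral.
- by apply: measurable_funM => //; exact: L2_measurable.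
- by apply: measurable_funM; exact: L2_measurable.
by apply: filterS kphi => p ->.
Qed.

(** The filter generated by finitely many cell integrals at finitely many times converges to f by
    [S0_cvg_cells], so it contains every open set around f. The indicators of these cells are the
    tests. *)
Lemma ptws_S0_nbhs (G : set {ptws I -> @S0 R}) (f : {ptws I -> @S0 R}) : open G -> G f ->
  exists (J : finType) (tt : J -> I) (phi : J -> plane R -> R) (d : R),
  [/\ 0 < d, forall j, mfun (phi j), forall j p, `|phi j p| <= 1 &
    forall h, (forall j, `|\int[mu]_p ((val (h (tt j)) : L2) p * phi j p) -
      \int[mu]_p ((val (f (tt j)) : L2) p * phi j p)| < d) -> G h].
Proof.
move=> oG Gf.
pose C := (I * {n : nat & ('I_n * 'I_n)%type})%type.
pose ci (c : C) (h : {ptws I -> @S0 R}) : R :=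
  cell_integral (projT2 c.2).1 (projT2 c.2).2 (val (h c.1) : L2).
pose B (sd : seq C * R) := [set h : {ptws I -> @S0 R} |
  forall c, c \in sd.1 -> `|ci c h - ci c f| < sd.2].
pose F := filter_from [set sd : seq C * R | 0 < sd.2] B.
have FF : Filter F.
  apply: filter_from_filter; first by exists ([::], 1) => /=.
  move=> [s1 d1] [s2 d2] /= d10 d20; exists (s1 ++ s2, Num.min d1 d2) => /=.
    by rewrite lt_min d10.
  move=> h Bh; split=> c cs; have := Bh c; rewrite /= mem_cat cs ?orbT => /(_ isT);
    by rewrite lt_min => /andP[].
have Ff : F --> f.
  apply: ptws_cvg => t; apply: S0_cvg_cells => n i j.
  apply/cvgrPdist_lt => e e0.
  exists ([:: (t, existT (fun n => ('I_n * 'I_n)%type) n (i, j))], e) => // h /= Bh.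
  by rewrite distrC; apply: (Bh (t, existT _ n (i, j))); rewrite inE.
have [[s d] /= d0 BG] : F G by apply: Ff; apply: open_nbhs_nbhs.
exists 'I_(size s).
exists (fun j => (tnth (in_tuple s) j).1).
exists (fun j => \1_(cell (projT2 (tnth (in_tuple s) j).2).1 `*` cell (projT2 (tnth (in_tuple s) j).2).2)).
exists d; split => //.
- by move=> j; apply: mfun_indic; apply: measurableX; exact: measurable_cell.
- by move=> j p; rewrite indicE; case: (_ \in _); rewrite ?normr1 ?normr0.
move=> h H; apply: BG => c /= /(nthP c)[k ks <-].
by have := H (Ordinal ks); rewrite (tnth_nth c).
Qed.

Variable W : I -> plane R -> R.
Hypothesis mW : forall t, mfun (W t).
Hypothesis W01 : forall t p, 0 < W t p < 1.

Lemma dual_rate_continuous (g : I -> plane R -> R) (K : R) :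
  (forall t, mfun (g t)) -> (forall t p, `|g t p| <= K) ->
  continuous (fun h : {ptws I -> @S0 R} => dual_rate W h g).
Proof.
move=> mg gK; rewrite /dual_rate; apply: continuous_big => [|t _ h]; first exact: add_continuous.
have c := @pairing_continuous t (g t) K (mg t) (gK t) h.
by apply: (cvgB c); exact: cvg_cst.
Qed.

Lemma open_dual_rate (g : I -> plane R -> R) (K a : R) :
  (forall t, mfun (g t)) -> (forall t p, `|g t p| <= K) ->
  open [set h : {ptws I -> @S0 R} | a < dual_rate W h g].
Proof.
move=> mg gK; apply: (@open_comp _ _ (fun h => dual_rate W h g) [set x | a < x]).
  by move=> h _; exact: dual_rate_continuous mg gK h.
exact: open_gt.
Qed.

(** The rate is a supremum of weakly continuous dual functionals, so its sublevel sets are closed in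
    a compact space. *)
Lemma compact_rate (r : R) : compact [set f | (rate W f <= r%:E)%E].
Proof.
apply: (@subclosed_compact _ _ [set: {ptws I -> @S0 R}]) => //; last exact: compact_ptws_S0.
rewrite -openC openE => f /= /negP; rewrite -ltNge => rf.
have [n rn] := rate_gt_dual mW W01 rf.
apply: (@filterS _ _ _ [set h | r < dual_rate W h (opt_dual W f n)]).
  move=> h /= rh; apply/negP; rewrite -ltNge.
  apply: lt_le_trans (dual_rate_le mW W01 h (measurable_opt_dual mW W01 f n) (opt_dual_bound W01 f n)).
  by rewrite lte_fin.
apply: open_nbhs_nbhs; split => //.
exact: open_dual_rate (measurable_opt_dual mW W01 f n) (opt_dual_bound W01 f n).
Qed.

(** Each point of F lies in an open set where some dual functional exceeds a. Finitely many of these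
    sets cover F, Chernoff's bound applies to each, and their number is absorbed by half of
    [eps]. *)
Lemma graphon_upper (F : set {ptws I -> @S0 R}) (a eps : R) : closed F ->
  (forall f, F f -> (a%:E < rate W f)%E) -> 0 < eps ->
  exists2 eta : R, 0 < eta & \forall n \near \oo, forall l, @near_weights R I n W eta l ->
  \sum_(y : cfg I n | `[< F (cfg_graphon y) >]) cfg_weight l y <=
    expR (- (n%:R ^+ 2 * (a - eps))).
Proof.
move=> cF aF e0.
pose T := {ptws I -> @S0 R}.
have /choice[N NP] : forall f : T, exists n, F f -> a < dual_rate W f (opt_dual W f n).
  move=> f; have [Ff|nF] := pselect (F f); last by exists 0%N.
  by have [n rn] := rate_gt_dual mW W01 (aF f Ff); exists n.
pose g f := opt_dual W f (N f).
have mg f t : mfun (g f t) by exact: measurable_opt_dual.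
have gK f t p : `|g f t p| <= - ln ((N f).+2%:R^-1) by exact: opt_dual_bound.
have cpF : compact F by apply: (@subclosed_compact _ _ [set: {ptws I -> @S0 R}]) => //; exact: compact_ptws_S0.
have [s sF] : exists s : seq T, F `<=` [set h | exists2 f, f \in s & a < dual_rate W h (g f)].
  move/compact_near_coveringP : cpF.
  (* Finite lists directed by inclusion: compactness in the near-covering form then yields a finite
     subcover. *)
  pose FF := filter_from [set: seq T] (fun s0 => [set s : seq T | {subset s0 <= s}]).
  have fFF : Filter FF.
    apply: filter_from_filter; first by exists [::].
    move=> s1 s2 _ _; exists (s1 ++ s2) => // s ss; split=> x xs; apply: ss;
      by rewrite mem_cat xs ?orbT.
  move=> /(_ _ FF (fun s h => exists2 f, f \in s & a < dual_rate W h (g f)) fFF) H.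
  have [f Ff|s0 _ H0] := H; last by exists s0; apply: H0.
  exists ([set h | a < dual_rate W h (g f)], [set s : seq T | (f : T) \in s]) => /=; last first.
    by move=> [h s] /= [ah fs]; exists f.
  split; last by exists [:: f] => // s; apply; rewrite inE.
  by apply: open_nbhs_nbhs; split; [exact: open_dual_rate (mg f) (gK f)|exact: NP].
have e20 : 0 < eps / 2 by rewrite divr_gt0.
pose gs (j : 'I_(size s)) := g (tnth (in_tuple s) j).
have [|eta eta0 H] := @near_weights_forall R I 'I_(size s) W (fun j n l => forall a : R,
  \sum_(y : cfg I n | a <= \sum_t pairing y t (gs j t)) cfg_weight l y <=
    expR (n%:R ^+ 2 * (- a + \sum_t \int[mu]_p logmgf (1 - W t p) (W t p) (gs j t p) + eps / 2))).
  by move=> j; exact: (weight_upper mW W01 (mg _) (gK _) e20).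
have s0 : 0 < (size s).+1%:R^-1 :> R by rewrite invr_gt0.
exists eta => //; apply: filterS2 H (expR_sqr_lt e20 s0) => n H hn l lW.
have l0 k x : 0 <= l k.1 k.2.1 k.2.2 x by have [h _ _ _] := lW k.1; exact: h.
pose A f (y : cfg I n) := a < dual_rate W (cfg_graphon y) (g f).
apply: (@le_trans _ _ (\sum_(f <- s) \sum_(y : cfg I n | A f y) cfg_weight l y)).
  under [leRHS]eq_bigr do rewrite big_mkcond.
  rewrite exchange_big /= big_mkcond; apply: ler_sum => y _.
  have w0 := prod_weight_ge0 y l0.
  case: ifPn => [/asboolP/sF[f fs af]|_]; last by apply: sumr_ge0 => f _; case: ifP.
  have h := @le_sum_mem R _ s (fun i => if A i y then cfg_weight l y else 0) f fs.
  by rewrite (le_trans _ (h _))//; [rewrite ifT|move=> i; case: ifP].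
apply: (@le_trans _ _ (\sum_(f <- s) expR (- (n%:R ^+ 2 * (a - eps / 2))))).
  rewrite big_seq [leRHS]big_seq; apply: ler_sum => f fs.
  have /tnthP[j jf] : f \in in_tuple s by [].
  have := H l lW j (a + \sum_t \int[mu]_p logmgf (1 - W t p) (W t p) (g f t p)).
  rewrite /gs -jf; set L := \sum_t _.
  rewrite (_ : - (a + L) + L + eps / 2 = - (a - eps / 2)); last by ring.
  rewrite mulrN; apply: le_trans.
  rewrite big_mkcond [leRHS]big_mkcond /=; apply: ler_sum => y _.
  have w0 := prod_weight_ge0 y l0.
  case: ifPn => [h|_]; last by case: ifP.
  rewrite ifT//; move: h; rewrite /A /dual_rate sumrB -/L.
  have -> : \sum_t pairing y t (g f t) =
      \sum_t \int[mu]_p ((val (cfg_graphon y t) : L2) p * g f t p).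
    by apply: eq_bigr => t _; rewrite (pairing_graphon _ _ (mg f t)).
  by lra.
rewrite big_const_seq count_predT iter_addr addr0 -[leLHS]mulr_natl.
rewrite (_ : - (n%:R ^+ 2 * (a - eps)) =
  - (n%:R ^+ 2 * (a - eps / 2)) + n%:R ^+ 2 * (eps / 2)); last by field.
rewrite expRD mulrC; apply: ler_wpM2l; first exact: expR_ge0.
rewrite expRN ltf_pV2 ?posrE ?expR_gt0 ?ltr0n// in hn.
by apply: le_trans (ltW hn); rewrite ler_nat.
Qed.

(** Half of the tolerance d is spent on the distance between the truncated tilt and f on the tests,
    the other half on concentration around that tilt. *)
Lemma graphon_lower (G : set {ptws I -> @S0 R}) (f : {ptws I -> @S0 R}) (r eps : R) : open G ->
  G f -> (rate W f <= r%:E)%E -> 0 < eps ->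
  exists2 eta : R, 0 < eta & \forall n \near \oo, forall l, @near_weights R I n W eta l ->
  expR (- (n%:R ^+ 2 * (r + eps))) <=
  \sum_(y : cfg I n | `[< G (cfg_graphon y) >]) cfg_weight l y.
Proof.
move=> oG Gf fr e0.
have [J [tt [phi [d [d0 mphi phi1 HG]]]]] := ptws_S0_nbhs oG Gf.
have d20 : 0 < d / 2 by rewrite divr_gt0.
have [m Hm] : exists m, forall j, `|\int[mu]_p (opt_tilt W f m (tt j) p * phi j p) -
    \int[mu]_p ((val (f (tt j)) : L2) p * phi j p)| < d / 2.
  have : \forall m \near \oo, forall j, `|\int[mu]_p (opt_tilt W f m (tt j) p * phi j p) -
    \int[mu]_p ((val (f (tt j)) : L2) p * phi j p)| < d / 2.
    apply: filter_forall => j.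
    have /cvgrPdist_lt/(_ _ d20) := cvg_opt_tilt (f := f) (t := tt j) mW W01 (mphi j) (phi1 j).
    by apply: filterS => m; rewrite distrC.
  by move=> [m _ /(_ m (leqnn m))]; exists m.
have [eta eta0 H] := weight_lower mW W01 (measurable_opt_dual mW W01 f m)
  (opt_dual_bound W01 f m) tt d20 e0 mphi phi1.
exists eta => //; apply: filterS H => n H l lW.
have l0 k x : 0 <= l k.1 k.2.1 k.2.2 x by have [h _ _ _] := lW k.1; exact: h.
apply: (@le_trans _ _ (expR (- (n%:R ^+ 2 * (\sum_t (\int[mu]_p (opt_tilt W f m t p * opt_dual W f m t p) -
      \int[mu]_p logmgf (1 - W t p) (W t p) (opt_dual W f m t p)) + eps))))).
  rewrite ler_expR lerN2 ler_wpM2l ?sqr_ge0// lerD2r -lee_fin.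
  exact: le_trans (opt_tilt_entropy mW W01 f m) fr.
apply: (le_trans (H l lW)).
rewrite big_mkcond [leRHS]big_mkcond /=; apply: ler_sum => y _.
have w0 := prod_weight_ge0 y l0.
case: ifPn => [/forallP h|_]; last by case: ifP.
rewrite ifT//; apply/asboolP; apply: HG => j; rewrite pairing_graphon//.
have := ler_normD (pairing y (tt j) (phi j) - \int[mu]_p (opt_tilt W f m (tt j) p * phi j p))
  (\int[mu]_p (opt_tilt W f m (tt j) p * phi j p) - \int[mu]_p ((val (f (tt j)) : L2) p * phi j p)).
by rewrite subrKA; have := Hm j; have := h j; rewrite /opt_tilt; lra.
Qed.

End AbstractLDP.

(** * Relaxation of the two-state chain *)

Section Comparison.
Context {R : realType}.
Local Notation lam := (@lebesgue_measure R).
Implicit Types (k z f : R -> R) (s t u v w : R).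

Lemma sub_itv_cc s u v t : s <= u -> v <= t -> `[u, v]%classic `<=` `[s, t]%classic.
Proof.
move=> su vt w /=; rewrite !in_itv /= => /andP[uw wv].
by rewrite (le_trans su uw) (le_trans wv vt).
Qed.

Lemma bounded_itv_integrable k u v (M : R) : measurable_fun `[u, v] k ->
  (forall w, u <= w <= v -> `|k w| <= M) -> lam.-integrable `[u, v] (EFin \o k).
Proof.
move=> mk kM; apply: measurable_bounded_integrable => //.
  by rewrite /= lebesgue_measure_itv; case: ifP; rewrite ?ltry// -EFinB ltry.
exists M; split; first exact: num_real.
by move=> x Mx w /= wuv; apply: le_trans (ltW Mx); apply: kM; rewrite in_itv in wuv.
Qed.

(** The bound B is asked only after the left endpoint: in [decay_le] it is not known at the last
    time itself. *)
Lemma Rintegral_itv_le k u v (B M : R) : u <= v -> measurable_fun `[u, v] k ->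
  (forall w, u <= w <= v -> `|k w| <= M) -> (forall w, u < w <= v -> k w <= B) ->
  \int[lam]_(w in `[u, v]) k w <= B * (v - u).
Proof.
move=> uv mk kM kB; have ik := bounded_itv_integrable mk kM.
have sub : `]u, v] `<=` `[u, v] by apply: subset_itvr; rewrite bnd_simp.
have ik' : lam.-integrable `]u, v] (EFin \o k) by apply: integrableS ik.
rewrite -(Rintegral_itv_obnd_cbnd ik').
have muv : (lam `]u, v] = (v - u)%:E)%E.
  rewrite lebesgue_measure_itv /= lte_fin -EFinB; case: ltP => // vu.
  by congr EFin; apply/eqP; rewrite eq_sym subr_eq0 eq_le uv vu.
rewrite -[v - u]/(fine (v - u)%:E) -muv -Rintegral_cst//.
apply: le_Rintegral => //.
  apply: measurable_bounded_integrable => //; first by rewrite /= muv ltry.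
  by exists `|B|; split; [exact: num_real|move=> x Bx w _; exact: ltW].
Qed.

(* Take the last time at which [z] is below the claimed bound: afterwards [z]
   decreases, so that bound can never be exceeded again; and if there is no
   such time, [z] decreases at a rate that brings it below the bound. *)
Lemma decay_le z k s t (kap M : R) : s <= t -> 0 < kap ->
  measurable_fun `[s, t] k -> (forall u, s <= u <= t -> `|k u| <= M) ->
  (forall u v, s <= u -> u <= v -> v <= t ->
    z v = z u + \int[lam]_(w in `[u, v]) k w) ->
  (forall u, s <= u <= t -> 0 <= z u -> k u <= - (kap * z u)) ->
  z s <= 1 -> z t <= (1 + kap * (t - s))^-1.
Proof.
move=> st kap0 mk kM zk kz zs; set e := _^-1.
have kts : 0 <= kap * (t - s) by rewrite mulr_ge0 ?subr_ge0// ltW.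
have e0 : 0 < e by rewrite invr_gt0; lra.
have M0 : 0 <= M by apply: le_trans (normr_ge0 _) (kM s _); rewrite lexx st.
have zle u v B : s <= u -> u <= v -> v <= t -> (forall w, u < w <= v -> k w <= B) ->
    z v <= z u + B * (v - u).
  move=> su uv vt kB; rewrite (zk u v)// lerD2l; apply: (@Rintegral_itv_le _ _ _ _ M) => //.
    by apply: measurable_funS mk => //; exact: sub_itv_cc.
  by move=> w /andP[uw wv]; rewrite kM// (le_trans su uw) (le_trans wv vt).
rewrite leNgt; apply/negP => ez.
pose E := [set u | s <= u <= t /\ z u <= e].
have [[u0 Eu0]|nE] := pselect (exists u, E u); last first.
  have ke w : s < w <= t -> k w <= - (kap * e).
    move=> /andP[sw wt]; have swt : s <= w <= t by rewrite ltW.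
    have ew : e < z w by rewrite ltNge; apply/negP => we; apply: nE; exists w.
    have := kz w swt (ltW (lt_trans e0 ew)).
    by have := ler_wpM2l (ltW kap0) (ltW ew); lra.
  have := zle s t _ (lexx s) st (lexx t) ke.
  (* Origin of the constant: if z stays above e, it loses at least kap e (t - s) from a value at
     most 1, and e solves 1 - kap e (t - s) = e. *)
  have ee : e * (1 + kap * (t - s)) = 1 by rewrite mulVf// gt_eqF//; lra.
  by nra.
have supE : has_sup E.
  by split; [exists u0|exists t => u [/andP[]]].
pose sg := sup E.
have sg1 : s <= sg by apply: le_trans (ub_le_sup supE.2 Eu0); case: Eu0 => /andP[].
have sg2 : sg <= t by apply: ge_sup; [exists u0|move=> u [/andP[]]].
(* The supremum is approached by times of E, between which z grows at speed at most M, so the bound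
   survives up to an arbitrary d. *)
have zsg : z sg <= e.
  apply/ler_addgt0Pr => d d0.
  have [u Eu us] := sup_adherent (divr_gt0 d0 (ltr_pwDl ltr01 M0)) supE.
  have usg : u <= sg by exact: (ub_le_sup supE.2 Eu).
  case: Eu => /andP[su ut] zu.
  have := zle u sg M su usg sg2 _.
  have kw w : u < w <= sg -> k w <= M.
    move=> /andP[uw wsg]; apply: le_trans (ler_norm _) (kM _ _).
    by rewrite (le_trans su (ltW uw)) (le_trans wsg).
  move=> /(_ kw); rewrite -/sg in us.
  have : M * (sg - u) <= d.
    have : sg - u <= d / (1 + M) by lra.
    rewrite ler_pdivlMr; last lra.
    by have : 0 <= sg - u; [lra|nra].
  by lra.
have kn w : sg < w <= t -> k w <= 0.
  move=> /andP[sw wt]; have swt : s <= w <= t by rewrite wt (le_trans sg1 (ltW sw)).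
  have ew : e < z w.
    rewrite ltNge; apply/negP => we.
    have : E w by []. by move/(ub_le_sup supE.2); rewrite -/sg leNgt sw.
  have zw := ltW (lt_trans e0 ew).
  by apply: le_trans (kz w swt zw) _; rewrite oppr_le0 mulr_ge0// ltW.
by have := zle sg t 0 sg1 sg2 (lexx t) kn; lra.
Qed.

End Comparison.

Section Transition.
Context {R : realType}.
Local Notation lam := (@lebesgue_measure R).
Variables (T kap M : R) (q : R -> bool -> R) (p : R -> R -> bool -> bool -> R).
Hypothesis trp : transition_function T q p.
Hypothesis mq : forall x, measurable_fun `[0, T] (q ^~ x).
Hypothesis qM : forall u x, 0 <= u <= T -> `|q u x| <= M.
Hypothesis kap0 : 0 < kap.
Hypothesis kapq : forall u, 0 <= u <= T -> kap <= q u false + q u true.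

(** Right-hand side of the forward equation for the state [true], once the probability of [false] is
    eliminated. *)
Definition drift (f : R -> R) (u : R) : R :=
  q u false - f u * (q u false + q u true).

Lemma trans01 s t x : 0 <= s -> s <= t -> t <= T -> 0 <= p s t x true <= 1.
Proof.
move=> s0 st tT; have := trans_sum1 trp x s0 st tT.
have := trans_ge0 trp x false s0 st tT; have := trans_ge0 trp x true s0 st tT.
by lra.
Qed.

Lemma measurable_trans s x u v : 0 <= s -> s <= u -> v <= T ->
  measurable_fun `[u, v] (fun w => p s w x true).
Proof.
move=> s0 su vT; have [uv|vu] := leP u v; last first.
  by rewrite set_itv_ge; [exact: measurable_fun_set0|rewrite bnd_simp -ltNge].
apply: measurable_funS (trans_measurable trp x true s0 _) => //.
  exact: sub_itv_cc.
exact: le_trans su (le_trans uv vT).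
Qed.

Lemma measurable_drift f u v : 0 <= u -> v <= T ->
  measurable_fun `[u, v] f -> measurable_fun `[u, v] (drift f).
Proof.
move=> u0 vT mf.
have mq' x : measurable_fun `[u, v] (q ^~ x).
  by apply: measurable_funS (mq x) => //; exact: sub_itv_cc.
apply: measurable_funB => //; apply: measurable_funM => //.
exact: measurable_funD.
Qed.

Lemma drift_bound f u : 0 <= u <= T -> 0 <= f u <= 1 -> `|drift f u| <= 3 * M.
Proof.
move=> uT /andP[f0 f1]; have := qM false uT; have := qM true uT.
rewrite /drift !ler_norml => /andP[a1 a2] /andP[b1 b2].
by apply/andP; split; nra.
Qed.

Lemma trans_incr s u v x : 0 <= s -> s <= u -> u <= v -> v <= T ->
  p s v x true = p s u x true +
    \int[lam]_(w in `[u, v]) drift (fun w => p s w x true) w.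
Proof.
move=> s0 su uv vT; pose k := drift (fun w => p s w x true).
have E t : s <= t -> t <= T -> p s t x true = (x == true)%:R + \int[lam]_(w in `[s, t]) k w.
  move=> st tT; rewrite (trans_forward trp)//; congr (_ + _).
  apply: eq_Rintegral => w; rewrite inE /= in_itv /= => /andP[sw wt].
  have := trans_sum1 trp x s0 sw (le_trans wt tT).
  rewrite /k /drift /= => h; have -> : p s w x false = 1 - p s w x true by lra.
  by ring.
have ik a b : s <= a -> b <= T -> lam.-integrable `[a, b] (EFin \o k).
  move=> sa bT; apply: (@bounded_itv_integrable _ _ _ _ (3 * M)).
    by apply: measurable_drift => //; [exact: le_trans sa|exact: measurable_trans].
  move=> w /andP[aw wb]; apply: drift_bound.
    by rewrite (le_trans s0 (le_trans sa aw)) (le_trans wb).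
  by apply: trans01 => //; [exact: le_trans aw|exact: le_trans wb bT].
rewrite !E ?(le_trans su)// ?(le_trans uv)// -addrA; congr (_ + _).
apply/eqP; rewrite addrC -subr_eq; apply/eqP.
rewrite Rintegral_itvB ?bnd_simp//; last exact: ik.
rewrite Rintegral_itv_obnd_cbnd//; apply: integrableS (ik u v su vT) => //.
by apply: subset_itvr; rewrite bnd_simp.
Qed.

(** The difference of two solutions is driven by minus the total rate times itself; [decay_le] is
    applied to it and to its opposite. The starting times may differ, since only [s, t] is used. *)
Lemma trans_close s t x x0 : 0 <= s -> s <= t -> t <= T ->
  `|p s t x true - p 0 t x0 true| <= (1 + kap * (t - s))^-1.
Proof.
move=> s0 st tT; have T0 : 0 <= T by apply: le_trans tT; apply: le_trans st.
pose f1 w := p s w x true; pose f2 w := p 0 w x0 true.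
have b w : s <= w <= t -> [/\ 0 <= w <= T, 0 <= f1 w <= 1 & 0 <= f2 w <= 1].
  move=> /andP[sw wt]; have w0 := le_trans s0 sw; have wT := le_trans wt tT.
  by rewrite w0 wT; split=> //; exact: trans01.
have m1 : measurable_fun `[s, t] f1 by exact: measurable_trans.
have m2 : measurable_fun `[s, t] f2 by exact: measurable_trans.
have md1 : measurable_fun `[s, t] (drift f1) by exact: measurable_drift.
have md2 : measurable_fun `[s, t] (drift f2) by exact: measurable_drift.
have inc u v : s <= u -> u <= v -> v <= t ->
    f1 v - f2 v = f1 u - f2 u + \int[lam]_(w in `[u, v]) (drift f1 w - drift f2 w).
  move=> su uv vt; have sub := sub_itv_cc su vt.
  have bb w : u <= w <= v -> s <= w <= t.
    by move=> /andP[uw wv]; rewrite (le_trans su uw) (le_trans wv vt).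
  rewrite /f1 /f2 (trans_incr x s0 su uv (le_trans vt tT)).
  rewrite (trans_incr x0 (lexx 0) (le_trans s0 su) uv (le_trans vt tT)).
  rewrite RintegralB//; [by rewrite /f1 /f2; ring|..];
    apply: (@bounded_itv_integrable _ _ _ _ (3 * M)); do 1?[exact: measurable_funS sub _];
    by move=> w /bb/b[? ? ?]; exact: drift_bound.
have bnd w : s <= w <= t -> `|drift f1 w - drift f2 w| <= 6 * M.
  move=> /b[wT h1 h2]; apply: le_trans (ler_normB _ _) _.
  by have := drift_bound wT h1; have := drift_bound wT h2; lra.
rewrite ler_norml; apply/andP; split.
  rewrite lerNl opprB.
  apply: (@decay_le _ (fun w => f2 w - f1 w) (fun w => drift f2 w - drift f1 w) _ _ _ (6 * M)) => //.
  - exact: measurable_funB.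
  - by move=> u /bnd; rewrite distrC.
  - move=> u v su uv vt; have := inc u v su uv vt.
    rewrite (_ : (fun w => drift f2 w - drift f1 w) = fun w => -1 * (drift f1 w - drift f2 w)).
      rewrite RintegralZl//; first by lra.
      apply: (@bounded_itv_integrable _ _ _ _ (6 * M)).
        by apply: measurable_funB; exact: measurable_funS (sub_itv_cc su vt) _.
      by move=> w /andP[uw wv]; apply: bnd; rewrite (le_trans su uw) (le_trans wv vt).
    by apply/funext => w; ring.
  - move=> u su z0; have [uT _ _] := b u su; have := kapq uT.
    by rewrite /drift; nra.
  - by have [_ /andP[? ?] /andP[? ?]] := b s (introT andP (conj (lexx s) st)); lra.
apply: (@decay_le _ (fun w => f1 w - f2 w) (fun w => drift f1 w - drift f2 w) _ _ _ (6 * M)) => //.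
- exact: measurable_funB.
- move=> u su z0; have [uT _ _] := b u su; have := kapq uT.
  by rewrite /drift; nra.
- by have [_ /andP[? ?] /andP[? ?]] := b s (introT andP (conj (lexx s) st)); lra.
Qed.

(** While f exceeds v + e it exceeds the current ratio of the rates, so f - v - e decays at rate at
    least [kap]; symmetrically for v - e - f. Only the window of length [dl] before t matters. *)
Lemma trans_equilibrium t x0 dl v e : 0 <= dl -> dl <= t -> t <= T -> 0 <= v <= 1 -> 0 <= e ->
  (forall u, t - dl <= u <= t -> `|q u false / (q u false + q u true) - v| <= e) ->
  `|p 0 t x0 true - v| <= e + (1 + kap * dl)^-1.
Proof.
move=> d0 dt tT /andP[v0 v1] e0 qv; pose f w := p 0 w x0 true; pose s := t - dl.
have s0 : 0 <= s by rewrite subr_ge0.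
have st : s <= t by rewrite gerBl.
have dE : dl = t - s by rewrite /s; ring.
have b w : s <= w <= t -> [/\ 0 <= w <= T, 0 <= f w <= 1 &
    (v - e) * (q w false + q w true) <= q w false <= (v + e) * (q w false + q w true)].
  move=> swt; have /andP[sw wt] := swt.
  have wT : 0 <= w <= T by rewrite (le_trans s0 sw) (le_trans wt tT).
  have L0 := lt_le_trans kap0 (kapq wT).
  have wT' := wT; case/andP: wT' => w0 wT'.
  split=> //; first exact: trans01.
  have := qv w swt; rewrite ler_norml lerBlDr lerBrDr => /andP[h1 h2].
  by apply/andP; split; [rewrite -ler_pdivlMr//; lra|rewrite -ler_pdivrMr//; lra].
have mf : measurable_fun `[s, t] f by exact: measurable_trans.
have md : measurable_fun `[s, t] (drift f) by exact: measurable_drift.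
have bnd w : s <= w <= t -> `|drift f w| <= 3 * M.
  by move=> /b[wT h1 h2]; exact: drift_bound.
have inc u w : s <= u -> u <= w -> w <= t ->
    f w = f u + \int[lam]_(r in `[u, w]) drift f r.
  by move=> su uv vt; apply: trans_incr => //; [exact: le_trans su|exact: le_trans tT].
have ss : s <= s <= t by rewrite lexx.
rewrite dE ler_norml; apply/andP; split.
  have : v - e - f t <= (1 + kap * (t - s))^-1; last by rewrite /f; lra.
  apply: (@decay_le _ (fun w => v - e - f w) (fun w => -1 * drift f w) _ _ _ (3 * M)) => //.
  - exact: measurable_funM.
  - by move=> u /bnd; rewrite mulN1r normrN.
  - move=> u w su uw wt; rewrite (inc u w)// RintegralZl//; first by ring.
    apply: (@bounded_itv_integrable _ _ _ _ (3 * M)).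
      by apply: measurable_funS md => //; exact: sub_itv_cc.
    by move=> r /andP[ur rw]; apply: bnd; rewrite (le_trans su ur) (le_trans rw wt).
  - move=> u su z0; have [uT /andP[? ?] /andP[? ?]] := b u su; have := kapq uT.
    by rewrite /drift; nra.
  - by have [_ /andP[? ?] _] := b s ss; lra.
have : f t - v - e <= (1 + kap * (t - s))^-1; last by rewrite /f; lra.
apply: (@decay_le _ (fun w => f w - v - e) (drift f) _ _ _ (3 * M)) => //.
- by move=> u w su uw wt; rewrite (inc u w)//; ring.
- move=> u su z0; have [uT /andP[? ?] /andP[? ?]] := b u su; have := kapq uT.
  by rewrite /drift; nra.
- by have [_ /andP[? ?] _] := b s ss; lra.
Qed.

End Transition.

(** * Law of the states at finitely many times *)

Section Sandwich.
Context {R : realType}.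
Implicit Types (ph e pt pf : R).

(** Bounds for a transition probability that no longer depend on the starting state. The lower one
    is cut at zero so that products of lower bounds remain lower bounds. *)
Definition occ_hi ph e (b : bool) : R := (if b then ph else 1 - ph) + e.
Definition occ_lo ph e (b : bool) : R := Num.max 0 ((if b then ph else 1 - ph) - e).

Lemma occ_sandwich ph e pt pf b : 0 <= pt <= 1 -> pf + pt = 1 -> `|pt - ph| <= e ->
  let pb := if b then pt else pf in
  [/\ 0 <= pb, occ_lo ph e b <= pb & pb <= occ_hi ph e b].
Proof.
move=> /andP[p0 p1] s1; rewrite ler_norml /occ_lo /occ_hi ge_max => /andP[h1 h2].
by case: b; split; do ?(apply/andP; split); lra.
Qed.

End Sandwich.

Section PathLaw.
Context {R : realType} d (Om : measurableType d) (P : probability Om R).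
Variables (T kap M : R) (q : R -> bool -> R) (x0 : bool) (X : R -> Om -> bool).
Hypothesis T0 : 0 < T.
Hypothesis jX : jump_chain P T q x0 X.
Hypothesis mq : forall x, measurable_fun `[0, T] (q ^~ x).
Hypothesis qM : forall u x, 0 <= u <= T -> `|q u x| <= M.
Hypothesis kap0 : 0 < kap.
Hypothesis kapq : forall u, 0 <= u <= T -> kap <= q u false + q u true.

Lemma history_le s t : s <= t -> history X s `<=` history X t.
Proof.
move=> st; apply: sub_sigma_algebra2 => A [u /andP[u0 us] BA].
by exists u => //; rewrite u0 (le_trans us).
Qed.

Lemma history_point s t B : 0 <= t <= s -> history X s (X t @^-1` B).
Proof. by move=> ts; apply: sub_sigma_algebra; exists t => //; exists B. Qed.

Lemma history_setI s A B : history X s A -> history X s B -> history X s (A `&` B).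
Proof. exact: (@measurableI _ (g_sigma_algebraType _) A B). Qed.

Lemma history_setT s : history X s setT.
Proof. exact: (@measurableT _ (g_sigma_algebraType _)). Qed.

Lemma history_measurable s A : s <= T -> history X s A -> measurable A.
Proof.
move=> sT; apply: smallest_sub; first exact: sigma_algebra_measurable.
move=> B [u /andP[u0 us] [C ->]]; rewrite -[X in measurable X]setTI.
by apply: (chain_measurable jX) => //; rewrite u0 (le_trans us).
Qed.

Definition occupation (t : R) : R := fine (P (X t @^-1` [set true])).

Lemma occupation_trans p : transition_function T q p ->
  (forall s t A x y, 0 <= s -> s <= t -> t <= T -> history X s A ->
      P (A `&` X s @^-1` [set x] `&` X t @^-1` [set y]) =
      (P (A `&` X s @^-1` [set x]) * (p s t x y)%:E)%E) ->
  forall t, 0 <= t <= T -> occupation t = p 0 t x0 true.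
Proof.
move=> trp mk t /andP[t0 tT].
have X0 : X 0 @^-1` [set x0] = setT.
  by apply/seteqP; split=> // w _ /=; rewrite (chain_init jX).
have := mk 0 t setT x0 true (lexx 0) t0 tT (@history_setT 0).
by rewrite X0 !setTI probability_setT mul1e /occupation => ->.
Qed.

Lemma occupation01 t : 0 <= t <= T -> 0 <= occupation t <= 1.
Proof.
move=> tT; have [p trp mk] := chain_markov jX; rewrite (occupation_trans trp mk)//.
by case/andP: tT => ? ?; apply: (trans01 trp).
Qed.

Lemma occupation_equilibrium t dl v e : 0 <= dl -> dl <= t -> t <= T ->
  0 <= v <= 1 -> 0 <= e ->
  (forall u, t - dl <= u <= t -> `|q u false / (q u false + q u true) - v| <= e) ->
  `|occupation t - v| <= e + (1 + kap * dl)^-1.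
Proof.
move=> d0 dt tT v01 e0 qv; have [p trp mk] := chain_markov jX.
rewrite (occupation_trans trp mk) ?(le_trans d0 dt)//.
exact: (trans_equilibrium trp mq qM kap0 kapq).
Qed.

Definition path_event (I : Type) (tau : I -> R) (y : I -> bool) (ts : seq I) : set Om :=
  [set w | all (fun i => X (tau i) w == y i) ts].

Lemma path_event_rcons (I : Type) (tau : I -> R) y ts i :
  path_event tau y (rcons ts i) = path_event tau y ts `&` X (tau i) @^-1` [set y i].
Proof.
apply/seteqP; split=> w; rewrite /path_event /= all_rcons.
  by move=> /andP[/eqP].
by move=> [-> ->]; rewrite eqxx.
Qed.

(** Induction on the last time: conditionally on the past and on the state at the previous time, the
    new transition probability is within e of the occupation probability. Membership in the history
    is carried along so that the Markov property applies at the next step. *)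
Lemma path_law (I : Type) (tau : I -> R) (y : I -> bool) (ts : seq I) (d0 : R) : 0 < d0 ->
  path (fun a b => a + d0 <= b) 0 (map tau ts) -> all (fun i => tau i <= T) ts ->
  let e := (1 + kap * d0)^-1 in
  [/\ 0 <= last 0 (map tau ts) <= T,
    history X (last 0 (map tau ts)) (path_event tau y ts) &
    \prod_(i <- ts) occ_lo (occupation (tau i)) e (y i) <=
      fine (P (path_event tau y ts)) <=
    \prod_(i <- ts) occ_hi (occupation (tau i)) e (y i)].
Proof.
move=> d00 + + e; have e0 : 0 <= e.
  by rewrite invr_ge0 addr_ge0// mulr_ge0// ltW.
elim/last_ind: ts => [_ _|ts i IH] /=.
  have -> : path_event tau y [::] = setT by apply/seteqP; split.
  rewrite !big_nil probability_setT !lexx (ltW T0); split=> //; exact: history_setT.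
rewrite map_rcons rcons_path all_rcons last_rcons => /andP[/IH{}IH st] /andP[tT /IH[]].
set s := last _ _; set E := path_event _ _ ts; set t := tau i => /andP[s0 sT] hE.
have {}st : s + d0 <= t by exact: st.
have st' : s <= t by apply: le_trans st; rewrite lerDl ltW.
have t0 := le_trans s0 st'.
move=> /andP[lo hi]; rewrite t0 tT path_event_rcons -/E; split=> //.
  by apply: history_setI; [exact: history_le hE|apply: history_point; rewrite t0 lexx].
have [p trp mk] := chain_markov jX.
have mX u b : 0 <= u -> u <= T -> measurable (X u @^-1` [set b]).
  by move=> u0 uT; apply: (@history_measurable u) => //; apply: history_point; rewrite u0 lexx.
have mE : measurable E by exact: history_measurable hE.
have mEX b : measurable (E `&` X s @^-1` [set b]) by apply: measurableI => //; exact: mX.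
have fP A : measurable A -> P A = (fine (P A))%:E.
  by move=> mA; rewrite fineK// fin_num_measure.
(* The Markov property needs the present state, which the event need not determine when s = 0;
   splitting over both states treats all cases alike. *)
have split_state (A : set Om) : A = (A `&` X s @^-1` [set false]) `|` (A `&` X s @^-1` [set true]).
  rewrite -setIUr; apply/seteqP; split=> [w Aw|w []//]; split=> //=.
  by case: (X s w); [right|left].
pose a b := fine (P (E `&` X s @^-1` [set b])).
have Ea : fine (P E) = a false + a true.
  rewrite {1}(split_state E) measureU//.
    by rewrite /= (fP _ (mEX false)) (fP _ (mEX true)).
  by apply/seteqP; split=> // w [[_ /= ->] []].
have Et : fine (P (E `&` X t @^-1` [set y i])) = a false * p s t false (y i) + a true * p s t true (y i).
  rewrite (split_state (_ `&` _)) measureU.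
  - have Pb b : P (E `&` X t @^-1` [set y i] `&` X s @^-1` [set b]) =
        (a b * p s t b (y i))%:E.
      by rewrite setIAC mk// (fP _ (mEX b)).
    by rewrite /= (Pb false) (Pb true).
  - by rewrite setIAC; apply: measurableI; [exact: mEX|exact: mX].
  - by rewrite setIAC; apply: measurableI; [exact: mEX|exact: mX].
  - by apply/seteqP; split=> // w [[_ /= ->] []].
have a0 b : 0 <= a b by rewrite fine_ge0.
have eE : forall b, `|p s t b true - occupation t| <= e.
  move=> b; rewrite (occupation_trans trp mk) ?t0//.
  apply: le_trans (trans_close trp mq qM kap0 kapq b x0 s0 st' tT) _.
  have kd : kap * d0 <= kap * (t - s) by apply: ler_wpM2l; [exact: ltW|lra].
  have k0 := mulr_gt0 kap0 d00.
  by rewrite /e lef_pV2 ?posrE; lra.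
have pb b : [/\ 0 <= p s t b (y i), occ_lo (occupation t) e (y i) <= p s t b (y i) &
    p s t b (y i) <= occ_hi (occupation t) e (y i)].
  have := occ_sandwich (y i) (trans01 trp b s0 st' tT) (trans_sum1 trp b s0 st' tT) (eE b).
  by case: (y i).
have [[pf0 lf hf] [pt0 lt ht]] := (pb false, pb true).
have lo0 : 0 <= occ_lo (occupation t) e (y i) by rewrite le_max lexx.
have hi0 := le_trans lo0 (le_trans lf hf).
rewrite Et -!cats1 !big_cat !big_seq1 /=; rewrite Ea in lo hi.
have [af at'] := (a0 false, a0 true).
apply/andP; split.
  apply: le_trans (ler_wpM2r lo0 lo) _.
  by rewrite mulrDl lerD// ler_wpM2l.
apply: le_trans _ (ler_wpM2r hi0 hi).
by rewrite mulrDl lerD// ler_wpM2l.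
Qed.

End PathLaw.

Lemma path_gap (R : realType) (x : R) (s : seq R) : path <%R x s ->
  exists2 d0 : R, 0 < d0 & path (fun a b => a + d0 <= b) x s.
Proof.
elim: s x => [|y s IH] x /=; first by exists 1.
move=> /andP[xy /IH[d0 d00 Hs]]; exists (Num.min d0 (y - x)).
  by rewrite lt_min d00 subr_gt0.
have h1 : Num.min d0 (y - x) <= y - x by rewrite ge_min lexx orbT.
have h2 : Num.min d0 (y - x) <= d0 by rewrite ge_min lexx.
apply/andP; split; first by lra.
by apply: sub_path Hs => a b; lra.
Qed.

(** Sorting the times yields a common gap, which also separates the first one from 0, where the
    induction of [path_law] starts. *)
Lemma time_gap (R : realType) (I : finType) (tau : I -> R) : injective tau ->
  (forall i, 0 < tau i) -> exists ts : seq I, exists2 d0 : R, 0 < d0 &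
    perm_eq ts (index_enum I) /\ path (fun a b => a + d0 <= b) 0 (map tau ts).
Proof.
move=> tau_inj tau0; pose le i j := tau i <= tau j.
exists (sort le (index_enum I)).
have [|d0 d00 H] := @path_gap R 0 (map tau (sort le (index_enum I))).
  rewrite path_sortedE; last exact: lt_trans.
  apply/andP; split; first by apply/allP => _ /mapP[i _ ->].
  rewrite lt_sorted_uniq_le map_inj_uniq// sort_uniq index_enum_uniq /=.
  by rewrite sorted_map; apply: sort_sorted => i j; exact: le_total.
by exists d0 => //; split=> //; rewrite perm_sort.
Qed.

Section JointLaw.
Context {R : realType} d (Om : measurableType d) (P : probability Om R).
Variables (T kap M : R) (n : nat) (q : 'I_n -> 'I_n -> R -> bool -> R).
Variables (x0 : 'I_n -> 'I_n -> bool) (X : 'I_n -> 'I_n -> R -> Om -> bool).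
Hypothesis T0 : 0 < T.
Hypothesis jX : forall i j, jump_chain P T (q i j) (x0 i j) (X i j).
Hypothesis indX : independent_processes P T (fun ij : 'I_n * 'I_n => X ij.1 ij.2).
Hypothesis mq : forall i j x, measurable_fun `[0, T] (q i j ^~ x).
Hypothesis qM : forall i j u x, 0 <= u <= T -> `|q i j u x| <= M.
Hypothesis kap0 : 0 < kap.
Hypothesis kapq : forall i j u, 0 <= u <= T -> kap <= q i j u false + q i j u true.
Variables (I : finType) (tau : I -> R) (ts : seq I) (d0 : R).
Hypothesis tauT : forall i, 0 < tau i <= T.
Hypothesis d00 : 0 < d0.
Hypothesis perm_ts : perm_eq ts (index_enum I).
Hypothesis path_ts : path (fun a b => a + d0 <= b) 0 (map tau ts).

Definition config (w : Om) : cfg I n := [ffun k => X k.2.1 k.2.2 (tau k.1) w].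

Let e := (1 + kap * d0)^-1.

Definition weight_hi (t : I) (i j : 'I_n) : bool -> R :=
  occ_hi (occupation P (X i j) (tau t)) e.
Definition weight_lo (t : I) (i j : 'I_n) : bool -> R :=
  occ_lo (occupation P (X i j) (tau t)) e.

Lemma measurable_config_event (y : cfg I n) : measurable (config @^-1` [set y]).
Proof.
rewrite (_ : _ @^-1` _ = \bigcap_(k : I * ('I_n * 'I_n))
    (X k.2.1 k.2.2 (tau k.1) @^-1` [set y k])).
  apply: fin_bigcap_measurable => // k _; rewrite -[X in measurable X]setTI.
  by apply: (chain_measurable (jX k.2.1 k.2.2)) => //;
    case/andP: (tauT k.1) => t0 ->; rewrite ltW.
apply/seteqP; split=> [w /= <- k _|w Hw]; first by rewrite /= ffunE.
by apply/ffunP => k; rewrite ffunE; exact: (Hw k).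
Qed.

Let fin_cfg (A : set (cfg I n)) : finite_set A.
Proof. exact: (@finite_finset {ffun I * ('I_n * 'I_n) -> bool} A). Qed.

Lemma config_law (A : set (cfg I n)) : measurable (config @^-1` A) /\
  (P (config @^-1` A) = (\sum_(y | `[< A y >]) fine (P (config @^-1` [set y])))%:E)%E.
Proof.
have -> : config @^-1` A = \bigcup_(y in A) config @^-1` [set y].
  apply/seteqP; split=> [w Aw|w [y Ay /= ->//]]; first by exists (config w).
split; first by apply: fin_bigcup_measurable => [|y _]; [exact: fin_cfg|exact: measurable_config_event].
rewrite measure_fin_bigcup; [|exact: fin_cfg| |by move=> y _; exact: measurable_config_event]; last first.
  by move=> y z _ _ [w [/= -> ->]].
have EA : A = [set` [pred y | `[< A y >]]].
  by apply/seteqP; split=> y; [move=> Ay; apply/asboolP|move/asboolP].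
rewrite (eq_fsbigl _ _ _ EA).
rewrite -(@bigfs _ _ _ _ (index_enum (cfg I n)))//.
- rewrite -sumEFin; apply: eq_big => y; first by rewrite inE.
  by move=> _; rewrite fineK// fin_num_measure//; exact: measurable_config_event.
- exact: index_enum_uniq.
- by move=> y _; rewrite mem_index_enum.
Qed.

Lemma config_eventE (y : cfg I n) : config @^-1` [set y] =
  \bigcap_(ij : 'I_n * 'I_n) path_event (X ij.1 ij.2) tau (fun t => y (t, ij)) ts.
Proof.
have tsI t : t \in ts by rewrite (perm_mem perm_ts) mem_index_enum.
apply/seteqP; split=> [w /= <- [i j] _|w Hw /=].
  by apply/allP => t _ /=; rewrite ffunE.
apply/ffunP => -[t [i j]]; rewrite ffunE /=.
by have /allP/(_ t (tsI t))/eqP := Hw (i, j) Logic.I.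
Qed.

(** A configuration prescribes one path event per pair: independence multiplies over the pairs, and
    [path_law] over the times within each pair. *)
Lemma config_event_law (y : cfg I n) : 
  cfg_weight weight_lo y <= fine (P (config @^-1` [set y])) <= cfg_weight weight_hi y.
Proof.
have allT : all (fun i => tau i <= T) ts by apply/allP => t _; case/andP: (tauT t).
have H ij := path_law T0 (jX ij.1 ij.2) (@mq ij.1 ij.2) (@qM ij.1 ij.2) kap0
  (@kapq ij.1 ij.2) (fun t => y (t, ij)) d00 path_ts allT.
have hist ij : history (X ij.1 ij.2) T
    (path_event (X ij.1 ij.2) tau (fun t => y (t, ij)) ts).
  by have [/andP[_ lT] h _] := H ij; exact: history_le h.
rewrite config_eventE (indX hist) /=.
have E (l : I -> 'I_n -> 'I_n -> bool -> R) : cfg_weight l y =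
    \prod_(ij : 'I_n * 'I_n) \prod_(t <- ts) l t ij.1 ij.2 (y (t, ij)).
  rewrite /cfg_weight /prod_weight exchange_big /= (perm_big _ perm_ts) /=.
  by rewrite pair_bigA; apply: eq_bigr => -[t [i j]].
rewrite !E; apply/andP; split; apply: ler_prod => ij _.
  have [_ _ /andP[-> _]] := H ij; rewrite andbT.
  by apply: prodr_ge0 => t _; rewrite /weight_lo /occ_lo le_max lexx.
by have [_ _ /andP[_ ->]] := H ij; rewrite fine_ge0.
Qed.

Lemma config_bounds (A : set (cfg I n)) :
  \sum_(y | `[< A y >]) cfg_weight weight_lo y <= fine (P (config @^-1` A)) <=
  \sum_(y | `[< A y >]) cfg_weight weight_hi y.
Proof.
rewrite (config_law A).2 /=.
by apply/andP; split; apply: ler_sum => y _; have /andP[] := config_event_law y.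
Qed.

End JointLaw.

(** * Convergence of the occupation probabilities *)

Lemma cvge0_lt (R : realType) (u : nat -> \bar R) (eps : R) :
  (u n @[n --> \oo] --> 0)%E -> 0 < eps -> \forall n \near \oo, (u n < eps%:E)%E.
Proof.
move=> /fine_cvgP[fu /cvgr_lt/(_ eps) ue] eps0; move: (ue eps0) => {}ue.
by apply: filterS2 fu ue => n fn; rewrite /= -lte_fin fineK.
Qed.

(* The Lebesgue integral is defined as the supremum of the integrals of the
   simple functions below the integrand, hence is monotone on nonmeasurable
   functions; suprema over time are only known to be measurable a.e. *)
Lemma le_integral_nonmeasurable d (T : measurableType d) (R : realType)
    (mu : {measure set T -> \bar R}) (D : set T) (f1 f2 : T -> \bar R) :
  (forall x, D x -> (0 <= f1 x)%E) -> (forall x, D x -> (f1 x <= f2 x)%E) ->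
  (\int[mu]_(x in D) f1 x <= \int[mu]_(x in D) f2 x)%E.
Proof.
move=> f10 f12; have f20 x : D x -> (0 <= f2 x)%E.
  by move=> Dx; apply: le_trans (f10 x Dx) (f12 x Dx).
rewrite !ge0_integralE//; apply: le_ereal_sup => _ [h hf <-]; exists h => // x.
by apply: le_trans (hf x) _; apply: lee_restrict.
Qed.

Lemma leb_sqE (R : realType) (A : set (plane R)) :
  leb_sq A = leb2 (A `&` unit_sq).
Proof. by []. Qed.


(** * Exceptional sets of points where the rates misbehave *)

Section Bad.
Context {R : realType}.
Local Notation mu := (@leb_sq R).
Implicit Types (F : plane R -> R -> R).

(** Restricting to rational times makes this a countable union of measurable sets, unlike the
    condition over all times in the interval. *)
Definition bad F (l r e : R) : set (plane R) :=
  [set p | unit_sq p /\ exists q : rat, l < ratr q < r /\ e < `|F p (ratr q)|].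

Lemma bad_measurable F l r e :
  (forall u, l < u < r -> measurable_fun unit_sq (F ^~ u)) -> measurable (bad F l r e).
Proof.
move=> mF; rewrite (_ : bad F l r e = \bigcup_(q : rat)
    (if l < ratr q < r then unit_sq `&` (fun p => `|F p (ratr q)|) @^-1` `]e, +oo[ else set0)).
  apply: countable_bigcupT_measurable => [|q]; first exact: countableP.
  case: ifPn => // lqr.
  have : measurable_fun unit_sq (fun p => `|F p (ratr q)|).
    by apply: measurableT_comp => //; exact: mF.
  by apply => //; exact: measurable_unit_sq.
apply/seteqP; split=> [p [sp [q [lqr eF]]]|p [q _]].
  by exists q => //; rewrite lqr; split=> //=; rewrite in_itv /= eF.
case: ifPn => // lqr [sp /=]; rewrite in_itv /= andbT => eF.
by split=> //; exists q.
Qed.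

(** A left limit at u is tested by rational times just below u. This is why u = r is included
    although the exceptional set only looks at times before r. *)
Lemma bad_le F l r e p u : unit_sq p -> ~ bad F l r e p -> l < u <= r ->
  F p s @[s --> u^'-] --> F p u -> `|F p u| <= e.
Proof.
move=> sp nb /andP[lu ur] Fu; rewrite leNgt; apply/negP => eF.
have /cvgr_gt/(_ e eF) : (fun s => `|F p s|) s @[s --> u^'-] --> `|F p u|.
  exact: cvg_norm.
rewrite near_withinE /= => -[dl dl0 H].
have lt : Num.max l (u - dl) < u by rewrite gt_max lu /= gtrBl.
have [q] := rat_in_itvoo lt; rewrite in_itv /= gt_max => /andP[/andP[lq dq] qu].
apply: nb; split=> //; exists q; rewrite lq (lt_le_trans qu ur); split=> //.
by apply: H => //=; rewrite gtr0_norm ?subr_gt0//; lra.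
Qed.

Lemma bad_mono F l l' r e : l <= l' -> bad F l' r e `<=` bad F l r e.
Proof.
move=> ll p [sp [q [/andP[lq qr] eF]]]; split=> //; exists q.
by rewrite (le_lt_trans ll lq).
Qed.

Lemma bad_markov F l r e (G : plane R -> \bar R) : 0 < e ->
  (forall u, l < u < r -> measurable_fun unit_sq (F ^~ u)) ->
  (forall p u, unit_sq p -> l < u < r -> (`|F p u|%:E <= G p)%E) ->
  (forall p, unit_sq p -> 0 <= G p)%E ->
  (e%:E * mu (bad F l r e) <= \int[leb2]_(p in unit_sq) G p)%E.
Proof.
move=> e0 mF FG G0; have mB := bad_measurable e mF.
rewrite leb_sqE -(integral_indic _ _ mB); last exact: measurable_unit_sq.
rewrite -ge0_integralZl//; last 3 first.
- exact: measurable_unit_sq.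
- by apply/measurable_EFinP; exact: measurable_indic.
- by rewrite lee_fin ltW.
apply: le_integral_nonmeasurable => p sp.
  by rewrite mule_ge0// lee_fin ltW.
rewrite indicE; case: (boolP (p \in _)) => [|_]; last by rewrite mule0 G0.
rewrite inE mule1 => -[_ [q [lqr eF]]].
by apply: le_trans (FG p _ sp lqr); rewrite lee_fin ltW.
Qed.

(** As the window before t shrinks, the exceptional sets decrease to a set on which the left limit
    fails, hence to a null set; continuity from above concludes. *)
Lemma bad_small F t e eps : 0 < t -> 0 < eps ->
  (forall u, 0 <= u <= t -> measurable_fun unit_sq (F ^~ u)) ->
  0 < e -> {ae mu, forall p, F p s @[s --> t^'-] --> 0} ->
  exists2 dl : R, 0 < dl < t & (mu (bad F (t - dl) t e) < eps%:E)%E.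
Proof.
move=> t0 eps0 mF e0 aeF; pose dl k : R := t / k.+2%:R.
have dl0 k : 0 < dl k < t.
  rewrite divr_gt0//= ltr_pdivrMr// ltr_pMr// ltr1n//.
pose A k := bad F (t - dl k) t e.
have mA k : measurable (A k).
  apply: bad_measurable => u /andP[lu ut]; apply: mF; have /andP[_ dt] := dl0 k.
  by apply/andP; split; lra.
have mcap : measurable (\bigcap_k A k) by exact: bigcapT_measurable.
have cap0 : mu (\bigcap_k A k) = 0%E.
  apply/eqP; rewrite -measure_le0; case: aeF => N [mN N0 sub].
  rewrite -N0; apply: le_measure; rewrite ?inE//.
  move=> p Ap; apply: sub => /= Fp.
  have /cvgr_norm_lt/(_ e) := Fp; rewrite normr0 => /(_ e0).
  rewrite near_withinE /= => -[r r0 H].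
  have [k kr] : exists k, dl k <= r.
    exists (Num.bound (t / r)); rewrite ler_pdivrMr// mulrC -ler_pdivrMr//.
    apply: ltW; apply: lt_trans (archi_boundP _) _; last by rewrite ltr_nat.
    by rewrite divr_ge0// ltW.
  have [_ [q [/andP[dq qt] eF]]] := Ap k Logic.I.
  have := H (ratr q); rewrite /= gtr0_norm ?subr_gt0//.
  move=> h; have tq : t - ratr q < r by lra.
  by have := lt_trans eF (h tq qt); rewrite ltxx.
have : (mu \o A) k @[k --> \oo] --> mu (\bigcap_k A k).
  apply: nonincreasing_cvg_mu => //.
    by rewrite -ge0_fin_numE//; exact: leb_sq_fin_num.
  move=> i j ij; apply/subsetPset; apply: bad_mono.
  by rewrite lerD2l lerN2 ler_pM2l// lef_pV2 ?posrE ?ltr0n// ler_nat.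
rewrite cap0 => /cvge0_lt/(_ eps0)/filter_ex[k Ak]; by exists (dl k).
Qed.

End Bad.

Section Slices.
Context {R : realType}.
Local Notation mu := (@leb_sq R).
Local Notation mfun f := (measurable_fun [set: plane R] (f : plane R -> R)).
Variables (T c : R) (b : plane R -> R -> R) (bn : forall n, 'I_n -> 'I_n -> R -> R).
Hypothesis T0 : 0 < T.
Hypothesis hb : standing_rates T c b bn.
Hypothesis ub : uniform_rates T b bn.

Lemma slice_measurable u : 0 <= u <= T -> measurable_fun unit_sq (b ^~ u).
Proof.
move=> uT; apply: (@measurable_comp _ _ _ _ _ _ (unit_sqT T)
  (fun z => b z.1 z.2) unit_sq (fun p => (p, u))); [| |exact: rate_measurable hb|].
- by apply: measurableX; [exact: measurable_unit_sq|exact: measurable_itv].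
- by move=> _ [p sp <-]; split=> //=; rewrite in_itv.
- exact: measurable_funTS (measurable_pair2 _).
Qed.

Lemma measurable_slice u : 0 <= u <= T ->
  measurable_fun [set: plane R] ((b ^~ u) \_ unit_sq).
Proof.
move=> uT; apply: (measurable_restrictT _ measurable_unit_sq).1.
exact: slice_measurable.
Qed.

Definition bad_rate (n : nat) (e : R) : set (plane R) :=
  bad (fun p u => step (fun i j => @bn n i j u) p - b p u) 0 T e.

Lemma bad_rate_slice (n : nat) u : 0 < u < T ->
  measurable_fun unit_sq (fun p => step (fun i j => @bn n i j u) p - b p u).
Proof.
move=> /andP[u0 uT]; apply: measurable_funB.
  exact: measurable_funTS (measurable_step_real _).
by apply: slice_measurable; rewrite !ltW.
Qed.

Lemma measurable_bad_rate n e : measurable (@bad_rate n e).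
Proof. by apply: bad_measurable => u uT; exact: bad_rate_slice. Qed.

Lemma bad_rate_small e eps : 0 < e -> 0 < eps ->
  \forall n \near \oo, (mu (@bad_rate n e) < eps%:E)%E.
Proof.
move=> e0 eps0; have ee := mulr_gt0 e0 eps0.
have := cvge0_lt (unif_rate_cvg ub) ee; apply: filterS => n.
set G := fun p => _; move=> H.
rewrite -(@lte_pmul2l _ e%:E)// ?lte_fin// -EFinM; apply: le_lt_trans H.
apply: bad_markov => //.
- by move=> u uT; exact: bad_rate_slice.
- move=> p u _ /andP[u0 uT]; apply: ereal_sup_ubound; exists u => //=.
  by rewrite in_itv /= !ltW.
- move=> p _; apply: le_trans (ereal_sup_ubound _); last first.
    by exists 0 => //=; rewrite in_itv /= lexx ltW.
  by rewrite lee_fin.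
Qed.

Definition bad_osc t dl e := bad (fun p u => b p u - b p t) (t - dl) t e.

Lemma bad_osc_slice t dl u : t <= T -> dl <= t -> t - dl < u < t ->
  measurable_fun unit_sq (fun p => b p u - b p t).
Proof.
by move=> tT dt /andP[du ut]; apply: measurable_funB; apply: slice_measurable; apply/andP; split; lra.
Qed.

Lemma measurable_bad_osc t dl e : t <= T -> dl <= t -> measurable (bad_osc t dl e).
Proof. by move=> tT dt; apply: bad_measurable => u du; exact: bad_osc_slice du. Qed.

Lemma bad_osc_small t e eps : 0 < t <= T -> 0 < e -> 0 < eps ->
  exists2 dl : R, 0 < dl < t & (mu (bad_osc t dl e) < eps%:E)%E.
Proof.
move=> /andP[t0 tT] e0 eps0; apply: bad_small => //.
  by move=> u /andP[u0 ut]; apply: measurable_funB; apply: slice_measurable; apply/andP; split; lra.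
apply: filterS (rate_regular hb) => p [_ lc].
rewrite -(subrr (b p t)); apply: cvgB; last exact: cvg_cst.
by apply: lc; rewrite t0.
Qed.

(** Off the first set the rates of the n-th model are close to the limiting ones, off the second the
    limiting ones barely move before t. The lower bound c, assumed for the former, passes to the
    latter at time t up to e. *)
Lemma rate_close (n : nat) (i j : 'I_n) p t dl e : left_continuous T (@bn n i j) ->
  left_continuous T (b p) -> unit_sq p -> (cell i `*` cell j) p ->
  0 < t <= T -> dl <= t -> ~ @bad_rate n e p -> ~ bad_osc t dl e p ->
  (c <= b p t + e) /\ (forall u, t - dl < u <= t -> `|@bn n i j u - b p t| <= e + e).
Proof.
move=> lcn lc sp cp /andP[t0 tT] dt nr no.
have stepE u : step (fun i j => @bn n i j u) p = @bn n i j u by rewrite (step_cell _ cp).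
have H u : 0 < u <= T -> `|bn i j u - b p u| <= e.
  move=> uT; rewrite -stepE; apply: (bad_le sp nr uT).
  apply: cvgB; last exact: lc.
  rewrite stepE (_ : (fun s => _) = @bn n i j); first exact: lcn.
  by apply/funext => s; rewrite (step_cell _ cp).
split.
  have tT' : 0 <= t <= T by rewrite ltW.
  have := raten_ge hb i j tT'; have := H t (introT andP (conj t0 tT)).
  by rewrite ler_norml; lra.
move=> u /andP[du ut]; have uT : 0 < u <= T by apply/andP; split; lra.
rewrite -(subrKA (b p u)); apply: le_trans (ler_normD _ _) _; rewrite lerD ?H//.
apply: (bad_le sp no); first by rewrite du.
by apply: cvgB; [exact: lc|exact: cvg_cst].
Qed.

End Slices.

(** A version of w_t with values in (0, 1) at every point of the plane: the arbitrary value 1/2 is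
    taken outside the square and where a limiting rate is not positive. *)
Definition graphon_limit (R : realType) (bp bm : plane R -> R -> R) (t : R) (p : plane R) : R :=
  let u := ((bp ^~ t) \_ unit_sq) p in let v := ((bm ^~ t) \_ unit_sq) p in
  if (0 < u) && (0 < v) then u / (u + v) else 2^-1.

Section GraphonLimit.
Context {R : realType}.
Variables (bp bm : plane R -> R -> R).
Local Notation W := (graphon_limit bp bm).

Lemma graphon_limit01 t p : 0 < W t p < 1.
Proof.
rewrite /graphon_limit /=; case: ifPn => [/andP[u0 v0]|_]; last by lra.
by rewrite divr_gt0 ?addr_gt0//= ltr_pdivrMr ?addr_gt0// mul1r ltrDl.
Qed.

Lemma graphon_limitE t p : unit_sq p -> 0 < bp p t -> 0 < bm p t ->
  W t p = limit_graphon bp bm t p.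
Proof. by move=> sp u0 v0; rewrite /graphon_limit !patchT ?inE// u0 v0. Qed.

Lemma measurable_graphon_limit t :
  measurable_fun [set: plane R] ((bp ^~ t) \_ unit_sq) ->
  measurable_fun [set: plane R] ((bm ^~ t) \_ unit_sq) -> measurable_fun setT (W t).
Proof.
move=> mp mm; apply: measurable_fun_ifT.
- by apply: measurable_and; exact: measurable_fun_ltr.
- by apply: measurable_funM => //; apply: measurable_funV; exact: measurable_funD.
- exact: measurable_cst.
Qed.

End GraphonLimit.

(** * The graph process *)

Lemma quarter_sum (R : realFieldType) (x y z w : \bar R) (r : R) :
  (x < (r / 4)%:E -> y < (r / 4)%:E -> z < (r / 4)%:E -> w < (r / 4)%:E ->
   x + y + (z + w) < r%:E)%E.
Proof.
move=> xr yr zr wr; rewrite (_ : r = r / 4 + r / 4 + (r / 4 + r / 4)); last by field.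
by rewrite (EFinD (_ + _)) (EFinD (r / 4)); apply: lteD; apply: lteD.
Qed.

Lemma gt0_of_close (R : realFieldType) (c e b : R) :
  0 < c -> e <= c / 2 -> c <= b + e -> 0 < b.
Proof. by move=> *; lra. Qed.

Lemma ratio_close (R : realType) (c e theta x y x' y' : R) : 0 < c -> e <= c * theta / 4 ->
  c <= x -> c <= y -> 0 < x' -> 0 < y' -> `|x - x'| <= e + e -> `|y - y'| <= e + e ->
  `|x / (x + y) - x' / (x' + y')| <= theta / 2.
Proof.
move=> c0 ec cx cy x0 y0 hx hy; have c20 : 0 < 2 * c by rewrite mulr_gt0.
apply: le_trans (frac_lip c20 _ (ltW x0) (ltW y0) (addr_gt0 x0 y0)) _; first by lra.
by rewrite ler_pdivrMr//; lra.
Qed.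

Section DistClose.
Context {R : realType}.
Local Notation mu := (@leb_sq R).
Local Notation mfun f := (measurable_fun [set: plane R] (f : plane R -> R)).

Lemma distL1_close (f g : plane R -> R) (S : set (plane R)) (theta : R) : mfun f -> mfun g ->
  measurable S -> (mu S < theta%:E)%E -> 0 <= theta ->
  {ae mu, forall p, `|f p - g p| <= 2 /\ (~ S p -> `|f p - g p| <= theta)} ->
  (distL1 f g <= (3 * theta)%:E)%E.
Proof.
move=> mf mg mS Sth th0 H.
have mind : measurable_fun [set: plane R] (fun p => (2 * \1_S p : R)%:E).
  by apply/measurable_EFinP; apply: measurable_funM => //; exact: mfun_indic.
apply: (@le_trans _ _ (\int[mu]_p (theta%:E + (2 * \1_S p)%:E))%E).
  apply: ae_ge0_le_integral => //.
  - exact: measurable_dist.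
  - by move=> p _; rewrite -EFinD lee_fin addr_ge0// mulr_ge0.
  - exact: emeasurable_funD.
  apply: filterS H => p [h1 h2] _; rewrite -EFinD lee_fin indicE.
  have [pS|pS] := pselect (S p); first by rewrite mem_set// mulr1; lra.
  by rewrite memNset// mulr0 addr0; exact: h2.
rewrite ge0_integralD//.
rewrite integral_cst// [mu setT]leb_sq_setT mule1.
under eq_integral do rewrite EFinM.
rewrite ge0_integralZl//; last by apply/measurable_EFinP; exact: mfun_indic.
rewrite integral_indic// setIT -(fineK (leb_sq_fin_num mS)) -EFinM -EFinD lee_fin.
have : fine (mu S) < theta by rewrite -lte_fin fineK// leb_sq_fin_num.
by lra.
Qed.

Lemma occ_hi_dist (ph e v : R) b : 0 <= e ->
  `|occ_hi ph e b - (if b then v else 1 - v)| <= `|ph - v| + e.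
Proof.
move=> e0; rewrite /occ_hi; have := lexx `|ph - v|; rewrite {1}ler_norml => /andP[].
by case: b => *; rewrite ler_norml; apply/andP; split; lra.
Qed.

Lemma occ_lo_dist (ph e v : R) b : 0 <= e -> 0 <= ph <= 1 ->
  `|occ_lo ph e b - (if b then v else 1 - v)| <= `|ph - v| + e.
Proof.
move=> e0 /andP[p0 p1]; have := lexx `|ph - v|; rewrite {1}ler_norml => /andP[].
rewrite /occ_lo; case: b => * /=; [case: (leP 0 (ph - e)) => *|case: (leP 0 (1 - ph - e)) => *];
  by rewrite ler_norml; apply/andP; split; lra.
Qed.

(** Off S the error is at most theta + e <= 2 theta, and on S it is at most 2; [distL1_close] at
    level 2 theta gives the factor 6. *)
Lemma step_close n (b : bool) (l ph : 'I_n -> 'I_n -> R) (W : plane R -> R)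
    (S : set (plane R)) (theta e : R) : (0 < n)%N -> mfun W ->
  (forall p, 0 < W p < 1) -> (forall i j, 0 <= ph i j <= 1) ->
  measurable S -> (mu S < theta%:E)%E -> 0 <= e <= theta -> theta <= 4^-1 ->
  {ae mu, forall p, ~ S p -> forall i j : 'I_n, (cell i `*` cell j) p ->
    `|ph i j - W p| <= theta} ->
  (forall i j v, `|l i j - (if b then v else 1 - v)| <= `|ph i j - v| + e) ->
  (distL1 (step l) (fun p => if b then W p else (1 - W p)%R) <= (6 * theta)%:E)%E.
Proof.
move=> n0 mW W01 ph01 mS Sth /andP[e0 eth] th4 aeS lph.
rewrite (_ : 6 * theta = 3 * (2 * theta)); last by ring.
apply: (@distL1_close _ _ S) => //.
- exact: measurable_step_real.
- by case: b {lph} => //; exact: measurable_funB.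
- by apply: lt_le_trans Sth _; rewrite lee_fin; lra.
- by lra.
apply: filterS2 aeS (@ae_unit_sq R) => p Sp sp.
have [i [j cp]] := unit_sq_cell n0 sp.
rewrite (step_cell _ cp); have := lph i j (W p); split.
  have /andP[? ?] := W01 p; have /andP[? ?] := ph01 i j.
  have : `|ph i j - W p| <= 1 by rewrite ler_norml; apply/andP; split; lra.
  by lra.
by move=> /Sp/(_ i j cp); lra.
Qed.

End DistClose.

Section Limsup.
Context {R : realType}.
Implicit Types (u : nat -> \bar R) (l : R).

Lemma limn_esup_le u l : (forall eps : R, 0 < eps ->
    \forall n \near \oo, (u n <= (l + eps)%:E)%E) -> (limn_esup u <= l%:E)%E.
Proof.
move=> H; apply/lee_addgt0Pr => eps eps0; rewrite -EFinD.
apply: le_trans (ereal_inf_lbound _) _; first by exists [set n | (u n <= (l + eps)%:E)%E] => //; exact: H.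
by apply: ge_ereal_sup => _ [n un <-].
Qed.

Lemma limn_einf_ge u l : (forall eps : R, 0 < eps ->
    \forall n \near \oo, ((l - eps)%:E <= u n)%E) -> (l%:E <= limn_einf u)%E.
Proof.
move=> H; rewrite leeNr -EFinN; apply: limn_esup_le => eps /H.
by apply: filterS => n; rewrite leeNl -EFinN opprD opprK addrC.
Qed.

Lemma lne_le_expR (x : \bar R) (r : R) : (0 <= x)%E -> (x <= (expR r)%:E)%E -> (lne x <= r%:E)%E.
Proof.
move=> x0 xr; rewrite -[r in leRHS]expRK -lne_EFin ?expR_gt0// lee_lne//.
- by rewrite in_itv /= x0 leey.
- by rewrite in_itv /= lee_fin expR_ge0 leey.
Qed.

Lemma lne_ge_expR (x : \bar R) (r : R) : ((expR r)%:E <= x)%E -> (r%:E <= lne x)%E.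
Proof.
move=> rx; rewrite -[r in leLHS]expRK -lne_EFin ?expR_gt0// lee_lne//.
- by rewrite in_itv /= lee_fin expR_ge0 leey.
- by rewrite in_itv /= leey andbT (le_trans _ rx)// lee_fin expR_ge0.
Qed.

Lemma le_of_lt_EFin (x y : \bar R) : (0 <= x)%E ->
  (forall a : R, (a%:E < x)%E -> (a%:E <= y)%E) -> (x <= y)%E.
Proof.
case: x => [r| |] //= x0 H.
  apply/lee_subgt0Pr => e e0; rewrite -EFinB; apply: H.
  by rewrite lte_fin gtrBl.
by rewrite leye_eq; apply/eqP/eqyP => A _; apply: H; rewrite ltry.
Qed.

End Limsup.

Section SquareIntegral.
Context {R : realType}.
Local Notation mu := (@leb_sq R).

Lemma integral_leb_sq (f : plane R -> \bar R) : measurable_fun [set: plane R] f ->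
  (\int[leb2]_(p in unit_sq) f p = \int[mu]_p f p)%E.
Proof.
move=> mf; have mD := @measurable_unit_sq R.
rewrite -(@eq_measure_integral _ _ _ _ leb2 mu); last first.
  by move=> A mA AD; rewrite leb_sqE setIidl.
rewrite integral_mkcond; apply: ae_eq_integral => //.
  by apply: (measurable_restrictT f mD).1; exact: measurable_funTS.
by apply: filterS (@ae_unit_sq R) => p sp _; rewrite patchT// inE.
Qed.

End SquareIntegral.

(** * Occupation probabilities of the graph process and the two conclusions *)

Section Occupation.
Context {R : realType}.
Local Notation mu := (@leb_sq R).
Variables (T : R) (bp bm : plane R -> R -> R).
Variables (bnp bnm : forall n, 'I_n -> 'I_n -> R -> R) (c : R) (a : nat -> R).
Hypotheses (T0 : 0 < T) (c0 : 0 < c).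
Hypotheses (hbp : standing_rates T c bp bnp) (hbm : standing_rates T c bm bnm).
Hypotheses (hup : uniform_rates T bp bnp) (hum : uniform_rates T bm bnm).
Hypothesis a0 : forall n, (0 < n)%N -> 0 < a n.
Hypothesis a_oo : a n @[n --> \oo] --> +oo.
Variables (d : measure_display) (Om : measurableType d) (P : probability Om R).
Variables (x : forall n, 'I_n -> 'I_n -> bool) (X : forall n, 'I_n -> 'I_n -> R -> Om -> bool).
Arguments X : clear implicits.
Arguments x : clear implicits.
Arguments bnp : clear implicits.
Arguments bnm : clear implicits.

Definition flip_rate n (i j : 'I_n) (t : R) (s : bool) : R :=
  a n * (if s then bnm n i j t else bnp n i j t).

Hypothesis hX : forall n (i j : 'I_n), jump_chain P T (flip_rate i j) (x n i j) (X n i j).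
Hypothesis indX : forall n, independent_processes P T (fun ij : 'I_n * 'I_n => X n ij.1 ij.2).

(** A lower bound for the total flip rate: each of the two directions contributes at least a(n)
    c. *)
Definition relax n : R := a n * (2 * c).

Lemma relax_gt0 n : (0 < n)%N -> 0 < relax n.
Proof. by move=> n0; rewrite !mulr_gt0// a0. Qed.

Lemma flip_rate_ge n (i j : 'I_n) u : (0 < n)%N -> 0 <= u <= T ->
  relax n <= flip_rate i j u false + flip_rate i j u true.
Proof.
move=> n0 uT; rewrite /relax /flip_rate -mulrDr; apply: ler_wpM2l; first exact/ltW/a0.
by have := raten_ge hbp i j uT; have := raten_ge hbm i j uT; lra.
Qed.

Lemma flip_rate_measurable n (i j : 'I_n) s : measurable_fun `[0, T] (flip_rate i j ^~ s).
Proof.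
by case: s; apply: measurable_funM => //; [exact: (raten_measurable hbm)|exact: (raten_measurable hbp)].
Qed.

Lemma rates_regular : \forall n \near \oo, (0 < n)%N /\
  (exists M : R, forall (i j : 'I_n) u s, 0 <= u <= T -> `|flip_rate i j u s| <= M) /\
  (forall i j : 'I_n, left_continuous T (bnp n i j) /\ left_continuous T (bnm n i j)).
Proof.
near=> n.
have n0 : (0 < n)%N by near: n; exact: nbhs_infty_gt.
have Hp : forall i j : 'I_n,
    [bounded bnp n i j t | t in `[0, T]] /\ left_continuous T (bnp n i j).
  by near: n; exact: raten_regular hbp.
have Hm : forall i j : 'I_n,
    [bounded bnm n i j t | t in `[0, T]] /\ left_continuous T (bnm n i j).
  by near: n; exact: raten_regular hbm.
split=> //; split; last by move=> i j; split; [case: (Hp i j)|case: (Hm i j)].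
have [K HK] : exists K : R, forall i j : 'I_n, forall u, 0 <= u <= T ->
    `|bnp n i j u| <= K /\ `|bnm n i j u| <= K.
  have : \forall K \near +oo, forall i j : 'I_n, forall u, 0 <= u <= T ->
    `|bnp n i j u| <= K /\ `|bnm n i j u| <= K.
    apply: filter_forall => i; apply: filter_forall => j.
    have [[Kp [_ HKp]] _] := Hp i j; have [[Km [_ HKm]] _] := Hm i j.
    exists (Num.max Kp Km); split; first exact: num_real.
    move=> K; rewrite gt_max => /andP[KpK KmK] u uT.
    by split; [apply: HKp KpK _ _|apply: HKm KmK _ _]; rewrite /= in_itv.
  by move=> /filter_ex.
exists (a n * K) => i j u s uT; rewrite /flip_rate normrM gtr0_norm ?a0//.
by apply: ler_wpM2l; [exact/ltW/a0|have [? ?] := HK i j u uT; case: s].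
Unshelve. all: by end_near. Qed.

Lemma relax_small r eps : 0 < r -> 0 < eps ->
  \forall n \near \oo, (1 + relax n * r)^-1 <= eps.
Proof.
move=> r0 eps0.
have /cvgryPge/(_ (eps^-1 / (2 * c * r))) := a_oo; apply: filterS => n.
have cr : 0 < 2 * c * r by rewrite !mulr_gt0.
rewrite ler_pdivrMr// => h; rewrite -[leRHS]invrK lef_pV2 ?posrE ?invr_gt0//.
  by rewrite /relax; lra.
by have := invr_gt0 eps; rewrite eps0 /relax; lra.
Qed.

(** Two time scales: off a small set the ratio of the rates is nearly constant on a window before t
    whose length does not depend on [n], while the chain equilibrates there because a(n) tends to
    infinity. *)
Lemma occ_close t theta : 0 < t <= T -> 0 < theta ->
  \forall n \near \oo, exists S : set (plane R), [/\ measurable S, (mu S < theta%:E)%E &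
    {ae mu, forall p, ~ S p -> forall i j : 'I_n, (cell i `*` cell j) p ->
      [/\ 0 < bp p t, 0 < bm p t &
      `|occupation P (X n i j) t - graphon_limit bp bm t p| <= theta]}].
Proof.
move=> tT th0; have /andP[t0 tT'] := tT.
(* The first bound leaves the limiting rates positive; the second turns two rate errors of 2e each,
   over a total rate of at least 2c, into an error theta/2 for the ratio. *)
pose e := Num.min (c / 2) (c * theta / 4).
have e0 : 0 < e by rewrite lt_min !divr_gt0// mulr_gt0.
have e1 : e <= c / 2 by rewrite ge_min lexx.
have e2 : e <= c * theta / 4 by rewrite ge_min lexx orbT.
have th4 : 0 < theta / 4 by rewrite divr_gt0.
have [dp /andP[dp0 dpt] Op] := bad_osc_small hbp tT e0 th4.
have [dm /andP[dm0 dmt] Om'] := bad_osc_small hbm tT e0 th4.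
(* Halving places the closed window [t - r, t] inside both half-open windows on which the rates are
   controlled. *)
pose r := Num.min dp dm / 2.
have r0 : 0 < r by rewrite divr_gt0// lt_min dp0.
have rp : r < dp by have : Num.min dp dm <= dp; [rewrite ge_min lexx|rewrite /r; lra].
have rm : r < dm by have : Num.min dp dm <= dm; [rewrite ge_min lexx orbT|rewrite /r; lra].
have th2 : 0 < theta / 2 by rewrite divr_gt0.
have ev1 := @filterI _ _ eventually_filter _ _ rates_regular (relax_small r0 th2).
have ev2p := bad_rate_small T0 hbp hup e0 th4.
have ev2m := bad_rate_small T0 hbm hum e0 th4.
apply: filterS3 ev1 ev2p ev2m => n [[n0 [[M HM] lc]] rel] Rp Rm.
have m1 := measurable_bad_rate hbp n e; have m2 := measurable_bad_rate hbm n e.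
have m3 := measurable_bad_osc hbp e tT' (ltW dpt).
have m4 := measurable_bad_osc hbm e tT' (ltW dmt).
exists ((bad_rate T bp bnp n e `|` bad_rate T bm bnm n e) `|`
        (bad_osc bp t dp e `|` bad_osc bm t dm e)); split.
- by do !apply: measurableU.
- apply: le_lt_trans (measureU2 _ _ _) _; [exact: measurableU..|].
  apply: le_lt_trans (leeD (measureU2 _ m1 m2) (measureU2 _ m3 m4)) _.
  exact: quarter_sum Rp Rm Op Om'.
apply: filterS3 (rate_regular hbp) (rate_regular hbm) (@ae_unit_sq R).
move=> p [_ lp] [_ lm] sp nS i j cp.
have [lnp lnm] := lc i j.
have [B1 H1] : c <= bp p t + e /\
    (forall u, t - dp < u <= t -> `|bnp n i j u - bp p t| <= e + e).
  apply: (rate_close hbp lnp lp sp cp tT (ltW dpt)) => h; apply: nS; first by left; left.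
  by right; left.
have [B2 H2] : c <= bm p t + e /\
    (forall u, t - dm < u <= t -> `|bnm n i j u - bm p t| <= e + e).
  apply: (rate_close hbm lnm lm sp cp tT (ltW dmt)) => h; apply: nS; first by left; right.
  by right; right.
have bp0 := gt0_of_close c0 e1 B1; have bm0 := gt0_of_close c0 e1 B2.
split=> //.
have /andP[w0 w1] := graphon_limit01 bp bm t p.
have rt := ltW (lt_trans rp dpt).
rewrite [theta]splitr; apply: le_trans (_ : theta / 2 + (1 + relax n * r)^-1 <= _).
  apply: (occupation_equilibrium (hX i j) (@flip_rate_measurable n i j) (@HM i j)
    (relax_gt0 n0) (fun u => flip_rate_ge i j n0)) => //.
  - exact: ltW.
  - by rewrite !ltW.
  - exact: ltW.
  move=> u /andP[ru ut]; rewrite graphon_limitE// /limit_graphon /flip_rate.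
  have uT : 0 <= u <= T by rewrite (le_trans ut tT') (le_trans _ ru)// subr_ge0.
  rewrite -mulrDr -mulf_div divff ?mul1r; last exact: (negbT (gt_eqF (a0 n0))).
  apply: (ratio_close c0 e2 (raten_ge hbp i j uT) (raten_ge hbm i j uT) bp0 bm0).
    by apply: H1; rewrite ut andbT (lt_le_trans _ ru)// ltrD2l ltrN2.
  by apply: H2; rewrite ut andbT (lt_le_trans _ ru)// ltrD2l ltrN2.
by rewrite lerD2l.
Qed.

Lemma weights_near (I : finType) (tau : I -> R) (d0 eta : R) :
  (forall i, 0 < tau i <= T) -> 0 < d0 -> 0 < eta ->
  \forall n \near \oo,
    near_weights (fun t => graphon_limit bp bm (tau t)) eta
      (weight_hi P (relax n) (X n) tau d0) /\
    near_weights (fun t => graphon_limit bp bm (tau t)) eta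
      (weight_lo P (relax n) (X n) tau d0).
Proof.
(* With theta <= 1/4 the lower weights keep total mass at least 1 - 2/4 = 1/2; with theta <= eta/8
   the bound 6 theta of [step_close] is below eta. *)
move=> tauT d00 eta0; pose theta := Num.min (4^-1) (eta / 8).
have th0 : 0 < theta by rewrite lt_min invr_gt0 divr_gt0// andbT ltr0n.
have th4 : theta <= 4^-1 by rewrite ge_min lexx.
have th8 : theta <= eta / 8 by rewrite ge_min lexx orbT.
have ev1 : \forall n \near \oo, forall t : I, exists S : set (plane R),
  [/\ measurable S, (mu S < theta%:E)%E &
    {ae mu, forall p, ~ S p -> forall i j : 'I_n, (cell i `*` cell j) p ->
      [/\ 0 < bp p (tau t), 0 < bm p (tau t) &
      `|occupation P (X n i j) (tau t) - graphon_limit bp bm (tau t) p| <= theta]}].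
  by apply: filter_forall => t; exact: occ_close.
apply: filterS3 ev1 (relax_small d00 th0) rates_regular => n oc rel [n0 [[M HM] _]].
have ph01 t (i j : 'I_n) : 0 <= occupation P (X n i j) (tau t) <= 1.
  apply: (occupation01 (hX i j)); case/andP: (tauT t) => t0 ->; by rewrite ltW.
have e0 : 0 <= (1 + relax n * d0)^-1.
  by rewrite invr_ge0 addr_ge0// mulr_ge0// ltW// relax_gt0.
have e0t : 0 <= (1 + relax n * d0)^-1 <= theta by rewrite e0.
have eth := conj e0 rel.
have close (l : I -> 'I_n -> 'I_n -> bool -> R) t b :
    (forall i j b v, `|l t i j b - (if b then v else 1 - v)| <=
      `|occupation P (X n i j) (tau t) - v| + (1 + relax n * d0)^-1) ->
    (distL1 (step (fun i j => l t i j b))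
      (fun p => if b then graphon_limit bp bm (tau t) p else (1 - graphon_limit bp bm (tau t) p)%R)
      < eta%:E)%E.
  move=> lph; have [S [mS Sth aeS]] := oc t.
  apply: le_lt_trans (step_close (ph := fun i j => occupation P (X n i j) (tau t)) n0 _
    (graphon_limit01 bp bm (tau t)) (ph01 t) mS Sth e0t th4 _ _) _.
  - have tT : 0 <= tau t <= T by case/andP: (tauT t) => t0 ->; rewrite ltW.
    by apply: measurable_graphon_limit;
      [exact: (measurable_slice hbp tT)|exact: (measurable_slice hbm tT)].
  - by apply: filterS aeS => p h /h{}h i j /h[].
  - by move=> i j v; exact: lph.
  - by rewrite lte_fin; lra.
split=> t.
  have hi i j b v := occ_hi_dist (occupation P (X n i j) (tau t)) v b e0.
  split; [move=> i j b|move=> i j|exact: (close _ t true)|exact: (close _ t false)].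
    have /andP[? ?] := ph01 t i j.
    by rewrite /weight_hi /occ_hi; case: b; lra.
  by rewrite /weight_hi /occ_hi; lra.
have lo i j b v := occ_lo_dist v b e0 (ph01 t i j).
split; [by move=> i j b; rewrite le_max lexx|move=> i j|
  exact: (close _ t true)|exact: (close _ t false)].
have le_max2 (u v : R) : v <= Num.max u v by rewrite le_max lexx orbT.
rewrite /weight_lo /occ_lo.
have h1 := le_max2 0 (1 - occupation P (X n i j) (tau t) - (1 + relax n * d0)^-1).
have h2 := le_max2 0 (occupation P (X n i j) (tau t) - (1 + relax n * d0)^-1).
by lra.
Qed.


Local Notation W := (graphon_limit bp bm).

(** A lower bound is assumed for the rates of the n-th model only. [occ_close] gives positivity of
    the limiting rates off sets of arbitrarily small measure, hence almost everywhere. *)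
Lemma limit_rates_gt0 t : 0 < t <= T ->
  {ae mu, forall p, [/\ unit_sq p, 0 < bp p t & 0 < bm p t]}.
Proof.
move=> tT; have /andP[t0 tT'] := tT; have tT0 : 0 <= t <= T by rewrite ltW.
pose u := (bp ^~ t) \_ unit_sq; pose v := (bm ^~ t) \_ unit_sq.
have mu' : measurable_fun [set: plane R] u.
  exact: (measurable_slice hbp tT0).
have mv : measurable_fun [set: plane R] v.
  exact: (measurable_slice hbm tT0).
have mpos (f : plane R -> R) : measurable_fun [set: plane R] f ->
    measurable (f @^-1` `]0, +oo[).
  by move=> mf; rewrite -[X in measurable X]setTI; apply: mf.
pose Z := ~` (unit_sq `&` (u @^-1` `]0, +oo[ `&` v @^-1` `]0, +oo[)).
have mZ : measurable Z.
  apply: measurableC; apply: measurableI; first exact: measurable_unit_sq.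
  by apply: measurableI; exact: mpos.
exists Z; split=> //; last first.
  move=> p /= H [sp []]; rewrite /= !in_itv /= !andbT /u /v !patchT ?inE// => u0 v0.
  by apply: H.
apply/eqP; rewrite -measure_le0; apply/lee_addgt0Pr => e e0; rewrite add0e.
have := @filterI _ _ eventually_filter _ _ (nbhs_infty_gt 0%N)
  (occ_close tT e0).
move=> /filter_ex[n [n0 [S [mS Se aeS]]]].
have [N [mN N0 sub]] : {ae mu, forall p, unit_sq p /\ (~ S p -> forall i j : 'I_n,
    (cell i `*` cell j) p -> 0 < bp p t /\ 0 < bm p t)}.
  apply: filterS2 (@ae_unit_sq R) aeS => p sp H; split=> // nS i j cp.
  by have [] := H nS i j cp.
apply: (@le_trans _ _ (mu (S `|` N))).
  apply: le_measure; rewrite ?inE//; first exact: measurableU.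
  move=> p Zp; have [Sp|nS] := pselect (S p); [by left|right].
  apply: sub => -[sp H]; apply: Zp; have [i [j cp]] := unit_sq_cell n0 sp.
  have [b1 b2] := H nS i j cp.
  by split=> //; rewrite /u /v; split; rewrite /= in_itv /= patchT ?inE// andbT.
have N0' : (mu N <= 0)%E by rewrite N0.
apply: le_trans (measureU2 _ mS mN) _; rewrite -[leRHS]adde0.
by apply: leeD N0'; exact: ltW.
Qed.

Lemma graphon_limit_ae t : 0 < t <= T -> {ae mu, forall p, W t p = limit_graphon bp bm t p}.
Proof.
by move=> tT; apply: filterS (limit_rates_gt0 tT) => p [sp ? ?]; exact: graphon_limitE.
Qed.

Lemma measurable_W t : 0 < t <= T -> measurable_fun [set: plane R] (W t).
Proof.
move=> /andP[t0 tT]; have tT0 : 0 <= t <= T by rewrite ltW.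
by apply: measurable_graphon_limit;
  [exact: (measurable_slice hbp tT0)|exact: (measurable_slice hbm tT0)].
Qed.

Lemma Ipoint_rate (Ts : {fset R}) : (forall t, t \in Ts -> 0 < t <= T) ->
  Ipoint bp bm (Ts := Ts) = rate (fun t : Ts => W (val t)).
Proof.
move=> TsT; apply/funext => f; apply: eq_bigr => t _.
have tT := TsT (val t) (valP t); have /andP[t0 tT'] := tT.
have tT0 : 0 <= val t <= T by rewrite ltW.
pose u := (bp ^~ (val t)) \_ unit_sq; pose v := (bm ^~ (val t)) \_ unit_sq.
have mu' : measurable_fun [set: plane R] u.
  exact: (measurable_slice hbp tT0).
have mv : measurable_fun [set: plane R] v.
  exact: (measurable_slice hbm tT0).
have mL : measurable_fun [set: plane R] (fun p => u p / (u p + v p)).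
  by apply: measurable_funM => //; apply: measurable_funV; exact: measurable_funD.
have uvE p : unit_sq p -> limit_graphon bp bm (val t) p = u p / (u p + v p).
  by move=> sp; rewrite /u /v !patchT ?inE.
rewrite (eq_integral (fun p => (Q2 ((val (f t) : L2) p) (u p / (u p + v p)))%:E)); last first.
  by move=> p; rewrite inE => /uvE ->.
rewrite integral_leb_sq; last first.
  by apply/measurable_EFinP; apply: measurable_Q2 => //; exact: L2_measurable.
apply: ae_eq_integral => //.
- by apply/measurable_EFinP; apply: measurable_Q2 => //; exact: L2_measurable.
- apply/measurable_EFinP; apply: measurable_Q2; first exact: L2_measurable.
  exact: measurable_W.
apply: filterS2 (@ae_unit_sq R) (graphon_limit_ae tT) => p sp Wp _.
by rewrite Wp uvE.
Qed.

(** The only estimate through which the probabilities of the chains enter the two conclusions. *)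
Lemma config_near (I : finType) (tau : I -> R) : injective tau ->
  (forall i, 0 < tau i <= T) -> forall eta : R, 0 < eta -> \forall n \near \oo, (0 < n)%N /\
  exists lo hi : I -> 'I_n -> 'I_n -> bool -> R,
    [/\ near_weights (fun t => W (tau t)) eta lo, near_weights (fun t => W (tau t)) eta hi &
    forall A : set (cfg I n),
      \sum_(y | `[< A y >]) cfg_weight lo y <= fine (P (config (X n) tau @^-1` A)) <=
      \sum_(y | `[< A y >]) cfg_weight hi y].
Proof.
move=> tau_inj tauT eta eta0.
have tau0 i : 0 < tau i by case/andP: (tauT i).
have [ts [d0 d00 [perm_ts path_ts]]] := time_gap tau_inj tau0.
have ev := weights_near tauT d00 eta0.
apply: filterS2 ev (rates_regular) => n [hi lo] [n0 [[M HM] _]].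
split=> //; exists (weight_lo P (relax n) (X n) tau d0).
exists (weight_hi P (relax n) (X n) tau d0); split=> // A.
have kq := fun i j u => @flip_rate_ge n i j u n0.
have mq := @flip_rate_measurable n.
have cb := config_bounds T0 (@hX n) (@indX n) mq HM.
have := cb _ (relax_gt0 n0) kq I tau ts d0 tauT d00 perm_ts path_ts A.
exact.
Qed.

Section TimePoints.
Variable Ts : {fset R}.
Hypothesis TsT : forall t, t \in Ts -> 0 < t <= T.

Let tau (t : Ts) : R := val t.
Let tau_inj : injective tau. Proof. exact: val_inj. Qed.
Let tauT t : 0 < tau t <= T. Proof. by apply: TsT; exact: valP. Qed.
Let WT (t : Ts) : plane R -> R := W (tau t).
Let mWT t : measurable_fun [set: plane R] (WT t). Proof. exact: measurable_W. Qed.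
Let WT01 t p : 0 < WT t p < 1. Proof. exact: graphon_limit01. Qed.

Let Y n om : {ptws Ts -> @S0 R} := fun t : Ts => graphon (fun i j => X n i j (val t) om).

Let YE n om : Y n om = cfg_graphon (config (X n) tau om).
Proof.
apply/funext => t; rewrite /cfg_graphon; congr graphon.
by apply/funext => i; apply/funext => j; rewrite ffunE.
Qed.

Let Y_preimage n (A : set {ptws Ts -> @S0 R}) :
  Y n @^-1` A = config (X n) tau @^-1` [set y | A (cfg_graphon y)].
Proof. by apply/seteqP; split=> om; rewrite /= YE. Qed.

(** [Y n] factors through the finite set of configurations, so the preimage of any set whatsoever is
    measurable. *)
Let measurable_Y n (A : set {ptws Ts -> @S0 R}) : measurable (Y n @^-1` A).
Proof. by rewrite Y_preimage; case: (config_law (@hX n) tauT [set y | A (cfg_graphon y)]). Qed.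

Let rescale n (r : R) : (0 < n)%N ->
  ((n%:R ^- 2)%:E * (n%:R ^+ 2 * r)%:E = r%:E)%E.
Proof. by move=> n0; rewrite -EFinM mulrA mulVf ?mul1r// expf_neq0// pnatr_eq0 -lt0n. Qed.

Lemma graphon_LDP : satisfies_LDP P Y (fun n => n%:R ^+ 2) (rate WT).
Proof.
split.
- by move=> n n0; rewrite exprn_gt0// ltr0n.
- by move=> n U _; exact: measurable_Y.
- by split; [move=> f; exact: rate_ge0 mWT WT01 f|move=> r; exact: compact_rate].
- move=> F cF; rewrite leeNr; apply: le_of_lt_EFin.
    by apply: le_ereal_inf_tmp => _ [f _ <-]; exact: rate_ge0.
  (* Real levels strictly below the infimum include the case of an infinite infimum and supply the
     strict inequality that [graphon_upper] asks on F. *)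
  move=> r rF; rewrite leeNr -EFinN; apply: limn_esup_le => eps eps0.
  have aF f : F f -> (r%:E < rate WT f)%E.
    by move=> Ff; apply: lt_le_trans rF _; apply: ereal_inf_lbound; exists f.
  have [eta eta0 H] := graphon_upper mWT WT01 cF aF eps0.
  apply: filterS2 H (config_near tau_inj tauT eta0) => n H [n0 [lo [hi [_ nhi HP]]]].
  have n20 : 0 < n%:R ^- 2 :> R by rewrite invr_gt0 exprn_gt0// ltr0n.
  rewrite -(rescale (- r + eps) n0); apply: lee_wpmul2l; first by rewrite lee_fin ltW.
  apply: lne_le_expR => //; rewrite -(fineK (fin_num_measure P _ (measurable_Y n F))) lee_fin.
  rewrite Y_preimage; have /andP[_ h] := HP [set y | F (cfg_graphon y)].
  apply: le_trans h _; apply: le_trans (H hi nhi) _.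
  by rewrite ler_expR; lra.
- move=> G oG; rewrite leeNl; apply: le_ereal_inf_tmp => _ [f Gf <-].
  case E : (rate WT f) => [r| |]; [|by rewrite leey|by have := rate_ge0 mWT WT01 f; rewrite E].
  rewrite leeNl -EFinN; apply: limn_einf_ge => eps eps0.
  have fr : (rate WT f <= r%:E)%E by rewrite E.
  have [eta eta0 H] := graphon_lower mWT WT01 oG Gf fr eps0.
  apply: filterS2 H (config_near tau_inj tauT eta0) => n H [n0 [lo [hi [nlo _ HP]]]].
  have n20 : 0 < n%:R ^- 2 :> R by rewrite invr_gt0 exprn_gt0// ltr0n.
  rewrite -(rescale (- r - eps) n0); apply: lee_wpmul2l; first by rewrite lee_fin ltW.
  apply: lne_ge_expR; rewrite -(fineK (fin_num_measure P _ (measurable_Y n G))) lee_fin.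
  rewrite Y_preimage; have /andP[h _] := HP [set y | G (cfg_graphon y)].
  apply: le_trans _ h; apply: le_trans _ (H lo nlo).
  by rewrite ler_expR; lra.
Qed.

End TimePoints.

Lemma measurable_lim_sup_set (F : (set Om)^nat) : (forall n, measurable (F n)) ->
  measurable (lim_sup_set F).
Proof.
by move=> mF; apply: bigcapT_measurable => n; apply: bigcup_measurable => k _; exact: mF.
Qed.

Lemma expR_sqr_half (kap : R) : 0 < kap ->
  \forall n \near \oo, 2 * expR (- (n%:R ^+ 2 * kap)) <= 1 / (2 ^ n.+1)%:R.
Proof.
(* Once n kap > 7, exp(n kap) is at least 8, so the exponential is at most 8^(-n), and 2 times
   2^(n+1) is at most 8^n for n >= 1. The target is the general term of a geometric series of sum
   1. *)
move=> k0; have := nbhs_infty_gtr (7 / kap); apply: filterS2 (nbhs_infty_gt 0%N) => n n0.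
rewrite ltr_pdivrMr// => hn.
have h8 : 8 <= expR (n%:R * kap) by apply: le_trans (expR_ge1Dx _); lra.
have h : 8 ^+ n <= expR (n%:R ^+ 2 * kap).
  rewrite expr2 -mulrA expRM_natl; apply: lerXn2r => //;
    by rewrite nnegrE ?expR_ge0.
have h4 : 2 * 2 ^+ n.+1 <= (8 : R) ^+ n.
  rewrite (_ : (8 : R) = 4 * 2); last by ring.
  rewrite exprMn exprS mulrA; apply: ler_wpM2r; first exact: exprn_ge0.
  case: n n0 {hn h8 h} => // n _; rewrite exprS.
  have := @exprn_ege1 R n 4; lra.
have p2 : 0 < (2 : R) ^+ n.+1 by rewrite exprn_gt0.
rewrite natrX expRN ler_pdivlMr// mulrAC ler_pdivrMr ?expR_gt0// mul1r.
by apply: le_trans h4 _.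
Qed.

Lemma pairing_ae t (phi : plane R -> R) (K dl : R) : 0 < t <= T -> 0 < K -> 0 < dl ->
  measurable_fun [set: plane R] phi -> (forall p, `|phi p| <= K) ->
  {ae P, forall om, \forall n \near \oo,
    `|pairing (config (X n) (fun _ : unit => t) om) tt phi -
      \int[mu]_p (W t p * phi p)| < dl}.
Proof.
move=> tT K0 dl0 mphi phiK; pose tau (_ : unit) := t.
have tau_inj : injective tau by case=> -[].
have tauT i : 0 < tau i <= T by [].
have mWt (i : unit) : measurable_fun [set: plane R] (W (tau i)) by exact: measurable_W.
have W01 (i : unit) p : 0 < W (tau i) p < 1 by exact: graphon_limit01.
have [kap kap0 [eta eta0 H]] := weight_concentration mWt W01 tt K0 dl0 mphi phiK.
pose bad_cfg n : set (cfg unit n) :=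
  [set y | dl <= `|pairing y tt phi - \int[mu]_p (W t p * phi p)|].
pose E n := config (X n) tau @^-1` bad_cfg n.
have mE n : measurable (E n) by case: (config_law (@hX n) tauT (bad_cfg n)).
have : \forall n \near \oo, (P (E n) <= (1 / (2 ^ n.+1)%:R)%:E)%E.
  apply: filterS3 H (config_near tau_inj tauT eta0) (expR_sqr_half kap0).
  move=> n H [n0 [lo [hi [_ nhi HP]]]] h2.
  rewrite -(fineK (fin_num_measure P _ (mE n))) lee_fin.
  have /andP[_ h] := HP (bad_cfg n); apply: le_trans h _; apply: le_trans _ h2.
  apply: le_trans _ (H hi nhi); rewrite le_eqVlt; apply/orP; left; apply/eqP.
  by apply: eq_bigl => y; rewrite asboolb.
(* The bound holds from N on only; empty sets before N make the whole series summable without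
   changing the limsup. *)
move=> [N _ HN]; pose F n := if (N <= n)%N then E n else set0.
have mF n : measurable (F n) by rewrite /F; case: ifP.
have sumF : (\sum_(n <oo) P (F n) < +oo)%E.
  apply: (@le_lt_trans _ _ (\sum_(n <oo) (1 / (2 ^ n.+1)%:R)%:E)%E).
    apply: lee_nneseries => // n _; rewrite /F; case: ifPn => [Nn|_]; first exact: HN.
    by rewrite measure0 lee_fin divr_ge0.
  by apply: le_lt_trans (epsilon_trick0 _ _) (ltry 1).
exists (lim_sup_set F); split.
- exact: measurable_lim_sup_set.
- exact: lim_sup_set_cvg0.
- move=> om /= nom n _; apply: contrapT => nF; apply: nom.
  exists (maxn n N) => // k; rewrite /= geq_max => /andP[nk Nk].
  rewrite ltNge; apply/negP => h; apply: nF; exists k => //.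
  by rewrite /F Nk.
Qed.

(** Weak convergence is tested by countably many cells and tolerances 1/(k+1), so the null sets of
    [pairing_ae] add up to a null set. *)
Lemma graphon_ae t : 0 < t <= T -> exists2 w : @S0 R,
  {ae leb_sq, forall p, val w p = limit_graphon bp bm t p} &
  {ae P, forall om, graphon (fun i j => X n i j t om) @[n --> \oo] --> w}.
Proof.
move=> tT; have W01 p : 0 <= W t p <= 1 by have /andP[? ?] := graphon_limit01 bp bm t p; rewrite !ltW.
have [w wW] := S0_of_fun (measurable_W tT) W01; exists w.
  by apply: filterS2 wW (graphon_limit_ae tT) => p -> ->.
pose tau (_ : unit) := t.
pose phi m (i j : 'I_m) : plane R -> R := \1_(cell i `*` cell j).
have mphi m (i j : 'I_m) : measurable_fun [set: plane R] (phi m i j).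
  by apply: mfun_indic; apply: measurableX; exact: measurable_cell.
have phi1 m (i j : 'I_m) p : `|phi m i j p| <= 1.
  by rewrite /phi indicE; case: (_ \in _); rewrite ?normr1 ?normr0.
have : {ae P, forall om (m k : nat) (i j : 'I_m), \forall n \near \oo,
    `|pairing (config (X n) tau om) tt (phi m i j) -
      \int[mu]_p (W t p * phi m i j p)| < k.+1%:R^-1}.
  apply: ae_foralln => m; apply: ae_foralln => k.
  apply: filter_forall => i; apply: filter_forall => j.
  exact: (@pairing_ae t _ 1).
apply: filterS => om H; apply: S0_cvg_cells => m i j.
have -> : cell_integral i j (val w : L2) = \int[mu]_p (W t p * phi m i j p).
  apply: ae_eq_Rintegral; last by apply: filterS wW => p /= ->.
    by apply: measurable_funM; [exact: L2_measurable|exact: mphi].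
  by apply: measurable_funM; [exact: measurable_W|exact: mphi].
apply/cvgrPdist_lt => e e0.
have [k ke] : exists k, k.+1%:R^-1 < e.
  exists (Num.bound e^-1); rewrite -[ltRHS]invrK ltf_pV2 ?posrE ?invr_gt0//.
  apply: lt_trans (archi_boundP _) _; last by rewrite ltr_nat.
  by rewrite invr_ge0 ltW.
apply: filterS (H m k i j) => n; rewrite distrC => h; apply: lt_trans ke; apply: le_lt_trans h.
rewrite le_eqVlt; apply/orP; left; apply/eqP; congr (`|_ - _|).
rewrite -(pairing_graphon _ _ (mphi m i j)) /cell_integral /cfg_graphon.
congr Rintegral; apply/funext => p; congr (_ * _); congr ((val (graphon _) : L2) p).
by apply/funext => i'; apply/funext => j'; rewrite ffunE.
Qed.

End Occupation.

Theorem proposition3p9 (R : realType) (T : R) (hT : 0 < T)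
  (bp bm : plane R -> R -> R)
  (bnp bnm : forall n, 'I_n -> 'I_n -> R -> R)
  (c : R) (hc : 0 < c)
  (hbp : standing_rates T c bp bnp) (hbm : standing_rates T c bm bnm)
  (a : nat -> R) (ha : forall n, (0 < n)%N -> 0 < a n)
  (ha_oo : a n @[n --> \oo] --> +oo)
  (d : measure_display) (Om : measurableType d) (P : probability Om R)
  (x : forall n, 'I_n -> 'I_n -> bool)
  (X : forall n, 'I_n -> 'I_n -> R -> Om -> bool)
  (hX : forall n (i j : 'I_n),
     jump_chain P T
       (fun t s => a n * (if s then bnm n i j t else bnp n i j t))
       (x n i j) (X n i j))
  (hXind : forall n,
     independent_processes P T
       (fun ij : 'I_n * 'I_n => X n ij.1 ij.2))
  (hup : uniform_rates T bp bnp) (hum : uniform_rates T bm bnm) :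
  (forall t, 0 < t <= T ->
     exists2 w : @S0 R,
       {ae leb_sq, forall p, val w p = limit_graphon bp bm t p} &
       {ae P, forall om,
         graphon (fun i j => X n i j t om) @[n --> \oo] --> w}) /\
  (forall Ts : {fset R}, (forall t, t \in Ts -> 0 < t <= T) ->
     satisfies_LDP P
       (fun n om => (fun t : Ts => graphon (fun i j => X n i j (val t) om))
                    : {ptws Ts -> @S0 R})
       (fun n => n%:R ^+ 2)
       (@Ipoint R bp bm Ts)).
Proof.
have hX' n (i j : 'I_n) : jump_chain P T (flip_rate bnp bnm a i j) (x n i j) (X n i j).
  exact: hX.
split=> [t tT|Ts TsT].
  exact: (graphon_ae hT hc hbp hbm hup hum ha ha_oo hX' hXind tT).
rewrite (Ipoint_rate hT hc hbp hbm hup hum ha ha_oo hX' TsT).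
exact: (graphon_LDP hT hc hbp hbm hup hum ha ha_oo hX' hXind TsT).
Qed.
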